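(* Let $p \in \mathbb{N}$, $p \geq 1$. For each integer $n \geq 4p+3$ there exists a 3-triangulable $p$-toroid $P$ with $n$ vertices such that $$T_{\min}(P) = n + 3(p-1).$$
   Context: Polyhedra are solid polyhedra in three-dimensional Euclidean space $\mathbb{R}^3$ (a solid together with its polyhedral boundary surface). For a natural number $p \geq 1$, a $p$-toroid is an ordinary polyhedron which is topologically equivalent to a sphere with $p$ handles (i.e. its boundary surface is homeomorphic to the closed orientable surface of genus $p$) and whose faces are simple polygons. A 3-triangulation of a polyhedron $P$ is a division of $P$ into finitely many (non-degenerate) tetrahedra with pairwise disjoint interiors, whose union is $P$ and all of whose vertices are vertices of $P$ (no new vertices are allowed). The tetrahedra fit together face-to-face: two distinct tetrahedra of the division either share a common face, or share only a common edge or only a common vertex, or have no common points. A polyhedron is 3-triangulable if it has at least one 3-triangulation. For a 3-triangulable polyhedron $P$, $T_{\min}(P)$ denotes the smallest number of tetrahedra in a 3-triangulation of $P$. *)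

(* Defs.v *)
From mathcomp Require Import all_boot all_order all_algebra.
From mathcomp Require Import boolp classical_sets reals topology normedtype.

Set Implicit Arguments.
Unset Strict Implicit.
Unset Printing Implicit Defensive.

Import Order.TTheory GRing.Theory Num.Theory.
Import numFieldNormedType.Exports.

Local Open Scope classical_set_scope.
Local Open Scope ring_scope.

Notation point R := ('rV[R]_3) (only parsing).

Definition frontier (T : topologicalType) (A : set T) : set T :=
  closure A `\` A°.

Definition homeomorphic (T U : topologicalType) (A : set T) (B : set U) : Prop :=
  exists (f : T -> U) (g : U -> T),
    [/\ {within A, continuous f}, {within B, continuous g},
        f @` A `<=` B, g @` B `<=` A
      & {in A, cancel f g} /\ {in B, cancel g f}].

(** Affine and convex hulls of a finite family of points. *)

Definition affine_hull (R : realType) (s : seq (point R)) : set (point R) :=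
  [set x | exists w : 'I_(size s) -> R,
     \sum_i w i = 1 /\ x = \sum_i w i *: s`_i].

Definition hull (R : realType) (s : seq (point R)) : set (point R) :=
  [set x | exists w : 'I_(size s) -> R,
     [/\ forall i, 0 <= w i, \sum_i w i = 1 & x = \sum_i w i *: s`_i]].

Definition segment (R : realType) (a b : point R) : set (point R) :=
  hull [:: a; b].

Definition coplanar (R : realType) (s : seq (point R)) : Prop :=
  exists2 u : 'cV[R]_3, u != 0 & {in s &, forall a b, a *m u = b *m u}.

(** A polygon is given by the cyclic sequence [s] of its vertices, so that its
    sides are the segments from [a] to [next s a]. *)

Definition is_side (R : realType) (s : seq (point R)) (a b : point R) : bool :=
  [&& a \in s, b \in s & (b == next s a) || (a == next s b)].

Definition polygon_curve (R : realType) (s : seq (point R)) : set (point R) :=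
  \bigcup_(a in [set a | a \in s]) segment a (next s a).

(* The last clause says that two sides meet at most in a common end point; it
   excludes collinear triangles, hence all collinear sequences. *)
Definition simple_polygon (R : realType) (s : seq (point R)) : Prop :=
  [/\ (3 <= size s)%N, uniq s, coplanar s
    & {in s &, forall a b, a != b -> forall x,
         segment a (next s a) x -> segment b (next s b) x ->
         x \in [:: a; next s a] /\ x \in [:: b; next s b]}].

(* For a simple polygon, [affine_hull s] is the plane of the polygon, and the
   bounded component of the complement of the curve in it is its interior. *)
Definition polygon_region (R : realType) (s : seq (point R)) : set (point R) :=
  polygon_curve s `|`
  [set x | (affine_hull s `\` polygon_curve s) x /\
     bounded_set (connected_component (affine_hull s `\` polygon_curve s) x)].

(** A solid polyhedron together with the polygonal faces that make up its
    boundary surface.  Faces sharing an edge are not coplanar and at least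
    three faces meet at each vertex, so that the faces, edges and vertices are
    the geometric ones: a face cannot be subdivided, and no vertex can be added
    inside a face or an edge. *)
Record polyhedron (R : realType) := Polyhedron {
  body : set (point R);
  nface : nat;
  face : 'I_nface -> seq (point R);
  body_compact : compact body;
  body_solid : closure body° = body;
  face_simple : forall i, simple_polygon (face i);
  frontier_body : frontier body = \bigcup_i polygon_region (face i);
  face_meet : forall i j, i != j -> forall x,
    polygon_region (face i) x -> polygon_region (face j) x ->
    (x \in face i /\ x \in face j) \/
    (exists a b, [/\ is_side (face i) a b, is_side (face j) a b
                   & segment a b x]);
  face_across : forall i a b, is_side (face i) a b ->
    exists! j, j != i /\ is_side (face j) a b;
  face_bend : forall i j a b, i != j ->
    is_side (face i) a b -> is_side (face j) a b ->
    ~ coplanar (face i ++ face j);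
  face_vertex : forall i a, a \in face i ->
    (3 <= #|[pred j | a \in face j]|)%N
}.

Definition vertices (R : realType) (P : polyhedron R) : seq (point R) :=
  undup (flatten (codom (@face R P))).

(** A concrete sphere with [p] handles: the boundary of the box
    [0, 2p+1] x [0, 3] x [0, 1] through which [p] disjoint square tunnels
    ]2i+1, 2i+2[ x ]1, 2[ x [0, 1] (i < p) have been drilled. *)

Definition drilled_box (R : realType) (p : nat) : set (point R) :=
  [set x | [/\ 0 <= x 0 0 <= (2 * p + 1)%:R, 0 <= x 0 1 <= 3,
               0 <= x 0 2 <= 1
             & forall i, (i < p)%N ->
               ~ ((2 * i + 1)%:R < x 0 0 < (2 * i + 2)%:R /\ 1 < x 0 1 < 2)]].

Definition sphere_with_handles (R : realType) (p : nat) : set (point R) :=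
  frontier (@drilled_box R p).

(* The faces of a [polyhedron] are simple polygons by definition. *)
Definition toroid (R : realType) (p : nat) (P : polyhedron R) : Prop :=
  (1 <= p)%N /\ homeomorphic (frontier (body P)) (@sphere_with_handles R p).

(** A tetrahedron is given by the tuple of its vertices. *)

Definition nondegenerate (R : realType) (t : 4.-tuple (point R)) : Prop :=
  \det (\matrix_(i < 3) (tnth t (lift ord0 i) - tnth t ord0)) != 0.

Definition triangulation (R : realType) (P : polyhedron R) (m : nat)
    (T : 'I_m -> 4.-tuple (point R)) : Prop :=
  [/\ forall i, nondegenerate (T i),
      forall i, {subset T i <= vertices P},
      \bigcup_i hull (T i) = body P,
      forall i j, i != j -> (hull (T i))° `&` (hull (T j))° = set0
    & forall i j, i != j -> exists s : seq (point R),
        [/\ (size s <= 3)%N, {subset s <= T i}, {subset s <= T j}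
          & hull (T i) `&` hull (T j) = hull s]].

Definition triangulable_in (R : realType) (P : polyhedron R) (m : nat) : Prop :=
  exists T : 'I_m -> 4.-tuple (point R), triangulation P T.

Definition triangulable (R : realType) (P : polyhedron R) : Prop :=
  exists m, triangulable_in P m.

Lemma triangulable_asbool (R : realType) (P : polyhedron R) :
  triangulable P -> exists m, `[< triangulable_in P m >].
Proof. by move=> [m Pm]; exists m; apply/asboolP. Qed.

Definition Tmin (R : realType) (P : polyhedron R) (hP : triangulable P) : nat :=
  ex_minn (triangulable_asbool hP).

(* Main.v *)
(** The witness is a chain of [p = m + 1] copies of the Csaszar torus,
    consecutive ones glued along a triangle, with [k] more tetrahedra stacked at
    one end.  The Csaszar torus bounds 7 tetrahedra on 7 vertices, so the chain
    has [4 p + 3] vertices and [7 p] tetrahedra, and each stacked tetrahedron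
    adds one of both.  The triangulation is unique, whence the lower bound: a
    quadruple of vertices whose hull lies in the body spans one of the given
    tetrahedra.  Indeed the gluing triangles lie alternately above and below the
    axis, so that no segment inside the body that joins two vertices crosses the
    plane of such a triangle; within one torus every other quadruple spans an
    explicit point outside the body; and the stacked vertices lie on a strictly
    convex curve.

    For the genus, points of the surface are identified with the weight vectors
    of the abstract simplicial complex.  There a stellar subdivision is an
    explicit homeomorphism, given by a formula that does not depend on the
    simplex.  Removing the stacked vertices, and then 29 such moves and inverse
    moves, take one torus to a triangulated block with a tunnel, gluing triangles
    going to the two ends of the block.  Turning over every other block, this map
    extends to the whole chain. *)

Require Import Defs.
From mathcomp Require Import all_boot all_order all_algebra.
From mathcomp Require Import boolp classical_sets reals topology normedtype.
From mathcomp Require Import functions cardinality zify ring lra.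

Set Implicit Arguments.
Unset Strict Implicit.
Unset Printing Implicit Defensive.

Import Order.TTheory GRing.Theory Num.Theory.
Import numFieldNormedType.Exports.

Local Open Scope classical_set_scope.
Local Open Scope ring_scope.

(** * Realizations of simplicial complexes *)

(** Block [i] is a translate of the first block, reflected in [z] when [i] is odd. Every statement
    about one block or two consecutive ones is therefore a finite check with integers, done once by
    computation, while the number of blocks only enters through inductions and through the planes of
    the gates. On the metric side essentially three facts are needed: the tetrahedra are
    nondegenerate, [place] is injective on the realization, and faces sharing an edge are not
    coplanar. Injectivity comes from separating planes. It then gives at once the frontier of the
    solid, the meeting of its faces, the face-to-face property, the embedding of the surface, and
    the lower bound once the admissible quadruples are known. The obstacle in the lower bound is
    that quadruples taken from far apart blocks cannot be enumerated; the obstacle in the genus is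
    that the chain has no fixed size. Both are met by confining everything to one block, with sign
    patterns of the gates in the first case and with a folding of the chain in the second. *)

Section Simplices.
Variables (R : realType) (N : nat).
Implicit Types (w : 'rV[R]_N) (s t : seq nat) (K : seq (seq nat)).

(** Weights are indexed by all [N] labels, not by the vertices of [s]: the simplices of a complex
    then share one ambient space, and two of them meet in the simplex on their common labels
    ([asimplexI]). *)
Definition asimplex s : set 'rV[R]_N :=
  [set w : 'rV[R]_N | [/\ forall i, 0 <= w 0 i, \sum_i w 0 i = 1
             & forall i, w 0 i != 0 -> (i : nat) \in s]].

Definition realization K : set 'rV[R]_N :=
  [set w | exists2 s, s \in K & asimplex s w].

Definition place (pos : nat -> 'rV[R]_3) w : 'rV[R]_3 :=
  \sum_i w 0 i *: pos i.

Lemma asimplexW s t w : {subset s <= t} -> asimplex s w -> asimplex t w.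
Proof. by move=> st [w0 w1 ws]; split=> // i /ws /st. Qed.

Lemma asimplexI s t w :
  asimplex s w -> asimplex t w -> asimplex [seq v <- s | v \in t] w.
Proof.
move=> [w0 w1 ws] [_ _ wt]; split=> // i wi.
by rewrite mem_filter ws ?wt.
Qed.

Lemma sum_seq_ord (V : nmodType) (F : nat -> V) s :
  uniq s -> all (gtn N) s -> (forall i : 'I_N, (i : nat) \notin s -> F i = 0) ->
  \sum_(v <- s) F v = \sum_(i < N) F i.
Proof.
move=> us ls F0.
rewrite -(big_mkord xpredT F) /index_iota subn0.
rewrite [RHS](bigID (mem s)) /= [X in _ = _ + X]big1_seq ?addr0; last first.
  move=> v /andP[vs]; rewrite mem_iota /= add0n => vN.
  exact: (F0 (Ordinal vN)).
rewrite -[RHS]big_filter; apply: perm_big; apply: uniq_perm => //.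
  by rewrite filter_uniq // iota_uniq.
move=> v; rewrite mem_filter mem_iota /= add0n.
by case vs: (v \in s) => //=; move: (allP ls _ vs) => /= ->.
Qed.

(** Bridge between [hull], whose weights sit on list positions, and weight vectors indexed by
    labels. *)
Lemma hull_place (pos : nat -> 'rV[R]_3) s : uniq s -> all (gtn N) s ->
  hull (map pos s) = place pos @` asimplex s.
Proof.
move=> us ls; apply/seteqP; split=> x /=; last first.
  move=> [w [w0 w1 ws] <-].
  (* [W] extends the weights by zero to all naturals, so that [sum_seq_ord] can trade a sum over
     labels for a sum over [s]. *)
  pose W (v : nat) : R := if insub v is Some i then w 0 i else 0.
  have WE (i : 'I_N) : W i = w 0 i by rewrite /W valK.
  have W0 v : 0 <= W v by rewrite /W; case: insub.
  exists (fun i => W (nth 0%N s i)); split=> //.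
    rewrite -w1 size_map -(big_mkord xpredT (fun i => W (nth 0%N s i))) -(big_nth 0%N xpredT W).
    rewrite sum_seq_ord //; first by apply: eq_bigr => i _; rewrite WE.
    by move=> i; rewrite WE; apply: contraNeq => /ws.
  rewrite /place size_map.
  rewrite (eq_bigr (fun i : 'I_(size s) => W (nth 0%N s i) *: pos (nth 0%N s i))); last first.
    by move=> i _; rewrite (nth_map 0%N).
  rewrite -(big_mkord xpredT (fun i => W (nth 0%N s i) *: pos (nth 0%N s i))) -(big_nth 0%N xpredT (fun v => W v *: pos v)).
  rewrite sum_seq_ord //; first by apply: eq_bigr => i _; rewrite WE.
  by move=> i; rewrite WE; have [->|/ws ->//] := eqVneq (w 0 i) 0; rewrite scale0r.
rewrite /hull size_map /= => -[c [c0 c1 ->]].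
have sN (j : 'I_(size s)) : (nth 0%N s j < N)%N by apply: (allP ls); rewrite mem_nth.
exists (\row_i \sum_(j < size s | nth 0%N s j == i) c j); first split.
- by move=> i; rewrite mxE sumr_ge0.
- under eq_bigr => i _ do rewrite mxE big_mkcond /=.
  rewrite exchange_big /= -c1; apply: eq_bigr => j _.
  by rewrite -big_mkcond /= (big_pred1 (Ordinal (sN j))).
- move=> i; rewrite mxE; apply: contraNT => si.
  rewrite big1 // => j /eqP ji; case/negP: si; rewrite -ji mem_nth //.
rewrite /place.
rewrite (eq_bigr (fun i : 'I_N => \sum_(j < size s)
    (if nth 0%N s j == i then c j *: pos i else 0))); last first.
  by move=> i _; rewrite mxE scaler_suml big_mkcond.
rewrite exchange_big /=; apply: eq_bigr => j _.
rewrite -big_mkcond /= (big_pred1 (Ordinal (sN j))) //=.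
by rewrite (nth_map 0%N).
Qed.

End Simplices.

(** * Homeomorphisms *)

Section Homeomorphisms.

Lemma within_continuousP (T U : topologicalType) (A : set T) (f : T -> U) :
  {within A, continuous f} <->
  forall x, A x -> forall V, nbhs (f x) V ->
    exists2 W, nbhs x W & forall y, W y -> A y -> V (f y).
Proof.
rewrite subspace_continuousP; split=> fc x Ax V.
  by move=> /(fc x Ax) WV; exists [set y | A y -> V (f y)].
by move=> /(fc x Ax)[W Wx WV]; apply: filterS Wx => y Wy Ay; apply: WV.
Qed.

Lemma within_comp (T U W : topologicalType) (A : set T) (B : set U)
    (f : T -> U) (g : U -> W) :
  f @` A `<=` B -> {within A, continuous f} -> {within B, continuous g} ->
  {within A, continuous (g \o f)}.
Proof.
move=> fAB /within_continuousP fc /within_continuousP gc.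
apply/within_continuousP => x Ax V Vx.
have [B' B'x B'V] := gc _ (fAB _ (imageP f Ax)) _ Vx.
have [A' A'x A'B] := fc _ Ax _ B'x.
by exists A' => // y A'y Ay; apply: B'V; [exact: A'B|apply: fAB; exact: imageP].
Qed.

Lemma homeomorphic_sym (T U : topologicalType) (A : set T) (B : set U) :
  homeomorphic A B -> homeomorphic B A.
Proof. by move=> [f [g [fc gc fA gB [fg gf]]]]; exists g, f. Qed.

Lemma homeomorphic_trans (T U W : topologicalType) (A : set T) (B : set U)
    (C : set W) :
  homeomorphic A B -> homeomorphic B C -> homeomorphic A C.
Proof.
move=> [f [g [fc gc fA gB [fg gf]]]] [f' [g' [fc' gc' fB gC [fg' gf']]]].
exists (f' \o f), (g \o g'); split.
- exact: within_comp fA fc fc'.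
- exact: within_comp gC gc' gc.
- by move=> _ [x Ax <-] /=; apply/fB/imageP/fA/imageP.
- by move=> _ [x Ax <-] /=; apply/gB/imageP/gC/imageP.
split=> x /set_mem Ax /=.
  by rewrite fg' ?fg //; apply/mem_set => //; apply/fA/imageP.
by rewrite gf ?gf' //; apply/mem_set => //; apply/gC/imageP.
Qed.

(** A closed part of the compact set [A] is compact, so its image is compact and hence closed in a
    Hausdorff space: the inverse pulls closed sets back to closed sets. *)
Lemma homeomorphic_compact (T : ptopologicalType) (U : topologicalType)
    (A : set T) (f : T -> U) :
  hausdorff_space U -> compact A -> {within A, continuous f} ->
  (forall x y, A x -> A y -> f x = f y -> x = y) ->
  homeomorphic A (f @` A).
Proof.
move=> hU cA fc fI.
pose g u := xget point [set x | A x /\ f x = u].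
have gf x : A x -> g (f x) = x.
  by move=> Ax; rewrite /g; case: xgetP => [y _ [Ay /fI->]|/(_ x)[]].
suff gc : {within f @` A, continuous g}.
  exists f, g; split=> //.
    by move=> _ [_ [x Ax <-] <-]; rewrite gf.
  split=> x /set_mem; first exact: gf.
  by move=> [y Ay <-]; rewrite gf.
apply/continuous_closedP => C cC; apply/closed_subspaceP.
exists (f @` (A `&` C)).
  apply: compact_closed => //; apply: continuous_compact.
    exact: continuous_subspaceW fc.
  exact: compact_closedI.
apply/seteqP; split=> u.
  move=> [[x [Ax Cx] <-] _]; split; last exact: imageP.
  by change (C (g (f x))); rewrite gf.
move=> [Cu [x Ax xu]]; move: Cu; rewrite -xu => Cx; split; exists x => //.
by split=> //; rewrite -(gf x Ax).
Qed.


(** The pasting lemma for finitely many closed pieces. Closedness of the union is part of the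
    conclusion because the induction needs it to paste the next piece. *)
Lemma closed_within_union (T U : topologicalType) n (A : nat -> set T)
    (f : T -> U) :
  (forall i, (i < n)%N -> closed (A i)) ->
  (forall i, (i < n)%N -> {within A i, continuous f}) ->
  closed [set x | exists2 i, (i < n)%N & A i x] /\
  {within [set x | exists2 i, (i < n)%N & A i x], continuous f}.
Proof.
elim: n => [|n IH] cA fc.
  have -> : [set x | exists2 i, (i < 0)%N & A i x] = set0.
    by apply/seteqP; split=> x // [].
  by split; [exact: closed0|exact: continuous_subspace0].
have -> : [set x | exists2 i, (i < n.+1)%N & A i x] =
    [set x | exists2 i, (i < n)%N & A i x] `|` A n.
  apply/seteqP; split=> x.
    move=> [i]; rewrite ltnS leq_eqVlt => /orP[/eqP->|lt_in] Aix; first by right.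
    by left; exists i.
  by move=> [[i lt_in Aix]|Anx]; [exists i => //; exact: ltnW|exists n].
have [clA ctA] := IH (fun i lt_in => cA i (ltnW lt_in))
  (fun i lt_in => fc i (ltnW lt_in)).
split; first by apply: closedU => //; exact: cA.
by apply: withinU_continuous => //; [exact: cA|exact: fc].
Qed.

End Homeomorphisms.

Section RowContinuity.
Variable R : realType.

Lemma continuous_row (T : topologicalType) n (f : T -> 'rV[R]_n) :
  (forall i, continuous (fun x => f x 0 i)) -> continuous f.
Proof.
move=> fc x V [P Px PV]; apply: filterS (PV) _ => //.
have : \forall y \near x, forall ij : 'I_1 * 'I_n, P ij.1 ij.2 (f y ij.1 ij.2).
  apply: filter_forall => -[i j] /=; rewrite (ord1 i); apply: (fc j x).
  by have := Px 0 j.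
by apply: filterS => y Py i j; exact: (Py (i, j)).
Qed.

Lemma continuous_add (T : topologicalType) (f g : T -> R) :
  continuous f -> continuous g -> continuous (fun x => f x + g x).
Proof. by move=> fc gc x; exact: (cvgD (fc x) (gc x)). Qed.

Lemma continuous_mul (T : topologicalType) (f g : T -> R) :
  continuous f -> continuous g -> continuous (fun x => f x * g x).
Proof. by move=> fc gc x; exact: (cvgM (fc x) (gc x)). Qed.

Lemma continuous_cst (T : topologicalType) (c : R) :
  continuous (fun _ : T => c).
Proof. by move=> x; exact: cvg_cst. Qed.

Lemma continuous_coord (T : topologicalType) n (f : T -> 'rV[R]_n) (i : 'I_n) :
  continuous f -> continuous (fun x => f x 0 i).
Proof.
move=> fc x; exact: (continuous_comp (fc x) (@coord_continuous R 1 n 0 i (f x))).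
Qed.

Lemma continuous_idfun (T : topologicalType) : continuous (fun x : T => x).
Proof. by move=> x; exact: cvg_id. Qed.

Lemma continuous_sum (T : topologicalType) (I : Type) (s : seq I)
    (f : I -> T -> R) :
  (forall i, continuous (f i)) -> continuous (fun x => \sum_(i <- s) f i x).
Proof.
move=> fc; elim: s => [|i s IH].
  have -> : (fun x => \sum_(i <- [::]) f i x) = (fun=> 0).
    by apply/funext => x; rewrite big_nil.
  by move=> x; exact: cvg_cst.
have -> : (fun x => \sum_(j <- i :: s) f j x) =
    (fun x => f i x + \sum_(j <- s) f j x).
  by apply/funext => x; rewrite big_cons.
by move=> x; apply: cvgD; [exact: fc|exact: IH].
Qed.

Lemma closed_fun_le (T : topologicalType) (f : T -> R) a :
  continuous f -> closed [set x | f x <= a].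
Proof. by move=> /continuous_closedP/(_ _ (@closed_le R a)). Qed.

Lemma closed_fun_ge (T : topologicalType) (f : T -> R) a :
  continuous f -> closed [set x | a <= f x].
Proof. by move=> /continuous_closedP/(_ _ (@closed_ge R a)). Qed.

Lemma open_fun_gt (T : topologicalType) (f : T -> R) a :
  continuous f -> open [set x | a < f x].
Proof. by move=> /continuousP/(_ _ (@open_gt R a)). Qed.

End RowContinuity.

(** * Barycentric coordinates *)

Section Barycentric.
Variable R : realType.
Implicit Types (x y : 'rV[R]_3) (u : 'cV[R]_3) (c : R).

Lemma rowB n (a b : 'rV[R]_n) i : (a - b) 0 i = a 0 i - b 0 i.
Proof. by rewrite !mxE. Qed.


(** The common form of barycentric coordinates, facet planes and separating planes. *)
Definition aff c u x : R := c + (x *m u) 0 0.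

Lemma aff_place N (pos : nat -> 'rV[R]_3) (w : 'rV[R]_N) c u :
  \sum_i w 0 i = 1 ->
  aff c u (place pos w) = \sum_i w 0 i * aff c u (pos i).
Proof.
move=> w1; rewrite /aff /place.
under [RHS]eq_bigr => i _ do rewrite mulrDr.
rewrite big_split /= -mulr_suml w1 mul1r mulmx_suml summxE; congr (_ + _).
by apply: eq_bigr => i _; rewrite -scalemxAl mxE.
Qed.

Lemma affD c u x y : aff c u (x + y) = aff c u x + (y *m u) 0 0.
Proof. by rewrite /aff mulmxDl mxE addrA. Qed.

Lemma continuous_aff c u : continuous (aff c u).
Proof.
have ac : continuous (fun x => \sum_(k <- enum 'I_3) x 0 k * u k 0).
  apply: continuous_sum => k.
  apply: continuous_mul; last exact: continuous_cst.
  exact/continuous_coord/continuous_idfun.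
have -> : aff c u = (fun x => c + \sum_(k <- enum 'I_3) x 0 k * u k 0).
  by apply/funext => x; rewrite /aff mxE big_enum.
exact: (continuous_add (@continuous_cst _ _ c) ac).
Qed.

(** The coordinates are affine functions on all of space, so that their signs also locate points
    outside the tetrahedron. *)
Definition barycentric (pos : nat -> 'rV[R]_3) (t : seq nat)
    (c : nat -> R) (u : nat -> 'cV[R]_3) : Prop :=
  [/\ {in t &, forall v v', aff (c v) (u v) (pos v') = (v == v')%:R},
      forall x, \sum_(v <- t) aff (c v) (u v) x = 1
    & forall x, x = \sum_(v <- t) aff (c v) (u v) x *: pos v].

(** The rows of the matrix are the edges from vertex 0, so multiplying [x - p] by its inverse gives
    the coordinates at the other three vertices; the remaining one is their complement to 1. *)
Lemma nondegenerate_coordinates (t : 4.-tuple 'rV[R]_3) : Defs.nondegenerate t ->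
  exists (c : 'I_4 -> R) (u : 'I_4 -> 'cV[R]_3),
    [/\ forall i j, aff (c i) (u i) (tnth t j) = (i == j)%:R,
        forall x, \sum_i aff (c i) (u i) x = 1
      & forall x, x = \sum_i aff (c i) (u i) x *: tnth t i].
Proof.
rewrite /Defs.nondegenerate; set D := (X in \det X) => D0.
have uD : D \in unitmx by rewrite unitmxE unitfE.
pose p := tnth t ord0.
pose U (i : 'I_3) : 'cV[R]_3 := col i (invmx D).
pose C (i : 'I_3) : R := - (p *m U i) 0 0.
have UE i x : aff (C i) (U i) x = ((x - p) *m invmx D) 0 i.
  have cE (z : 'rV[R]_3) : (z *m U i) 0 0 = (z *m invmx D) 0 i.
    by rewrite /U colE mulmxA -colE mxE.
  by rewrite /aff /C !cE mulmxBl rowB addrC.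
have DE x : x - p = \sum_i aff (C i) (U i) x *: (tnth t (lift ord0 i) - p).
  rewrite -{1}[x - p](mulmxKV uD) mulmx_sum_row.
  by apply: eq_bigr => i _; rewrite UE rowK.
pose c i := if unlift ord0 i is Some j then C j else 1 - \sum_k C k.
pose u i := if unlift ord0 i is Some j then U j else - \sum_k U k.
have a0 x : aff (c ord0) (u ord0) x = 1 - \sum_k aff (C k) (U k) x.
  rewrite /c /u unlift_none /aff mulmxN mulmx_sumr big_split /= opprD.
  by rewrite mxE addrA summxE.
have aS i x : aff (c (lift ord0 i)) (u (lift ord0 i)) x = aff (C i) (U i) x.
  by rewrite /c /u liftK.
have a1 x : \sum_i aff (c i) (u i) x = 1.
  by rewrite big_ord_recl (eq_bigr _ (fun i _ => aS i x)) a0 subrK.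
have ax x : x = \sum_i aff (c i) (u i) x *: tnth t i.
  rewrite big_ord_recl.
  rewrite (eq_bigr (fun i => aff (C i) (U i) x *: tnth t (lift ord0 i))); last first.
    by move=> i _; rewrite aS.
  rewrite a0 scalerBl scale1r scaler_suml -addrA addrC -sumrN -big_split /=.
  apply/eqP; rewrite -subr_eq; apply/eqP; rewrite (DE x).
  by apply: eq_bigr => i _; rewrite scalerBr addrC.
exists c, u; split=> //.
have aSj i j : aff (C i) (U i) (tnth t (lift ord0 j)) = (i == j)%:R.
  rewrite UE -(rowK (fun i => tnth t (lift ord0 i) - p) j) -/D.
  by rewrite -row_mul mulmxV // !mxE eq_sym.
have aS0 i : aff (C i) (U i) p = 0 by rewrite UE subrr mul0mx mxE.
move=> i j; case: (unliftP ord0 i) => [i'|] ->; case: (unliftP ord0 j) => [j'|] ->.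
- by rewrite aS aSj (inj_eq lift_inj).
- by rewrite aS aS0.
- rewrite a0; under eq_bigr => k _ do rewrite aSj.
  by rewrite (bigD1 j') //= eqxx big1 ?addr0 ?subrr // => k /negbTE ->.
- by rewrite a0 eqxx big1 ?subr0 // => k _; rewrite -[tnth t ord0]/p aS0.
Qed.

Lemma nondegenerate_barycentric (pos : nat -> 'rV[R]_3) (t : seq nat)
    (T : 4.-tuple 'rV[R]_3) :
  uniq t -> tval T = map pos t -> Defs.nondegenerate T ->
  exists (c : nat -> R) (u : nat -> 'cV[R]_3), barycentric pos t c u.
Proof.
move=> ut TE /nondegenerate_coordinates[c [u [cu1 cu2 cu3]]].
have st : size t = 4%N by rewrite -(size_map pos) -TE size_tuple.
pose ix v : 'I_4 := inord (index v t).
have sumE (V : nmodType) (F : nat -> V) :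
    \sum_(v <- t) F v = \sum_(i < 4) F (nth 0%N t i).
  by rewrite (big_nth 0%N) st big_mkord.
have ixK (i : 'I_4) : ix (nth 0%N t i) = i.
  by rewrite /ix index_uniq ?st //; apply: val_inj; rewrite /= inordK.
have nthE v : v \in t -> tnth T (ix v) = pos v.
  move=> vt; rewrite (tnth_nth 0) TE (nth_map 0%N) ?inordK -?st ?index_mem //.
  by rewrite nth_index.
have tnE i : tnth T i = pos (nth 0%N t i).
  by rewrite -{1}[i]ixK nthE // mem_nth ?st.
exists (c \o ix), (u \o ix); split.
- move=> v v' vt v't /=; rewrite -(nthE _ v't) cu1; congr ((nat_of_bool _)%:R).
  apply/eqP/eqP => [/(congr1 (fun i : 'I_4 => nth 0%N t i))|-> //].
  by rewrite /ix !inordK -?st ?index_mem // !nth_index.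
- by move=> x; rewrite sumE -[RHS](cu2 x); apply: eq_bigr => i _ /=; rewrite ixK.
- move=> x; rewrite sumE {1}[x]cu3; apply: eq_bigr => i _ /=.
  by rewrite ixK tnE.
Qed.

End Barycentric.

Section Coordinates.
Variables (R : realType) (N : nat) (pos : nat -> 'rV[R]_3).
Implicit Types (w : 'rV[R]_N) (s t : seq nat) (x y : 'rV[R]_3).

Lemma compact_asimplex s : compact (@asimplex R N s).
Proof.
apply: bounded_closed_compact.
  exists 1; split=> // M M1 w [w0 w1 _]; rewrite /= -[`|w|]/(mx_norm w) mx_normrE.
  apply: bigmax_le => [|[i j] _ /=]; first exact: le_trans (ltW M1).
  rewrite (ord1 i) ger0_norm //; apply: le_trans (ltW M1).
  by rewrite -w1 (bigD1 j) //= lerDl sumr_ge0.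
have -> : asimplex s =
    (\bigcap_(i in [set: 'I_N]) [set w : 'rV[R]_N | 0 <= w 0 i]) `&`
    ([set w : 'rV[R]_N | \sum_i w 0 i <= 1] `&`
     [set w : 'rV[R]_N | 1 <= \sum_i w 0 i]) `&`
    \bigcap_(i in [set i : 'I_N | (i : nat) \notin s])
      [set w : 'rV[R]_N | w 0 i <= 0].
  apply/seteqP; split=> w /=.
    move=> [w0 w1 ws]; split.
      by split; [move=> i _; exact: w0|split; rewrite /= w1].
    by move=> i /= si; rewrite leNgt lt_def w0 andbT; apply: contra si => /ws.
  move=> [[w0 [w1 w1']] ws]; split; first by move=> i; exact: w0.
    by apply/eqP; rewrite eq_le w1 w1'.
  move=> i; apply: contraNT => si; have := ws i si; rewrite /= => wi0.
  by apply/eqP/le_anti; rewrite wi0; exact: w0.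
have cc (i : 'I_N) : continuous (fun w : 'rV[R]_N => w 0 i).
  exact/continuous_coord/continuous_idfun.
have sc : continuous (fun w : 'rV[R]_N => \sum_i w 0 i).
  exact: continuous_sum.
apply: closedI; last by apply: closed_bigI => i _; exact: closed_fun_le.
apply: closedI; first by apply: closed_bigI => i _; exact: closed_fun_ge.
by apply: closedI; [exact: closed_fun_le|exact: closed_fun_ge].
Qed.

Lemma compact_realization K : compact (@realization R N K).
Proof.
elim: K => [|s K IH].
  have -> : realization [::] = set0 :> set 'rV[R]_N.
    by apply/seteqP; split=> x // [].
  exact: compact0.
have -> : realization (s :: K) = asimplex s `|` realization K :> set 'rV[R]_N.
  apply/seteqP; split=> w.
    by move=> [t]; rewrite in_cons => /orP[/eqP-> ?|tK wt]; [left|right; exists t].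
  move=> [ws|[t tK wt]]; first by exists s => //; rewrite mem_head.
  by exists t => //; rewrite in_cons tK orbT.
by apply: compactU => //; exact: compact_asimplex.
Qed.

Lemma continuous_place : continuous (@place R N pos).
Proof.
apply: continuous_row => k.
have -> : (fun w => place pos w 0 k) =
    (fun w : 'rV[R]_N => \sum_i w 0 i * pos i 0 k).
  apply/funext => w; rewrite /place summxE.
  by apply: eq_bigr => i _; rewrite mxE.
apply: continuous_sum => i; apply: continuous_mul; last exact: continuous_cst.
exact/continuous_coord/continuous_idfun.
Qed.

Lemma compact_place (A : set 'rV[R]_N) : compact A -> compact (place pos @` A).
Proof.
by move=> cA; apply: continuous_compact => //; exact/continuous_subspaceT/continuous_place.
Qed.

Lemma compact_hull s : uniq s -> all (gtn N) s -> compact (hull (map pos s)).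
Proof. by move=> us sN; rewrite (hull_place pos us sN); exact/compact_place/compact_asimplex. Qed.

Lemma open_aff_gt0 s (c : nat -> R) (u : nat -> 'cV[R]_3) :
  open [set x | {in s, forall v, 0 < aff (c v) (u v) x}].
Proof.
elim: s => [|v s IH].
  rewrite (_ : mkset _ = setT); first exact: openT.
  by apply/seteqP; split=> x // _ v; rewrite in_nil.
have -> : [set x | {in v :: s, forall v, 0 < aff (c v) (u v) x}] =
    [set x | 0 < aff (c v) (u v) x] `&`
    [set x | {in s, forall v, 0 < aff (c v) (u v) x}].
  apply/seteqP; split=> x /=.
    move=> h; split; first by apply: h; rewrite mem_head.
    by move=> v' v's; apply: h; rewrite in_cons v's orbT.
  by move=> [h1 h2] v'; rewrite in_cons => /orP[/eqP->|/h2].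
apply: openI => //.
exact/open_fun_gt/continuous_aff.
Qed.

Variables (t : seq nat) (c : nat -> R) (u : nat -> 'cV[R]_3).
Hypotheses (ut : uniq t) (tN : all (gtn N) t) (cu : barycentric pos t c u).

Lemma asimplex_aff w : asimplex t w ->
  forall i : 'I_N, (i : nat) \in t -> w 0 i = aff (c i) (u i) (place pos w).
Proof.
move=> [w0 w1 wt] i it; rewrite aff_place // (bigD1 i) //=.
have [cu1 _ _] := cu; rewrite cu1 // eqxx mulr1 big1 ?addr0 // => j ji.
have [->|/wt jt] := eqVneq (w 0 j) 0; first by rewrite mul0r.
by rewrite cu1 // (inj_eq val_inj) eq_sym (negbTE ji) mulr0.
Qed.

Lemma place_inj w w' : asimplex t w -> asimplex t w' ->
  place pos w = place pos w' -> w = w'.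
Proof.
move=> wt w't e; apply/rowP => i; have [it|it] := boolP ((i : nat) \in t).
  by rewrite (asimplex_aff wt) // (asimplex_aff w't) // e.
move: wt w't => [_ _ wt] [_ _ w't].
by rewrite (contraNeq (wt i) it) (contraNeq (w't i) it).
Qed.

(** Inverse of [place pos] on the tetrahedron [t]; outside it some weights are negative. *)
Definition weights x : 'rV[R]_N :=
  \row_i (if (i : nat) \in t then aff (c i) (u i) x else 0).

(** With [F 0 i = 0] the labels outside [t] contribute nothing. The general [F] covers total
    weights, placements and values of affine functions alike. *)
Lemma sum_weights (V : nmodType) (F : R -> nat -> V) x :
  (forall i, F 0 i = 0) ->
  \sum_i F (weights x 0 i) i = \sum_(v <- t) F (aff (c v) (u v) x) v.
Proof.
move=> F0; pose G v := F (if v \in t then aff (c v) (u v) x else 0) v.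
transitivity (\sum_(v <- t) G v); last first.
  by apply: eq_big_seq => v vt; rewrite /G vt.
rewrite (@sum_seq_ord N) //; last by move=> i it; rewrite /G (negbTE it) F0.
by apply: eq_bigr => i _; rewrite mxE.
Qed.

Lemma place_weights x : place pos (weights x) = x.
Proof.
have [_ _ cu3] := cu; rewrite [RHS]cu3.
by apply: (sum_weights (F := fun a v => a *: pos v)) => i; rewrite scale0r.
Qed.

Lemma asimplex_weights x : {in t, forall v, 0 <= aff (c v) (u v) x} ->
  asimplex [seq v <- t | aff (c v) (u v) x != 0] (weights x).
Proof.
move=> x0; split=> [i||i].
- by rewrite mxE; case: ifP => // /x0.
- by have [_ cu2 _] := cu; rewrite -[RHS](cu2 x) (sum_weights (F := fun a _ => a)).
- by rewrite mxE mem_filter; case: ifP => [it|_]; rewrite ?eqxx // andbT.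
Qed.

Lemma mem_hull x :
  hull (map pos t) x <-> {in t, forall v, 0 <= aff (c v) (u v) x}.
Proof.
rewrite (hull_place pos ut tN); split=> [[w wt <-] v vt|x0].
  have vN := allP tN _ vt; rewrite -(asimplex_aff wt (i := Ordinal vN)) //.
  by case: wt.
exists (weights x); last exact: place_weights.
by apply: asimplexW (asimplex_weights x0) => v; rewrite mem_filter => /andP[].
Qed.

Lemma interior_hull x : {in t, forall v, 0 < aff (c v) (u v) x} ->
  (hull (map pos t))° x.
Proof.
move=> x0; have : [set y | {in t, forall v, 0 < aff (c v) (u v) y}] `<=`
    (hull (map pos t))°.
  rewrite -(open_subsetE _ (@open_aff_gt0 t c u)) => y y0.
  by apply/mem_hull => v /y0 /ltW.
exact.
Qed.

End Coordinates.

(** * Triangles as simple polygons *)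

Section Triangle.
Variable R : realType.
Implicit Types (x y : 'rV[R]_3).

Lemma affine_hull3 (A B D : 'rV[R]_3) x : affine_hull [:: A; B; D] x <->
  exists a b d, a + b + d = 1 /\ x = a *: A + b *: B + d *: D.
Proof.
split=> [[w [w1 ->]]|[a [b [d [abd ->]]]]].
  exists (w ord0), (w (lift ord0 ord0)), (w (lift ord0 (lift ord0 ord0))).
  by split; [rewrite -w1|]; rewrite /= !big_ord_recl big_ord0 addr0 addrA.
exists (fun i : 'I_3 => nth 0 [:: a; b; d] i).
by rewrite /= !big_ord_recl !big_ord0 /= !addr0 !addrA.
Qed.

Lemma hull3 (A B D : 'rV[R]_3) x : hull [:: A; B; D] x <->
  exists a b d, [/\ 0 <= a, 0 <= b, 0 <= d, a + b + d = 1
                  & x = a *: A + b *: B + d *: D].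
Proof.
split=> [[w [w0 w1 ->]]|[a [b [d [a0 b0 d0 abd ->]]]]].
  exists (w ord0), (w (lift ord0 ord0)), (w (lift ord0 (lift ord0 ord0))).
  by split=> //; [rewrite -w1|]; rewrite /= !big_ord_recl big_ord0 addr0 addrA.
exists (fun i : 'I_3 => nth 0 [:: a; b; d] i).
rewrite /= !big_ord_recl !big_ord0 /= !addr0 !addrA; split=> //.
by case=> [[|[|[|]]]].
Qed.

Lemma segmentP (A B : 'rV[R]_3) x : segment A B x <->
  exists a b, [/\ 0 <= a, 0 <= b, a + b = 1 & x = a *: A + b *: B].
Proof.
split=> [[w [w0 w1 ->]]|[a [b [a0 b0 ab ->]]]].
  exists (w ord0), (w (lift ord0 ord0)).
  by split=> //; [rewrite -w1|]; rewrite /= !big_ord_recl big_ord0 addr0.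
exists (fun i : 'I_2 => nth 0 [:: a; b] i).
rewrite /= !big_ord_recl !big_ord0 /= !addr0; split=> //.
by case=> [[|[|]]].
Qed.

Lemma aff3 c u (A B D : 'rV[R]_3) a b d : a + b + d = 1 ->
  aff c u (a *: A + b *: B + d *: D) = a * aff c u A + b * aff c u B + d * aff c u D.
Proof.
move=> abd; rewrite /aff !mulmxDl -!scalemxAl; rewrite 5!mxE -[c in LHS]mul1r -abd.
by rewrite 2!mxE; ring.
Qed.

(** Independence of the vertices is expressed by affine functions dual to them; these will be three
    of the barycentric coordinates of a tetrahedron that has the triangle as a facet. *)
Variables (A B D : 'rV[R]_3) (c : R * R * R) (u : 'cV[R]_3 * 'cV[R]_3 * 'cV[R]_3).
Let lA := aff c.1.1 u.1.1.
Let lB := aff c.1.2 u.1.2.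
Let lD := aff c.2 u.2.
Hypotheses (lAA : lA A = 1) (lAB : lA B = 0) (lAD : lA D = 0).
Hypotheses (lBA : lB A = 0) (lBB : lB B = 1) (lBD : lB D = 0).
Hypotheses (lDA : lD A = 0) (lDB : lD B = 0) (lDD : lD D = 1).

Let coordE a b d x : a + b + d = 1 -> x = a *: A + b *: B + d *: D ->
  [/\ lA x = a, lB x = b & lD x = d].
Proof.
move=> abd ->; rewrite /lA /lB /lD !aff3 // -/lA -/lB -/lD.
by rewrite lAA lAB lAD lBA lBB lBD lDA lDB lDD; split; ring.
Qed.

Let planeP x : affine_hull [:: A; B; D] x <->
  lA x + lB x + lD x = 1 /\ x = lA x *: A + lB x *: B + lD x *: D.
Proof.
rewrite affine_hull3; split=> [[a [b [d [abd xE]]]]|[l1 xE]].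
  by have [-> -> ->] := coordE abd xE.
by exists (lA x), (lB x), (lD x).
Qed.

Let hullP x : hull [:: A; B; D] x <->
  [/\ affine_hull [:: A; B; D] x, 0 <= lA x, 0 <= lB x & 0 <= lD x].
Proof.
rewrite hull3; split=> [[a [b [d [a0 b0 d0 abd xE]]]]|[/planeP[l1 xE] ? ? ?]].
  have [-> -> ->] := coordE abd xE; split=> //.
  by apply/affine_hull3; exists a, b, d.
by exists (lA x), (lB x), (lD x).
Qed.

Let AB : A != B. Proof. by apply: contra_eq_neq lAB => <-; rewrite lAA oner_eq0. Qed.
Let BD : B != D. Proof. by apply: contra_eq_neq lBD => <-; rewrite lBB oner_eq0. Qed.
Let DA : D != A. Proof. by apply: contra_eq_neq lDA => <-; rewrite lDD oner_eq0. Qed.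

Let nextA : next [:: A; B; D] A = B. Proof. by rewrite /= eqxx. Qed.
Let nextB : next [:: A; B; D] B = D.
Proof. by rewrite /= ?(eq_sym B A) (negbTE AB) eqxx. Qed.
Let nextD : next [:: A; B; D] D = A.
Proof. by rewrite /= (negbTE DA) ?(eq_sym D B) (negbTE BD) eqxx. Qed.

Lemma triangle_curve x : polygon_curve [:: A; B; D] x <->
  [\/ segment A B x, segment B D x | segment D A x].
Proof.
split=> [[P Ps]|].
  have : P \in [:: A; B; D] by [].
  rewrite !inE => /or3P[]/eqP PE; rewrite PE ?nextA ?nextB ?nextD => ?.
  - by constructor 1.
  - by constructor 2.
  - by constructor 3.
case=> xs; [exists A|exists B|exists D]; rewrite ?nextA ?nextB ?nextD //;
  by rewrite /= !inE eqxx ?orbT.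
Qed.

Let sideAB x : segment A B x <-> hull [:: A; B; D] x /\ lD x = 0.
Proof.
rewrite segmentP hull3; split=> [[a [b [a0 b0 ab xE]]]|[[a [b [d [a0 b0 d0 abd xE]]]]]].
  have ab0 : a + b + 0 = 1 by rewrite addr0.
  have xE' : x = a *: A + b *: B + 0 *: D by rewrite scale0r addr0.
  by split; [exists a, b, 0|have [_ _] := coordE ab0 xE'].
have [_ _ ->] := coordE abd xE => d00; exists a, b.
by move: abd xE; rewrite d00 scale0r !addr0.
Qed.

Let sideBD x : segment B D x <-> hull [:: A; B; D] x /\ lA x = 0.
Proof.
rewrite segmentP hull3; split=> [[b [d [b0 d0 bd xE]]]|[[a [b [d [a0 b0 d0 abd xE]]]]]].
  have ab0 : 0 + b + d = 1 by rewrite add0r.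
  have xE' : x = 0 *: A + b *: B + d *: D by rewrite scale0r add0r.
  by split; [exists 0, b, d|have [] := coordE ab0 xE'].
have [-> _ _] := coordE abd xE => a00; exists b, d.
by move: abd xE; rewrite a00 scale0r !add0r.
Qed.

Let sideDA x : segment D A x <-> hull [:: A; B; D] x /\ lB x = 0.
Proof.
rewrite segmentP hull3; split=> [[d [a [d0 a0 da xE]]]|[[a [b [d [a0 b0 d0 abd xE]]]]]].
  have ab0 : a + 0 + d = 1 by rewrite addr0 addrC.
  have xE' : x = a *: A + 0 *: B + d *: D by rewrite scale0r addr0 addrC.
  by split; [exists a, 0, d|have [] := coordE ab0 xE'].
have [_ -> _] := coordE abd xE => b00; exists d, a.
by move: abd xE; rewrite b00 scale0r !addr0 => e xE; split; rewrite // addrC.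
Qed.

(** On two different sides two coordinates vanish, which leaves a single vertex. *)
Lemma triangle_sides : {in [:: A; B; D] &, forall P Q, P != Q -> forall x,
  segment P (next [:: A; B; D] P) x -> segment Q (next [:: A; B; D] Q) x ->
  x \in [:: P; next [:: A; B; D] P] /\ x \in [:: Q; next [:: A; B; D] Q]}.
Proof.
have vA x : hull [:: A; B; D] x -> lB x = 0 -> lD x = 0 -> x = A.
  move=> /hullP[/planeP[l1 xE] _ _ _] b0 d0; move: l1 xE; rewrite b0 d0.
  by rewrite !addr0 !scale0r !addr0 => ->; rewrite scale1r.
have vB x : hull [:: A; B; D] x -> lA x = 0 -> lD x = 0 -> x = B.
  move=> /hullP[/planeP[l1 xE] _ _ _] b0 d0; move: l1 xE; rewrite b0 d0.
  by rewrite add0r !addr0 !scale0r add0r !addr0 => ->; rewrite scale1r.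
have vD x : hull [:: A; B; D] x -> lA x = 0 -> lB x = 0 -> x = D.
  move=> /hullP[/planeP[l1 xE] _ _ _] b0 d0; move: l1 xE; rewrite b0 d0.
  by rewrite !add0r !scale0r !add0r => ->; rewrite scale1r.
move=> P Q; rewrite !inE => /or3P[]/eqP-> /or3P[]/eqP->; rewrite ?eqxx // => _ x;
  rewrite ?nextA ?nextB ?nextD.
- by move=> /sideAB[hx lx] /sideBD[_ lx']; rewrite (vB x) // !inE !eqxx ?orbT.
- by move=> /sideAB[hx lx] /sideDA[_ lx']; rewrite (vA x) // !inE !eqxx ?orbT.
- by move=> /sideBD[hx lx] /sideAB[_ lx']; rewrite (vB x) // !inE !eqxx ?orbT.
- by move=> /sideBD[hx lx] /sideDA[_ lx']; rewrite (vD x) // !inE !eqxx ?orbT.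
- by move=> /sideDA[hx lx] /sideAB[_ lx']; rewrite (vA x) // !inE !eqxx ?orbT.
- by move=> /sideDA[hx lx] /sideBD[_ lx']; rewrite (vD x) // !inE !eqxx ?orbT.
Qed.

(** A point of the plane outside the triangle has a negative coordinate. The ray that leaves it away
    from the corresponding vertex keeps this coordinate negative, hence avoids the curve and makes
    the component unbounded. Conversely, the component of a point of the triangle off the curve
    stays in the triangle, because its part in the triangle is relatively open (all coordinates are
    positive there) and closed. *)
Lemma triangle_region : polygon_region [:: A; B; D] = hull [:: A; B; D].
Proof.
have curve_hull x : polygon_curve [:: A; B; D] x -> hull [:: A; B; D] x.
  by move=> /triangle_curve[/sideAB|/sideBD|/sideDA][].
have hull_aff x : hull [:: A; B; D] x -> affine_hull [:: A; B; D] x.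
  by move=> /hullP[].
have hA : affine_hull [:: A; B; D] A.
  by apply/planeP; rewrite lAA lBA lDA scale1r !scale0r !addr0.
have hB : affine_hull [:: A; B; D] B.
  by apply/planeP; rewrite lAB lBB lDB scale1r !scale0r addr0 !add0r addr0.
have hD : affine_hull [:: A; B; D] D.
  by apply/planeP; rewrite lAD lBD lDD scale1r !scale0r !add0r.
have bnd : bounded_set (hull [:: A; B; D]).
  apply: compact_bounded.
  by apply: (@compact_hull R 3 (nth 0 [:: A; B; D]) [:: 0; 1; 2]%N).
apply/seteqP; split=> x.
  case=> [/curve_hull //|[[xa xc] xb]]; apply: contrapT => xh.
  have ray V c' u' : aff c' u' V = 1 -> affine_hull [:: A; B; D] V ->
      (forall y, hull [:: A; B; D] y -> 0 <= aff c' u' y) ->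
      aff c' u' x < 0 -> False.
    move=> lV Va l0 lx.
    pose g (s : R) := x + s *: (x - V).
    have gE s : g s = (1 + s) *: x + (- s) *: V + 0 *: V.
      by rewrite /g scale0r addr0 scalerDl scale1r scalerBr scaleNr addrA.
    have gl s : 0 <= s -> aff c' u' (g s) < 0.
      move=> s0; rewrite gE aff3; last by ring.
      by rewrite lV; nra.
    have ga s : affine_hull [:: A; B; D] (g s).
      move: xa Va; rewrite !affine_hull3 => -[a [b [d [abd xE]]]].
      move=> [a' [b' [d' [abd' VE]]]].
      exists ((1 + s) * a - s * a'), ((1 + s) * b - s * b'), ((1 + s) * d - s * d').
      split.
        have -> : (1 + s) * a - s * a' + ((1 + s) * b - s * b') +
            ((1 + s) * d - s * d') = (1 + s) * (a + b + d) - s * (a' + b' + d').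
          by ring.
        by rewrite abd abd'; ring.
      rewrite /g xE VE !(scalerDr, scalerDl, scalerBl, scale1r, scalerA, mulrDl, mul1r).
      apply/rowP => k; rewrite !mxE; ring.
    pose S := g @` [set s | 0 <= s].
    have Sx : S x by exists 0; rewrite //= /g scale0r addr0.
    have SC : S `<=` connected_component
        (affine_hull [:: A; B; D] `\` polygon_curve [:: A; B; D]) x.
      apply: connected_component_max => //.
        move=> _ [s s0 <-]; split; first exact: ga.
        by move=> /curve_hull/l0; rewrite leNgt gl.
      apply: connected_continuous_connected.
        apply/connected_intervalP => s s' /= s0 s'0 z /andP[sz _].
        exact: le_trans sz.
      apply: continuous_subspaceT; apply: continuous_row => k.
      rewrite (_ : (fun s => _) = fun s => x 0 k + s * (x - V) 0 k); last first.
        by apply/funext => s; rewrite /g 2!mxE.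
      apply: continuous_add; first exact: continuous_cst.
      apply: continuous_mul; [exact: continuous_idfun|exact: continuous_cst].
    have : bounded_set S.
      by case: xb => M [Mr Mb]; exists M; split=> // r Mr' y Sy; apply: (Mb r Mr' y); exact: SC.
    move=> [M [_ /(_ (`|M| + 1))]].
    have M1 : M < `|M| + 1 by rewrite (le_lt_trans (ler_norm M)) // ltrDl.
    move=> /(_ M1) bS.
    have xV : x != V by apply/eqP => xV; move: lx; rewrite xV lV ltr10.
    have n0 : 0 < `|x - V| by rewrite normr_gt0 subr_eq0.
    have K0 : 0 <= `|M| + 1 + `|x| + 1 by rewrite !addr_ge0.
    (* This parameter puts the point of the ray at distance |M| + 1 + |x| + 1 from [x], hence
       outside the ball of radius |M| + 1. *)
    have s0 : 0 <= (`|M| + 1 + `|x| + 1) / `|x - V| by rewrite divr_ge0 // ltW.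
    have /= := bS _ (imageP g s0); apply/negP; rewrite -ltNge.
    set r := (X in g X); have gr : r *: (x - V) = g r - x.
      by rewrite /g [RHS]addrC addKr.
    have := ler_normB (g r) x; rewrite -gr normrZ ger0_norm // /r divfK ?gt_eqF //.
    by move=> h; move: h; lra.
  apply: xh; apply/hullP; split=> //; rewrite leNgt; apply/negP.
  - by apply: (ray _ _ _ lAA hA) => y /hullP[].
  - by apply: (ray _ _ _ lBB hB) => y /hullP[].
  - by apply: (ray _ _ _ lDD hD) => y /hullP[].
move=> xh; have [xc|xc] := pselect (polygon_curve [:: A; B; D] x); first by left.
right; split; first by split=> //; exact: hull_aff.
set C := connected_component _ _.
suff CH : C `<=` hull [:: A; B; D].
  by case: bnd => M [Mr Mb]; exists M; split=> // r Mr' y Cy; apply: (Mb r Mr' y); exact: CH.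
have Csub : C `<=` affine_hull [:: A; B; D] `\` polygon_curve [:: A; B; D].
  exact: connected_component_sub.
have strict y : C y -> hull [:: A; B; D] y -> [/\ 0 < lA y, 0 < lB y & 0 < lD y].
  move=> /Csub[_ yc] yh; have [_ a0 b0 d0] := (hullP y).1 yh.
  split; rewrite lt_neqAle ?a0 ?b0 ?d0 andbT; apply/eqP => e; apply: yc;
    apply/triangle_curve.
  - by constructor 2; apply/sideBD.
  - by constructor 3; apply/sideDA.
  - by constructor 1; apply/sideAB.
have <- : C `&` hull [:: A; B; D] = C.
  apply: (@component_connected _ _ x).
  - by exists x; split=> //; apply: connected_component_refl; split=> //; exact: hull_aff.
  - exists ([set y | 0 < lA y] `&` [set y | 0 < lB y] `&` [set y | 0 < lD y]).
      by apply: openI; [apply: openI|]; apply/open_fun_gt/continuous_aff.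
    apply/seteqP; split=> y [Cy]; first by move=> /(strict _ Cy)[].
    move=> [[a0 b0] d0]; split=> //; apply/hullP; split; rewrite ?ltW //.
    by have [] := Csub y Cy.
  - exists (hull [:: A; B; D]) => //.
    apply: compact_closed; first exact: norm_hausdorff.
    by apply: (@compact_hull R 3 (nth 0 [:: A; B; D]) [:: 0; 1; 2]%N).
by move=> y [].
Qed.

End Triangle.

(** * Triangulated solids *)

Section Segments.
Variable R : realType.
Implicit Types (x y z : 'rV[R]_3).

Lemma small_step x z (U : set 'rV[R]_3) : nbhs x U ->
  exists2 s : R, 0 < s <= 1 & U (x + s *: z).
Proof.
(* The summand 1 in the denominator avoids a division by zero when [z = 0]. *)
move=> /nbhs_ballP[e /= e0 eU]; exists (Num.min 1 (e / (2 * (`|z| + 1)))).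
  have z1 : 0 < 2 * (`|z| + 1) by rewrite mulr_gt0 // ltr_wpDl.
  by rewrite lt_min ltr01 divr_gt0 // ge_min lexx.
apply: eU; rewrite -ball_normE /= opprD addNKr normrN normrZ.
have z1 : 0 < 2 * (`|z| + 1) by rewrite mulr_gt0 // ltr_wpDl.
rewrite ger0_norm; last by rewrite le_min ler01 divr_ge0 // ltW.
apply: (@le_lt_trans _ _ (e / (2 * (`|z| + 1)) * `|z|)).
  by apply: ler_wpM2r => //; rewrite ge_min lexx orbT.
rewrite mulrAC ltr_pdivrMr // ltr_pM2l //.
by have := normr_ge0 z; lra.
Qed.

Lemma closure_segment x z (A : set 'rV[R]_3) :
  (forall s : R, 0 < s <= 1 -> A (x + s *: z)) -> closure A x.
Proof. by move=> Az U /(@small_step x z)[s s01 Us]; exists (x + s *: z); split=> //; exact: Az. Qed.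

Lemma aff_step c u x z (s : R) :
  aff c u (x + s *: (z - x)) = (1 - s) * aff c u x + s * aff c u z.
Proof.
rewrite affD -scalemxAl mulmxBl /aff.
by move: (x *m u) (z *m u) => a b; rewrite 3!mxE; ring.
Qed.

Lemma place_step N pos (w w' : 'rV[R]_N) (s : R) :
  place pos w + s *: (place pos w' - place pos w) = place pos (w + s *: (w' - w)).
Proof.
rewrite /place -sumrB scaler_sumr -big_split; apply: eq_bigr => i _ /=.
by rewrite !mxE scalerDl -scalerBl scalerA.
Qed.

Lemma asimplex_step N t (w w' : 'rV[R]_N) (s : R) : 0 <= s <= 1 ->
  asimplex t w -> asimplex t w' -> asimplex t (w + s *: (w' - w)).
Proof.
move=> /andP[s0 s1] [w0 w1 wt] [w'0 w'1 w't].
have E i : (w + s *: (w' - w)) 0 i = (1 - s) * w 0 i + s * w' 0 i.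
  by rewrite !mxE; ring.
split=> [i||i].
- by rewrite E addr_ge0 ?mulr_ge0 // subr_ge0.
- under eq_bigr => i _ do rewrite E.
  by rewrite big_split /= -!mulr_sumr w1 w'1; ring.
- rewrite E; apply: contraNT => it.
  by rewrite (contraNeq (wt i) it) (contraNeq (w't i) it) !mulr0 addr0.
Qed.

(** The barycentre of [s] as a weight vector; for a singleton, the vertex itself. *)
Definition uniform N (s : seq nat) : 'rV[R]_N :=
  \row_i (if (i : nat) \in s then (size s)%:R^-1 else 0).

Lemma asimplex_uniform N s : uniq s -> all (gtn N) s -> (0 < size s)%N ->
  asimplex s (uniform N s).
Proof.
move=> us sN s0; split=> [i||i]; rewrite ?mxE.
- by case: ifP => _ //; rewrite invr_ge0 ler0n.
- under eq_bigr => i _ do rewrite mxE.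
  rewrite -(@sum_seq_ord N _ (fun i => if i \in s then (size s)%:R^-1 else 0) s) //.
    rewrite (eq_big_seq (fun=> (size s)%:R^-1)) => [|i ->] //.
    by rewrite big_const_seq count_predT iter_addr_0 -[LHS]mulr_natr mulVf // pnatr_eq0 -lt0n.
  by move=> i /negbTE ->.
- by case: ifP; rewrite ?eqxx.
Qed.

Lemma place_vertex N pos v : (v < N)%N ->
  place pos (uniform N [:: v]) = pos v :> 'rV[R]_3.
Proof.
move=> vN; rewrite /place (bigD1 (Ordinal vN)) //= mxE mem_head invr1 scale1r.
by rewrite big1 ?addr0 // => i iv; rewrite mxE inE ifN ?scale0r.
Qed.

End Segments.

(** Incidence data of a solid with tetrahedra [T] and boundary triangles [B]. Labels are sorted so
    that equal vertex sets are equal lists. Through [tet_edge] every vertex and edge of a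
    tetrahedron lies on the boundary, so that only points inside facets need care when the frontier
    is computed, and all vertices of tetrahedra are vertices of the polyhedron. *)
Record closed_surface (T B : seq (seq nat)) : Prop := ClosedSurface {
  tet_sorted : {in T, forall t, sorted ltn t /\ size t = 4%N};
  tri_sorted : {in B, forall b, sorted ltn b /\ size b = 3%N};
  tri_uniq : uniq B;
  tri_tet : {in B, forall b, exists2 t, t \in T /\ {subset b <= t}
    & {in T, forall t', {subset b <= t'} -> t' = t}};
  tet_tri : {in T, forall t, {in t, forall d,
    [seq v <- t | v != d] \in B \/
    (exists2 t', t' \in T /\ t' != t & {subset [seq v <- t | v != d] <= t'})}};
  tet_edge : {in T, forall t, {in t &, forall u v,
    exists2 b, b \in B & u \in b /\ v \in b}};
  tri_across : {in B, forall b, {in b &, forall u v, u != v ->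
    exists2 b', [/\ b' \in B, b' != b, u \in b' & v \in b']
    & {in B, forall b'', b'' != b -> u \in b'' -> v \in b'' -> b'' = b'}}};
  tri_vertex : {in B, forall b, {in b, forall u,
    (3 <= count (fun b' => u \in b') B)%N}}
}.

Lemma sorted_ltn_eq (s t : seq nat) :
  sorted ltn s -> sorted ltn t -> s =i t -> s = t.
Proof.
move=> ss st e; apply: (irr_sorted_eq ltn_trans ltnn ss st e).
Qed.

Lemma sorted_ltn_sub (s t : seq nat) : sorted ltn s -> sorted ltn t ->
  (size t <= size s)%N -> {subset s <= t} -> s = t.
Proof.
move=> ss st le_ts st'; apply: sorted_ltn_eq => // v.
have us : uniq s := sorted_uniq ltn_trans ltnn ss.
by have [_ /(_ v)->] := uniq_min_size us st' le_ts.
Qed.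

Lemma outside_tri (t b : seq nat) : uniq t -> (size b < size t)%N ->
  exists2 d, d \in t & d \notin b.
Proof.
move=> ut lt_bt; apply/hasP; rewrite has_predC -[~~ _]negbK; apply/negP.
rewrite negbK => /allP tb; move: lt_bt; rewrite ltnNge.
by rewrite (uniq_leq_size ut tb).
Qed.

(** * From incidence data and an injective placement to a polyhedron *)

Section Solid.
Variables (R : realType) (N : nat) (pos : nat -> 'rV[R]_3).
Variables T B : seq (seq nat).
Hypothesis cs : closed_surface T B.
Hypothesis labels : {in T, forall t, all (gtn N) t}.
Hypothesis coords : {in T, forall t,
  exists (c : nat -> R) (u : nat -> 'cV[R]_3), barycentric pos t c u}.
(** Tetrahedra meet in space exactly where they meet in the abstract complex. *)
Hypothesis inj : forall w w' : 'rV[R]_N, realization T w -> realization T w' ->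
  place pos w = place pos w' -> w = w'.
Hypothesis bend : {in B &, forall b b' : seq nat, b != b' -> forall u v, u != v ->
  u \in b -> v \in b -> u \in b' -> v \in b' ->
  ~ coplanar (map pos b ++ map pos b')}.

Definition solid : set 'rV[R]_3 := place pos @` @realization R N T.

Lemma tet_uniq t : t \in T -> uniq t.
Proof. by move=> /(tet_sorted cs)[st _]; exact: (sorted_uniq ltn_trans ltnn st). Qed.

Lemma tri_uniqS b : b \in B -> uniq b.
Proof. by move=> /(tri_sorted cs)[st _]; exact: (sorted_uniq ltn_trans ltnn st). Qed.

Lemma tri_labels b : b \in B -> all (gtn N) b.
Proof.
by move=> /(tri_tet cs)[t [tT bt] _]; apply/allP => v /bt; apply: allP v; exact: labels.
Qed.

Lemma solidE x : solid x <-> exists2 t, t \in T & hull (map pos t) x.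
Proof.
split=> [[w [t tT wt] <-]|[t tT]].
  by exists t => //; rewrite (hull_place pos (tet_uniq tT) (labels tT)); exists w.
by rewrite (hull_place pos (tet_uniq tT) (labels tT)) => -[w wt <-]; exists w => //; exists t.
Qed.

Lemma compact_solid : compact solid.
Proof. exact/compact_place/compact_realization. Qed.

Lemma closed_solid : closed solid.
Proof. by apply: compact_closed compact_solid; exact: norm_hausdorff. Qed.

Lemma triP b : b \in B -> exists A1 A2 A3, b = [:: A1; A2; A3] /\
  [/\ A1 != A2, A1 != A3 & A2 != A3].
Proof.
move=> bB; have [_ ] := tri_sorted cs bB; have := tri_uniqS bB.
case: b bB => [|A1 [|A2 [|A3 []]]] //= _.
rewrite !inE negb_or => /and3P[/andP[? ?] ? _] _.
by exists A1, A2, A3; split.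
Qed.

Lemma tri_region b : b \in B ->
  polygon_region (map pos b) = hull (map pos b) /\ simple_polygon (map pos b).
Proof.
move=> bB; have [A1 [A2 [A3 [bE [/negbTE n12 /negbTE n13 /negbTE n23]]]]] := triP bB.
have [t [tT bt] _] := tri_tet cs bB.
have [c [u [cu _ _]]] := coords tT.
have [d dt db] : exists2 d, d \in t & d \notin b.
  apply: outside_tri (tet_uniq tT) _.
  by have [_ ->] := tet_sorted cs tT; have [_ ->] := tri_sorted cs bB.
move: bt db; rewrite bE => bt; rewrite !inE !negb_or => /and3P[dA1 dA2 dA3].
have t1 : A1 \in t by apply: bt; rewrite !inE eqxx.
have t2 : A2 \in t by apply: bt; rewrite !inE eqxx orbT.
have t3 : A3 \in t by apply: bt; rewrite !inE eqxx !orbT.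
pose C := (c A1, c A2, c A3); pose U := (u A1, u A2, u A3).
have l11 : aff C.1.1 U.1.1 (pos A1) = 1 by rewrite cu // eqxx.
have l12 : aff C.1.1 U.1.1 (pos A2) = 0 by rewrite cu // n12.
have l13 : aff C.1.1 U.1.1 (pos A3) = 0 by rewrite cu // n13.
have l21 : aff C.1.2 U.1.2 (pos A1) = 0 by rewrite cu // eq_sym n12.
have l22 : aff C.1.2 U.1.2 (pos A2) = 1 by rewrite cu // eqxx.
have l23 : aff C.1.2 U.1.2 (pos A3) = 0 by rewrite cu // n23.
have l31 : aff C.2 U.2 (pos A1) = 0 by rewrite cu // eq_sym n13.
have l32 : aff C.2 U.2 (pos A2) = 0 by rewrite cu // eq_sym n23.
have l33 : aff C.2 U.2 (pos A3) = 1 by rewrite cu // eqxx.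
split; first exact: (triangle_region l11 l12 l13 l21 l22 l23 l31 l32 l33).
split=> //.
- have p12 : pos A1 != pos A2 by apply: contra_eq_neq l12 => <-; rewrite l11 oner_eq0.
  have p13 : pos A1 != pos A3 by apply: contra_eq_neq l13 => <-; rewrite l11 oner_eq0.
  have p23 : pos A2 != pos A3 by apply: contra_eq_neq l23 => <-; rewrite l22 oner_eq0.
  by rewrite /= !inE negb_or p12 p13 p23.
(* The coordinate of the vertex [d] off the triangle vanishes on its three vertices, so its linear
   part is a normal vector. *)
- exists (u d); last first.
    have zero p : p \in map pos [:: A1; A2; A3] -> aff (c d) (u d) p = 0.
      by rewrite /= !inE => /or3P[]/eqP->; rewrite cu ?(negbTE dA1) ?(negbTE dA2) ?(negbTE dA3).
    move=> p q /zero; rewrite /aff => p0 /zero; rewrite /aff => q0.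
    apply/matrixP => i j; rewrite !ord1.
    by apply: (@addrI _ (c d)); rewrite p0 q0.
  apply/eqP => u0; have := cu d d dt dt; have := cu d A1 dt t1.
  by rewrite /aff u0 !mulmx0 mxE !addr0 eqxx (negbTE dA1) => -> /eqP; rewrite eq_sym oner_eq0.
- exact: (triangle_sides l11 l12 l13 l21 l22 l23 l31 l32 l33).
Qed.

Lemma tri_hullP b x : b \in B ->
  hull (map pos b) x <-> exists2 w : 'rV[R]_N, asimplex b w & place pos w = x.
Proof.
move=> bB; rewrite (hull_place pos (tri_uniqS bB) (tri_labels bB)).
by split=> [[w wb <-]|[w wb <-]]; exists w.
Qed.

Lemma tri_realization b (w : 'rV[R]_N) : b \in B -> asimplex b w -> realization T w.
Proof.
move=> bB wb; have [t [tT bt] _] := tri_tet cs bB.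
by exists t => //; exact: asimplexW wb.
Qed.

Lemma tet_interior t c u x : t \in T -> barycentric pos t c u ->
  {in t, forall v, 0 < aff (c v) (u v) x} -> solid° x.
Proof.
move=> tT cu /(interior_hull (tet_uniq tT) (labels tT) cu).
by apply: interiorS => y yt; apply/solidE; exists t.
Qed.

(** Suppose [d'] were not strictly beyond the shared facet. A short step from the relatively
    interior point [w] towards [d'] would stay in [t], while in [t'] it gives [d'] a positive
    weight: one point with two weight vectors, against [inj]. *)
Lemma opposite t t' c u d d' (w : 'rV[R]_N) : t \in T -> t' \in T ->
  barycentric pos t c u -> d \in t -> d' \in t' -> d' \notin t ->
  {subset [seq v <- t | v != d] <= t'} ->
  asimplex [seq v <- t | v != d] w ->
  (forall i : 'I_N, (i : nat) \in t -> (i : nat) != d -> 0 < w 0 i) ->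
  aff (c d) (u d) (pos d') < 0.
Proof.
move=> tT t'T cu dt d't' d't st' ws w0; rewrite ltNge; apply/negP => d'0.
have wt : asimplex t w.
  by apply: asimplexW ws => v; rewrite mem_filter => /andP[].
have wt' : asimplex t' w by exact: asimplexW ws.
pose x := place pos w.
have xpos : {in [seq v <- t | v != d], forall v, 0 < aff (c v) (u v) x}.
  move=> v; rewrite mem_filter => /andP[vd vt].
  have vN := allP (labels tT) _ vt.
  by rewrite -(asimplex_aff cu wt (i := Ordinal vN)) // w0.
have d'N : (d' < N)%N := allP (labels t'T) _ d't'.
have uS : asimplex [:: d'] (uniform R N [:: d']).
  by apply: asimplex_uniform; rewrite //= d'N.
have [s /andP[s0 s1] sU] := small_step (pos d' - x)
  (open_nbhs_nbhs (conj (@open_aff_gt0 R _ c u) xpos)).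
have yE : x + s *: (pos d' - x) = place pos (w + s *: (uniform R N [:: d'] - w)).
  by rewrite -place_step place_vertex.
have yt : {in t, forall v, 0 <= aff (c v) (u v) (x + s *: (pos d' - x))}.
  move=> v vt; have [->|vd] := eqVneq v d; last first.
    by apply/ltW/sU; rewrite mem_filter vd.
  have dN := allP (labels tT) _ dt.
  have xd : aff (c d) (u d) x = 0.
    rewrite -(asimplex_aff cu wt (i := Ordinal dN)) //; apply/eqP.
    have [_ _ wsd] := ws; apply: contraT => /(wsd (Ordinal dN)).
    by rewrite mem_filter eqxx.
  by rewrite aff_step xd mulr0 add0r mulr_ge0 // ltW.
have w1t : asimplex t' (w + s *: (uniform R N [:: d'] - w)).
  apply: asimplex_step => //; first by rewrite ltW.
  by apply: asimplexW uS => v; rewrite inE => /eqP->.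
have e : weights N t c u (x + s *: (pos d' - x)) = w + s *: (uniform R N [:: d'] - w).
  apply: inj; [exists t => //|by exists t'|].
    by apply: asimplexW (asimplex_weights (tet_uniq tT) (labels tT) cu yt) => v; rewrite mem_filter => /andP[].
  by rewrite (place_weights (tet_uniq tT) (labels tT) cu).
have := congr1 (fun w : 'rV_N => w 0 (Ordinal d'N)) e.
rewrite mxE /= (negbTE d't) !mxE /= mem_head invr1 => /eqP.
have [_ _ /(_ (Ordinal d'N))] := wt; rewrite /= (negbTE d't) => wd'.
have -> : w 0 (Ordinal d'N) = 0 by apply/eqP; apply: contraT => /wd'.
by rewrite subr0 mulr1 add0r eq_sym gt_eqF.
Qed.

(** Each point of a tetrahedron is a limit of points of the segment to its barycentre, and those are
    interior. *)
Lemma solid_regular : closure solid° = solid.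
Proof.
apply/seteqP; split=> x.
  by move=> /(closureS (@interior_subset _ _)); have /closure_id <- := closed_solid.
move=> /solidE[t tT xt]; have [c [u cu]] := coords tT.
have st : (0 < size t)%N by have [_ ->] := tet_sorted cs tT.
have ct := asimplex_uniform R (tet_uniq tT) (labels tT) st.
apply: (@closure_segment _ _ (place pos (uniform R N t) - x)) => s /andP[s0 s1].
apply: (tet_interior tT cu) => v vt; rewrite aff_step.
have vN := allP (labels tT) _ vt.
rewrite -(asimplex_aff cu ct (i := Ordinal vN)) // mxE /= vt.
have /(_ v vt) x0 := (mem_hull (tet_uniq tT) (labels tT) cu x).1 xt.
by rewrite ltr_wpDl ?mulr_ge0 ?subr_ge0 // mulr_gt0 // invr_gt0 ltr0n.
Qed.

(** Near a relatively interior point of [b] only the tetrahedron on [b] is present, the others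
    forming a closed set that misses the point; a small step away from the opposite vertex then
    leaves the solid. If an arbitrary point of [b] were interior to the solid, so would be a point
    slightly closer to the barycentre of [b], which is the previous case. *)
Lemma tri_frontier b x : b \in B -> hull (map pos b) x -> ~ solid° x.
Proof.
move=> bB; have [t [tT bt] tb] := tri_tet cs bB; have [c [u cu]] := coords tT.
have sb : (0 < size b)%N by have [_ ->] := tri_sorted cs bB.
have cb := asimplex_uniform R (tri_uniqS bB) (tri_labels bB) sb.
pose g := uniform R N b.
have relint (w : 'rV[R]_N) : asimplex b w ->
    (forall i : 'I_N, (i : nat) \in b -> 0 < w 0 i) -> ~ solid° (place pos w).
  move=> wb w0 wi.
  have [d dt db] : exists2 d, d \in t & d \notin b.
    apply: outside_tri (tet_uniq tT) _.
    by have [_ ->] := tet_sorted cs tT; have [_ ->] := tri_sorted cs bB.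
  pose others := \bigcup_(t' in [set t' | t' \in [seq t' <- T | t' != t]]) hull (map pos t').
  have cl_others : closed others.
    apply: closed_bigcup; first exact: finite_seq.
    move=> t' /=; rewrite mem_filter => /andP[_ t'T].
    apply: compact_closed; first exact: norm_hausdorff.
    exact: (compact_hull (tet_uniq t'T) (labels t'T)).
  have n_others : ~ others (place pos w).
    move=> [t' /=]; rewrite mem_filter => /andP[t't t'T].
    rewrite (hull_place pos (tet_uniq t'T) (labels t'T)) => -[w' w't' e].
    have ww' : w' = w.
      by apply: inj; rewrite ?e //; [exists t'|exact: tri_realization wb].
    move/eqP: t't; apply; apply: tb => // v vb.
    have vN := allP (tri_labels bB) _ vb.
    case: w't' => _ _ /(_ (Ordinal vN)); apply.
    by rewrite ww' gt_eqF // w0.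
  have n_nbhs : nbhs (place pos w) (~` others).
    by apply: open_nbhs_nbhs; split=> //; exact: closed_openC.
  have [s /andP[s0 s1] [/solidE[t' t'T yt'] y_others]] :=
    small_step (place pos w - pos d) (filterI wi n_nbhs).
  have t't : t' = t.
    apply/eqP; apply: contra_notT y_others => t't.
    by exists t' => //=; rewrite mem_filter t't.
  move: yt'; rewrite t't => /(mem_hull (tet_uniq tT) (labels tT) cu)/(_ d dt).
  have -> : place pos w + s *: (place pos w - pos d) =
      place pos w + (- s) *: (pos d - place pos w).
    by rewrite scaleNr -scalerN opprB.
  rewrite aff_step; have [cu1 _ _] := cu; rewrite (cu1 d d dt dt) eqxx.
  have dN := allP (labels tT) _ dt.
  have wt : asimplex t w by exact: asimplexW wb.
  rewrite -(asimplex_aff cu wt (i := Ordinal dN)) //.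
  have [_ _ wbd] := wb.
  have -> : w 0 (Ordinal dN) = 0.
    by apply/eqP; apply: contraT => /wbd /=; rewrite (negbTE db).
  by rewrite mulr0 add0r mulr1 oppr_ge0 leNgt s0.
move=> /(tri_hullP _ bB)[w wb <-] /=.
move=> /nbhs_interior wi.
have [s /andP[s0 s1]] := small_step (place pos g - place pos w) wi.
rewrite place_step; apply: relint => [|i ib].
  by apply: asimplex_step => //; rewrite ltW.
rewrite !mxE ib; have [w0 _ _] := wb.
have -> : w 0 i + s * ((size b)%:R^-1 - w 0 i) = (1 - s) * w 0 i + s * (size b)%:R^-1.
  by ring.
by rewrite ltr_wpDl ?mulr_ge0 ?subr_ge0 // mulr_gt0 // invr_gt0 ltr0n.
Qed.

(** A point of a tetrahedron is classified by its vanishing weights. If there are none it is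
    interior. If there are at least two it lies on an edge, hence on a boundary triangle by
    [tet_edge]. If there is exactly one, either the facet is in [B], or the two tetrahedra on it
    fill a neighbourhood. *)
Lemma frontier_solid : frontier solid =
  \bigcup_(b in [set b | b \in B]) hull (map pos b).
Proof.
rewrite /frontier -((closure_id _).1 closed_solid).
apply/seteqP; split=> x; last first.
  move=> [b bB xb]; split; last exact: tri_frontier xb.
  by move: xb => /(tri_hullP _ bB)[w wb <-]; exists w => //; exact: tri_realization wb.
move=> [[w [t tT wt] <-] xi]; have [c [u cu]] := coords tT.
have ut := tet_uniq tT; have lt := labels tT.
have [w0 _ wsup] := wt.
have inB b : b \in B -> (forall i : 'I_N, w 0 i != 0 -> (i : nat) \in b) ->
    (\bigcup_(b in [set b | b \in B]) hull (map pos b)) (place pos w).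
  move=> bB wb; exists b => //; apply/(tri_hullP _ bB); exists w => //.
  by case: wt.
have [/allP pos_w|] := boolP (all (fun v => aff (c v) (u v) (place pos w) != 0) t).
  case: xi; apply: (tet_interior tT cu) => v vt.
  have vN := allP lt _ vt.
  have := pos_w v vt; rewrite -(asimplex_aff cu wt (i := Ordinal vN)) // => wv.
  by rewrite lt_neqAle eq_sym wv w0.
move=> /allPn[d dt]; rewrite negbK => /eqP wd.
have dN := allP lt _ dt.
have wd0 : w 0 (Ordinal dN) = 0 by rewrite (asimplex_aff cu wt).
have wsd (i : 'I_N) : w 0 i != 0 -> (i : nat) \in [seq v <- t | v != d].
  move=> wi; rewrite mem_filter wsup // andbT; apply: contra wi => /eqP id'.
  by apply/eqP; rewrite -wd0; congr (w 0 _); apply: val_inj.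
have [/allP pos_w|] := boolP (all (fun v => aff (c v) (u v) (place pos w) != 0)
    [seq v <- t | v != d]); last first.
  move=> /allPn[e]; rewrite mem_filter => /andP[ed et]; rewrite negbK => /eqP we.
  have eN := allP lt _ et.
  have we0 : w 0 (Ordinal eN) = 0 by rewrite (asimplex_aff cu wt).
  have : (size [seq v <- t | (v != d) && (v != e)] = 2)%N.
    have -> : [seq v <- t | (v != d) && (v != e)] = rem e (rem d t).
      rewrite (rem_filter d ut) rem_filter ?filter_uniq // -filter_predI.
      by apply: eq_filter => v /=; rewrite andbC.
    rewrite size_rem; last by rewrite mem_rem_uniq // !inE ed.
    by rewrite size_rem //; have [_ ->] := tet_sorted cs tT.
  case E : [seq v <- t | (v != d) && (v != e)] => [|v1 [|v2 []]] // _.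
  have [v1t v2t] : v1 \in t /\ v2 \in t.
    have : {subset [:: v1; v2] <= t}.
      by move=> v; rewrite -E mem_filter => /andP[].
    by move=> h; split; apply: h; rewrite !inE eqxx ?orbT.
  have [b bB [b1 b2]] := tet_edge cs tT v1t v2t.
  apply: (inB b bB) => i wi.
  have : (i : nat) \in [:: v1; v2].
    rewrite -E mem_filter wsup // andbT; apply/andP; split.
      by have := wsd i wi; rewrite mem_filter => /andP[].
    apply: contra wi => /eqP ie; apply/eqP; rewrite -we0; congr (w 0 _).
    exact: val_inj.
  by rewrite !inE => /orP[]/eqP->.
have wsF : asimplex [seq v <- t | v != d] w by case: wt.
have [bB|[t' [t'T t't] st']] := tet_tri cs tT dt; first exact: (inB _ bB).
have w_gt0 (i : 'I_N) : (i : nat) \in t -> (i : nat) != d -> 0 < w 0 i.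
  move=> it id'; have := pos_w i; rewrite mem_filter id' it => /(_ isT).
  by rewrite -(asimplex_aff cu wt) // lt_neqAle w0 andbT eq_sym.
have ut' := tet_uniq t'T; have lt' := labels t'T.
have [d' d't' d't] : exists2 d', d' \in t' & d' \notin t.
  have [s't' sz'] := tet_sorted cs t'T; have [stt sz] := tet_sorted cs tT.
  apply/hasP; rewrite has_predC; apply: contra t't => /allP t't.
  by rewrite (sorted_ltn_sub s't' stt) // sz sz'.
have [c' [u' cu']] := coords t'T.
have wt' : asimplex t' w by exact: asimplexW wsF.
have dd' := opposite tT t'T cu dt d't' d't st' wsF w_gt0.
have t'E v : v \in t' -> v != d' -> v \in [seq v <- t | v != d].
  move=> vt' vd'.
  have : [seq v <- t | v != d] =i [seq v <- t' | v != d'].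
    have sF : size [seq v <- t' | v != d'] = 3%N.
      rewrite -(rem_filter d' ut') size_rem //.
      by have [_ ->] := tet_sorted cs t'T.
    have sF2 : size [seq v <- t | v != d] = 3%N.
      rewrite -(rem_filter d ut) size_rem //.
      by have [_ ->] := tet_sorted cs tT.
    have sub : {subset [seq v <- t | v != d] <= [seq v <- t' | v != d']}.
      move=> z zt; rewrite mem_filter st' // andbT.
      by apply: contraNneq d't => <-; move: zt; rewrite mem_filter => /andP[].
    by have [] := uniq_min_size (filter_uniq _ ut) sub; rewrite ?sF ?sF2.
  by move=> ->; rewrite mem_filter vd'.
case: xi.
have open1 : nbhs (place pos w)
    [set y | {in [seq v <- t | v != d], forall v, 0 < aff (c v) (u v) y}].
  apply: open_nbhs_nbhs; split; first exact: open_aff_gt0.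
  move=> v; rewrite mem_filter => /andP[vd vt].
  have vN := allP lt _ vt.
  by rewrite -(asimplex_aff cu wt (i := Ordinal vN)) // w_gt0.
have open2 : nbhs (place pos w)
    [set y | {in [seq v <- t | v != d], forall v, 0 < aff (c' v) (u' v) y}].
  apply: open_nbhs_nbhs; split; first exact: open_aff_gt0.
  move=> v vF; have vt' := st' v vF; have vN := allP lt' _ vt'.
  move: vF; rewrite mem_filter => /andP[vd vt].
  by rewrite -(asimplex_aff cu' wt' (i := Ordinal vN)) // w_gt0.
apply: filterS (filterI open1 open2) => y [y1 y2]; apply/solidE.
have [dy|dy] := leP 0 (aff (c d) (u d) y).
  exists t => //; apply/(mem_hull ut lt cu) => v vt.
  by have [->//|vd] := eqVneq v d; apply/ltW/y1; rewrite mem_filter vd.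
exists t' => //; apply/(mem_hull ut' lt' cu') => v vt'.
have [->|vd'] := eqVneq v d'; last exact/ltW/y2/t'E.
(* The [d]-coordinate of [t] vanishes on the vertices of [t'] other than [d'], so it equals the
   [d']-coordinate of [t'] times its value at [d'], which is negative by [opposite]. *)
have yE : aff (c d) (u d) y = aff (c' d') (u' d') y * aff (c d) (u d) (pos d').
  rewrite -{1}(place_weights ut' lt' cu' y) aff_place; last first.
    by have [_ cu2 _] := cu'; rewrite -[RHS](cu2 y) (sum_weights c' u' ut' lt' (F := fun a _ => a)).
  rewrite (sum_weights c' u' ut' lt' (F := fun a v => a * aff (c d) (u d) (pos v))); last first.
    by move=> i; rewrite mul0r.
  rewrite (bigD1_seq d') //= big1_seq ?addr0 // => v' /andP[v'd' v't'].
  have := t'E _ v't' v'd'; rewrite mem_filter => /andP[v'd v't].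
  by have [cu1 _ _] := cu; rewrite cu1 // eq_sym (negbTE v'd) mulr0.
by move: dy; rewrite yE nmulr_llt0 // => /ltW.
Qed.

Lemma pos_inj b b' v v' : b \in B -> b' \in B -> v \in b -> v' \in b' ->
  pos v = pos v' -> v = v'.
Proof.
move=> bB b'B vb v'b' e.
have vN := allP (tri_labels bB) _ vb; have v'N := allP (tri_labels b'B) _ v'b'.
have real w0 w1 (b1 : seq nat) : b1 \in B -> w0 \in b1 -> w1 = uniform R N [:: w0] ->
    realization T w1.
  move=> b1B w0b ->; apply: (tri_realization b1B).
  apply: (@asimplexW _ _ [:: w0]) => [z|]; first by rewrite inE => /eqP->.
  by apply: asimplex_uniform => //=; rewrite andbT; exact: (allP (tri_labels b1B) _ w0b).
have ww' : uniform R N [:: v] = uniform R N [:: v'].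
  apply: inj; [exact: (real v _ b)|exact: (real v' _ b')|].
  by rewrite !place_vertex.
have := congr1 (fun w : 'rV_N => w 0 (Ordinal vN)) ww'.
rewrite !mxE /= mem_head inE; case: eqP => // _ /eqP.
by rewrite invr1 oner_eq0.
Qed.

Lemma is_side3 (P Q A1 A2 A3 : 'rV[R]_3) :
  A1 != A2 -> A1 != A3 -> A2 != A3 ->
  is_side [:: A1; A2; A3] P Q =
  [&& P \in [:: A1; A2; A3], Q \in [:: A1; A2; A3] & P != Q].
Proof.
move=> /negbTE n12 /negbTE n13 /negbTE n23; rewrite /is_side.
have n21 : (A2 == A1) = false by rewrite eq_sym.
have n31 : (A3 == A1) = false by rewrite eq_sym.
have n32 : (A3 == A2) = false by rewrite eq_sym.
have [E1 E2 E3] : [/\ next [:: A1; A2; A3] A1 = A2, next [:: A1; A2; A3] A2 = A3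
    & next [:: A1; A2; A3] A3 = A1].
  by rewrite /= !eqxx ?n12 ?n13 ?n23 ?n21 ?n31 ?n32.
case Pin: (P \in _); rewrite ?andFb ?andTb; last by [].
case Qin: (Q \in _); rewrite ?andFb ?andTb; last by [].
by move: Pin Qin; rewrite !inE => /or3P[]/eqP-> /or3P[]/eqP->;
  rewrite ?E1 ?E2 ?E3 ?eqxx ?n12 ?n13 ?n23 ?n21 ?n31 ?n32.
Qed.

Lemma is_sideP b p q : b \in B -> is_side (map pos b) p q <->
  exists u v, [/\ u \in b, v \in b, u != v, p = pos u & q = pos v].
Proof.
move=> bB; have [A1 [A2 [A3 [bE [n12 n13 n23]]]]] := triP bB.
have inb : [/\ A1 \in b, A2 \in b & A3 \in b].
  by rewrite bE !inE !eqxx !orbT.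
have pinj v v' : v \in b -> v' \in b -> (pos v == pos v') = (v == v').
  by move=> vb v'b; apply/eqP/eqP => [|-> //]; exact: (pos_inj bB bB).
have [b1 b2 b3] := inb.
have -> : is_side (map pos b) p q = [&& p \in map pos b, q \in map pos b & p != q].
  by rewrite bE; apply: is_side3; rewrite pinj.
split=> [/and3P[/mapP[u ub ->] /mapP[v vb ->]]|[u [v [ub vb uv -> ->]]]].
  by rewrite pinj // => uv; exists u, v.
by rewrite !map_f //= pinj.
Qed.

(** By [inj] a common point has the same weights in both triangles, so it is carried by the common
    labels. None is impossible since weights sum to 1; one gives a common vertex, two a common side,
    and three would make the triangles equal. *)
Lemma face_region_meet b b' x : b \in B -> b' \in B -> b != b' ->
  hull (map pos b) x -> hull (map pos b') x ->
  (x \in map pos b /\ x \in map pos b') \/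
  (exists p q, [/\ is_side (map pos b) p q, is_side (map pos b') p q
                 & segment p q x]).
Proof.
move=> bB b'B bb' /(tri_hullP _ bB)[w wb <-] /(tri_hullP _ b'B)[w' wb' e].
have {wb' e} wb' : asimplex b' w.
  by have <- : w' = w by apply: inj => //; [exact: (tri_realization b'B)|exact: (tri_realization bB)].
have wI := asimplexI wb wb'.
have [sb zb] := tri_sorted cs bB; have [sb' zb'] := tri_sorted cs b'B.
have lt3 : (size [seq v <- b | v \in b'] < 3)%N.
  rewrite ltn_neqAle -{2}zb size_filter count_size andbT.
  apply: contra bb' => /eqP c3; apply/eqP; apply: sorted_ltn_sub => //.
    by rewrite zb zb'.
  by apply/allP; rewrite all_count c3 zb.
have sub1 : {subset [seq v <- b | v \in b'] <= b} by move=> v; rewrite mem_filter => /andP[].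
have sub2 : {subset [seq v <- b | v \in b'] <= b'} by move=> v; rewrite mem_filter => /andP[].
have uI : uniq [seq v <- b | v \in b'] by rewrite filter_uniq // tri_uniqS.
have lI : all (gtn N) [seq v <- b | v \in b'].
  by apply/allP => v /sub1; apply: allP v; exact: tri_labels.
move: wI lt3 sub1 sub2 uI lI; case: [seq v <- b | v \in b'] => [|u [|v []]] //.
- move=> [_ w1 ws] _ _ _ _ _; have /eqP : (0 : R) = 1.
    by rewrite -w1 big1 // => i _; apply/eqP; apply: contraT => /ws.
  by rewrite eq_sym oner_eq0.
- move=> wI _ s1 s2 us ls; left.
  have : hull (map pos [:: u]) (place pos w) by rewrite (hull_place pos us ls); exists w.
  move=> [a [_ a1 ->]]; rewrite /= !big_ord1 /= in a1 *; rewrite a1 scale1r.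
  by split; apply: map_f; [apply: s1|apply: s2]; rewrite mem_head.
move=> wI _ s1 s2 us ls; right; exists (pos u), (pos v).
have uv : u != v by move: us; rewrite /= inE => /andP[].
split; last by rewrite /segment -/(map pos [:: u; v]) (hull_place pos us ls); exists w.
  by apply/is_sideP => //; exists u, v; split=> //; apply: s1; rewrite !inE eqxx ?orbT.
by apply/is_sideP => //; exists u, v; split=> //; apply: s2; rewrite !inE eqxx ?orbT.
Qed.

Definition tri_face (i : 'I_(size B)) : seq 'rV[R]_3 := map pos (nth [::] B i).

Lemma mem_tri (i : 'I_(size B)) : nth [::] B i \in B.
Proof. by rewrite mem_nth. Qed.

Lemma tri_neq (i j : 'I_(size B)) : i != j -> nth [::] B i != nth [::] B j.
Proof. by rewrite nth_uniq ?(tri_uniq cs) // -(inj_eq val_inj). Qed.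

Lemma tri_face_simple i : simple_polygon (tri_face i).
Proof. by have [] := tri_region (mem_tri i). Qed.

Lemma tri_face_frontier : frontier solid = \bigcup_i polygon_region (tri_face i).
Proof.
rewrite frontier_solid; apply/seteqP; split=> x.
  move=> [b bB xb]; have iB : (index b B < size B)%N by rewrite index_mem.
  exists (Ordinal iB) => //; rewrite /tri_face /= nth_index //.
  by have [-> _] := tri_region bB.
move=> [i _]; rewrite /tri_face; have [-> _] := tri_region (mem_tri i).
by exists (nth [::] B i) => //; exact: mem_tri.
Qed.

Lemma tri_face_meet i j : i != j -> forall x,
  polygon_region (tri_face i) x -> polygon_region (tri_face j) x ->
  (x \in tri_face i /\ x \in tri_face j) \/
  (exists a b, [/\ is_side (tri_face i) a b, is_side (tri_face j) a b
                 & segment a b x]).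
Proof.
move=> ij x; rewrite /tri_face; have [-> _] := tri_region (mem_tri i).
have [-> _] := tri_region (mem_tri j).
by apply: face_region_meet; rewrite ?mem_tri ?tri_neq.
Qed.

Lemma tri_face_across i a b : is_side (tri_face i) a b ->
  exists! j, j != i /\ is_side (tri_face j) a b.
Proof.
move=> /(is_sideP _ _ (mem_tri i))[u [v [ui vi uv -> ->]]].
have [b' [b'B b'i ub' vb'] b'u] := tri_across cs (mem_tri i) ui vi uv.
have jB : (index b' B < size B)%N by rewrite index_mem.
exists (Ordinal jB); split.
  split.
    by apply: contraNneq b'i => <-; rewrite /= nth_index.
  by apply/is_sideP; [exact: mem_tri|exists u, v; rewrite /= nth_index].
move=> j [ji /(is_sideP _ _ (mem_tri j))[u' [v' [u'j v'j _ uE vE]]]].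
apply: val_inj => /=; rewrite -(b'u _ (mem_tri j) (tri_neq ji)).
- by rewrite index_uniq ?(tri_uniq cs).
- by rewrite (pos_inj (mem_tri i) (mem_tri j) ui u'j uE).
- by rewrite (pos_inj (mem_tri i) (mem_tri j) vi v'j vE).
Qed.

Lemma tri_face_bend i j a b : i != j ->
  is_side (tri_face i) a b -> is_side (tri_face j) a b ->
  ~ coplanar (tri_face i ++ tri_face j).
Proof.
move=> ij /(is_sideP _ _ (mem_tri i))[u [v [ui vi uv -> ->]]].
move=> /(is_sideP _ _ (mem_tri j))[u' [v' [u'j v'j _ uE vE]]].
have uu' := pos_inj (mem_tri i) (mem_tri j) ui u'j uE.
have vv' := pos_inj (mem_tri i) (mem_tri j) vi v'j vE.
by apply: (bend (mem_tri i) (mem_tri j) (tri_neq ij) uv); rewrite // ?uu' ?vv'.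
Qed.

Lemma tri_face_vertex i a : a \in tri_face i ->
  (3 <= #|[pred j | a \in tri_face j]|)%N.
Proof.
move=> /mapP[u ui ->]; apply: leq_trans (tri_vertex cs (mem_tri i) ui) _.
rewrite -sum1_card -sum1_count (big_nth [::]) big_mkord.
rewrite [leqRHS](eq_bigl (fun j : 'I_(size B) => u \in nth [::] B j)) //.
move=> j; rewrite inE /tri_face; apply/mapP/idP => [[v vj e]|]; last by exists u.
by rewrite (pos_inj (mem_tri i) (mem_tri j) ui vj e).
Qed.

Definition solid_polyhedron : polyhedron R :=
  Polyhedron compact_solid solid_regular tri_face_simple tri_face_frontier
    tri_face_meet tri_face_across tri_face_bend tri_face_vertex.

Lemma mem_vertices x :
  x \in vertices solid_polyhedron <->
  exists2 b, b \in B & exists2 v, v \in b & x = pos v.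
Proof.
rewrite /vertices mem_undup; split=> [/flattenP[s /codomP[i ->]]|].
  by move=> /mapP[v vi ->]; exists (nth [::] B i); [exact: mem_tri|exists v].
move=> [b bB [v vb ->]]; apply/flattenP.
have iB : (index b B < size B)%N by rewrite index_mem.
exists (tri_face (Ordinal iB)); first exact: codom_f.
by rewrite /tri_face /= nth_index // map_f.
Qed.

Hypothesis uniqT : uniq T.
Hypothesis nondeg : {in T, forall t,
  Defs.nondegenerate [tuple pos (nth 0%N t j) | j < 4]}.

Definition tet (i : 'I_(size T)) : 4.-tuple 'rV[R]_3 :=
  [tuple pos (nth 0%N (nth [::] T i) j) | j < 4].

Lemma mem_tet (i : 'I_(size T)) : nth [::] T i \in T.
Proof. by rewrite mem_nth. Qed.

Lemma val_tet i : tval (tet i) = map pos (nth [::] T i).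
Proof.
have [_ sz] := tet_sorted cs (mem_tet i).
apply: (@eq_from_nth _ 0); first by rewrite size_tuple size_map sz.
move=> j; rewrite size_tuple => j4.
by rewrite -(tnth_nth _ _ (Ordinal j4)) tnth_mktuple (nth_map 0%N) ?sz.
Qed.

Lemma mem_tetE i p : (p \in tet i) = (p \in map pos (nth [::] T i)).
Proof. by rewrite -val_tet. Qed.

Lemma tet_diff t t' : t \in T -> t' \in T -> t != t' ->
  exists2 d, d \in t & d \notin t'.
Proof.
move=> tT t'T tt'; have [st zt] := tet_sorted cs tT.
have [st' zt'] := tet_sorted cs t'T.
apply/hasP; rewrite has_predC; apply: contra tt' => /allP tt'.
by rewrite (sorted_ltn_sub st st') // zt zt'.
Qed.

Lemma tet_hullI t t' : t \in T -> t' \in T ->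
  hull (map pos t) `&` hull (map pos t') = hull (map pos [seq v <- t | v \in t']).
Proof.
move=> tT t'T; have uI := filter_uniq (mem t') (tet_uniq tT).
have lI : all (gtn N) [seq v <- t | v \in t'].
  apply/allP => v; rewrite mem_filter => /andP[_]; apply: allP v; exact: labels.
rewrite (hull_place pos (tet_uniq tT) (labels tT)).
rewrite (hull_place pos (tet_uniq t'T) (labels t'T)) (hull_place pos uI lI).
apply/seteqP; split=> x.
  move=> [[w wt <-] [w' w't' e]]; exists w => //; apply: asimplexI => //.
  by have <- : w' = w by apply: inj => //; [exists t'|exists t].
move=> [w wI <-]; split; exists w => //; apply: asimplexW wI => v;
  by rewrite mem_filter => /andP[].
Qed.

Lemma triangulation_tet : @triangulation R solid_polyhedron (size T) tet.
Proof.
have neq (i j : 'I_(size T)) : i != j -> nth [::] T i != nth [::] T j.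
  by move=> ij; rewrite nth_uniq // -(inj_eq val_inj).
split.
- by move=> i; exact: (nondeg (mem_tet i)).
- move=> i p; rewrite mem_tetE => /mapP[v vt ->]; apply/mem_vertices.
  by have [b bB [vb _]] := tet_edge cs (mem_tet i) vt vt; exists b => //; exists v.
- rewrite /=; apply/seteqP; split=> x.
    by move=> [i _]; rewrite val_tet => xt; apply/solidE; exists (nth [::] T i) => //; exact: mem_tet.
  move=> /solidE[t tT xt]; have it : (index t T < size T)%N by rewrite index_mem.
  by exists (Ordinal it) => //; rewrite val_tet /= nth_index.
(* A common interior point would lie on the common face, where the coordinate of a vertex [d]
   belonging only to the first tetrahedron vanishes; a small step away from [d] makes it negative
   although it stays in that tetrahedron. *)
- move=> i j ij; apply/seteqP; split=> // x [xi xj].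
  have [d di dj] := tet_diff (mem_tet i) (mem_tet j) (neq _ _ ij).
  have tT := mem_tet i; have [c [u cu]] := coords tT.
  have [s /andP[s0 s1]] := small_step (x - pos d) xi.
  rewrite val_tet => /(mem_hull (tet_uniq tT) (labels tT) cu)/(_ d di).
  have -> : x + s *: (x - pos d) = x + (- s) *: (pos d - x).
    by rewrite scaleNr -scalerN opprB.
  rewrite aff_step; have [cu1 _ _] := cu; rewrite (cu1 d d di di) eqxx.
  have : (hull (tet i) `&` hull (tet j)) x.
    by split; exact: interior_subset.
  rewrite !val_tet (tet_hullI tT (mem_tet j)) => xI.
  have -> : aff (c d) (u d) x = 0.
    have uI := filter_uniq (mem (nth [::] T j)) (tet_uniq tT).
    have lI : all (gtn N) [seq v <- nth [::] T i | v \in nth [::] T j].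
      apply/allP => v; rewrite mem_filter => /andP[_]; apply: allP v; exact: labels.
    move: xI; rewrite (hull_place pos uI lI) => -[w wI <-].
    have dN := allP (labels tT) _ di.
    rewrite -(asimplex_aff cu _ (i := Ordinal dN)) //; last first.
      by apply: asimplexW wI => v; rewrite mem_filter => /andP[].
    have [_ _ wd] := wI; apply/eqP; apply: contraT => /wd /=.
    by rewrite mem_filter => /andP[d_in _]; case/negP: dj.
  by rewrite mulr0 add0r mulr1 oppr_ge0 leNgt s0.
move=> i j ij; exists (map pos [seq v <- nth [::] T i | v \in nth [::] T j]).
have [d di dj] := tet_diff (mem_tet i) (mem_tet j) (neq _ _ ij).
rewrite !val_tet; split.
- rewrite size_map size_filter -ltnS.
  have [_ <-] := tet_sorted cs (mem_tet i).
  rewrite ltn_neqAle count_size andbT; apply: contra dj.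
  by rewrite -all_count => /allP; apply.
- by move=> _ /mapP[v vI ->]; rewrite mem_tetE; apply: map_f; move: vI; rewrite mem_filter => /andP[].
- by move=> _ /mapP[v vI ->]; rewrite mem_tetE; apply: map_f; move: vI; rewrite mem_filter => /andP[].
- by rewrite tet_hullI ?mem_tet.
Qed.

Hypothesis only_tets : forall s : seq nat, uniq s -> size s = 4%N ->
  {in s, forall v, exists2 b, b \in B & v \in b} ->
  hull (map pos s) `<=` solid -> exists2 t, t \in T & s =i t.

(** In any triangulation the barycentre of a given tetrahedron of [T] lies in some member, and the
    vertices of this member form a tetrahedron of [T] by [only_tets]. By [inj] it carries all the
    weights of the barycentre, so both have the same vertices. Distinct tetrahedra of [T] thus
    require distinct members. *)
Lemma triangulation_size m : triangulable_in solid_polyhedron m -> (size T <= m)%N.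
Proof.
move=> [T' [nd sub cov _ _]].
have lab i : exists s : seq nat, [/\ uniq s, size s = 4%N,
    {in s, forall v, exists2 b, b \in B & v \in b} & tval (T' i) = map pos s].
  have vs j : exists v, (exists2 b, b \in B & v \in b) /\ tnth (T' i) j = pos v.
    have /sub/mem_vertices[b bB [v vb e]] := mem_tnth j (T' i).
    by exists v; split=> //; exists b.
  pose f j := projT1 (cid (vs j)).
  have fP j : (exists2 b, b \in B & f j \in b) /\ tnth (T' i) j = pos (f j).
    by rewrite /f; case: cid.
  exists (map f (enum 'I_4)); split.
  - rewrite map_inj_in_uniq ?enum_uniq // => j k _ _ e.
    have [c [u [cu1 _ _]]] := nondegenerate_coordinates (nd i).
    have [_ jE] := fP j; have [_ kE] := fP k.
    have := cu1 j k; rewrite kE -e -jE cu1 eqxx.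
    by case: eqP => // _ /eqP; rewrite oner_eq0.
  - by rewrite size_map size_enum_ord.
  - by move=> _ /mapP[j _ ->]; have [] := fP j.
  - rewrite -map_comp -[LHS](map_tnth_enum (T' i)).
    by apply: eq_map => j /=; have [_ <-] := fP j.
have found (i : 'I_(size T)) : exists k, {subset tval (tet i) <= tval (T' k)}.
  have tT := mem_tet i; set t := nth [::] T i in tT.
  have st : (0 < size t)%N by have [_ ->] := tet_sorted cs tT.
  have gt := asimplex_uniform R (tet_uniq tT) (labels tT) st.
  have : solid (place pos (uniform R N t)) by exists (uniform R N t) => //; exists t.
  rewrite -[solid]/(body solid_polyhedron) -cov => -[k _ gk]; exists k.
  have [s [us zs ls sE]] := lab k.
  have hs : hull (map pos s) `<=` solid.
    by rewrite -sE -[solid]/(body solid_polyhedron) -cov => x xk; exists k.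
  have [t' t'T st'] := only_tets us zs ls hs.
  have lN : all (gtn N) s.
    by apply/allP => v; rewrite st'; apply: allP v; exact: labels.
  move: gk; rewrite sE (hull_place pos us lN) => -[w ws e].
  have we : w = uniform R N t.
    apply: inj => //; last by exists t.
    by exists t' => //; apply: asimplexW ws => v; rewrite st'.
  move=> p; rewrite val_tet => /mapP[v vt ->]; apply: map_f.
  have vN := allP (labels tT) _ vt.
  case: ws => _ _ /(_ (Ordinal vN)); apply.
  by rewrite we mxE /= -/t vt invr_eq0 pnatr_eq0 -lt0n.
pose f i := projT1 (cid (found i)).
have fP i : {subset tval (tet i) <= tval (T' (f i))} by rewrite /f; case: cid.
have f_inj : injective f.
  move=> i j fij; apply/eqP; apply: contraT => ij.
  have [d di dj] : exists2 d, d \in nth [::] T i & d \notin nth [::] T j.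
    apply: tet_diff; rewrite ?mem_tet // nth_uniq //.
  have uT k : uniq (tval (tet k)).
    rewrite val_tet map_inj_in_uniq ?(tet_uniq (mem_tet k)) // => v v' vt v't.
    have [b bB [vb _]] := tet_edge cs (mem_tet k) vt vt.
    have [b' b'B [vb' _]] := tet_edge cs (mem_tet k) v't v't.
    exact: (pos_inj bB b'B).
  have E k : tval (tet k) =i tval (T' (f k)).
    by have [] := uniq_min_size (uT k) (fP k); rewrite ?size_tuple.
  have : pos d \in tval (tet j) by rewrite E -fij -E val_tet map_f.
  rewrite val_tet => /mapP[d' d'j e]; case/negP: dj.
  have [b bB [vb _]] := tet_edge cs (mem_tet i) di di.
  have [b' b'B [vb' _]] := tet_edge cs (mem_tet j) d'j d'j.
  by rewrite (pos_inj bB b'B vb vb' e).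
by have := leq_card f f_inj; rewrite !card_ord.
Qed.

End Solid.

(** * Gluing along a triangle *)

(** A strictly increasing relabelling keeps the lists sorted; the other conditions only compare
    labels. *)
Lemma relabel_closed (f : nat -> nat) T B : {mono f : x y / (x < y)%N} ->
  closed_surface T B ->
  closed_surface (map (map f) T) (map (map f) B).
Proof.
move=> fm cs.
have fI : injective f.
  by move=> x y e; case: (ltngtP x y) => //; rewrite -fm e ltnn.
have FI : injective (map f) by exact: inj_map.
have srt s : sorted ltn (map f s) = sorted ltn s.
  by rewrite sorted_map; apply: eq_sorted => x y; rewrite /relpre /= fm.
have sub s t : {subset map f s <= map f t} <-> {subset s <= t}.
  split=> st x; first by move=> xs; rewrite -(mem_map fI); apply: st; rewrite map_f.
  by move=> /mapP[y ys ->]; rewrite map_f // st.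
have flt d s : [seq v <- map f s | v != f d] = map f [seq v <- s | v != d].
  by rewrite filter_map; congr map; apply: eq_filter => v /=; rewrite (inj_eq fI).
split.
- by move=> _ /mapP[t /(tet_sorted cs)[st zt] ->]; rewrite srt size_map.
- by move=> _ /mapP[t /(tri_sorted cs)[st zt] ->]; rewrite srt size_map.
- by rewrite map_inj_uniq // (tri_uniq cs).
- move=> _ /mapP[b bB ->]; have [t [tT bt] tu] := tri_tet cs bB.
  exists (map f t); first by rewrite map_f // sub.
  by move=> _ /mapP[t' t'T ->] /sub bt'; rewrite (tu t').
- move=> _ /mapP[t tT ->] _ /mapP[d dt ->]; rewrite flt.
  have [bB|[t' [t'T t't] st']] := tet_tri cs tT dt; first by left; rewrite map_f.
  right; exists (map f t'); last by apply/sub.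
  by rewrite map_f // (inj_eq FI).
- move=> _ /mapP[t tT ->] _ _ /mapP[u ut ->] /mapP[v vt ->].
  have [b bB [ub vb]] := tet_edge cs tT ut vt.
  by exists (map f b); rewrite ?map_f.
- move=> _ /mapP[b bB ->] _ _ /mapP[u ub ->] /mapP[v vb ->] uv.
  have {}uv : u != v by apply: contraNneq uv => ->.
  have [b' [b'B b'b ub' vb'] bu] := tri_across cs bB ub vb uv.
  exists (map f b'); first by rewrite !map_f // (inj_eq FI).
  move=> _ /mapP[b'' b''B ->]; rewrite (inj_eq FI) !(mem_map fI) => h1 h2 h3.
  by rewrite (bu b'').
- move=> _ /mapP[b bB ->] _ /mapP[u ub ->].
  apply: leq_trans (tri_vertex cs bB ub) _; rewrite count_map.
  by apply: sub_count => b' /= ub'; rewrite map_f.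
Qed.

Section Glue.
Variables (T1 B1 T2 B2 : seq (seq nat)) (g : seq nat).
Hypotheses (cs1 : closed_surface T1 B1) (cs2 : closed_surface T2 B2).
Hypotheses (gB1 : g \in B1) (gB2 : g \in B2).
Hypothesis common : forall t1 t2 v,
  t1 \in T1 -> t2 \in T2 -> v \in t1 -> v \in t2 -> v \in g.

Let B := [seq b <- B1 | b != g] ++ [seq b <- B2 | b != g].

Lemma glue_common b1 b2 v : b1 \in B1 -> b2 \in B2 ->
  v \in b1 -> v \in b2 -> v \in g.
Proof.
move=> b1B b2B v1 v2; have [t1 [t1T s1] _] := tri_tet cs1 b1B.
by have [t2 [t2T s2] _] := tri_tet cs2 b2B; apply: (common t1T t2T); [exact: s1|exact: s2].
Qed.

Lemma glue_disjoint b : b \in B1 -> b \in B2 -> b = g.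
Proof.
move=> b1 b2; have [sb zb] := tri_sorted cs1 b1; have [sg zg] := tri_sorted cs1 gB1.
apply: sorted_ltn_sub => //; first by rewrite zb zg.
by move=> v vb; exact: (glue_common b1 b2).
Qed.

(** A triangle other than [g] cannot lie in a tetrahedron of the other piece: its three vertices
    would all be common, hence those of [g]. *)
Lemma glue_tri_tet b : b \in B1 -> b != g ->
  exists2 t, (t \in T1 ++ T2) /\ {subset b <= t}
  & {in T1 ++ T2, forall t', {subset b <= t'} -> t' = t}.
Proof.
move=> bB bg; have [t [tT bt] tu] := tri_tet cs1 bB.
exists t; first by rewrite mem_cat tT.
move=> t'; rewrite mem_cat => /orP[/tu //|t'T bt'].
case/eqP: bg; have [sb zb] := tri_sorted cs1 bB; have [sg zg] := tri_sorted cs1 gB1.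
apply: sorted_ltn_sub => //; first by rewrite zb zg.
by move=> v vb; apply: (common tT t'T); [exact: bt|exact: bt'].
Qed.

(** A facet equal to [g] stops being a boundary triangle and is now shared with the tetrahedron on
    [g] in the other piece. *)
Lemma glue_tet_tri t d : t \in T1 -> d \in t ->
  [seq v <- t | v != d] \in B \/
  (exists2 t', (t' \in T1 ++ T2) /\ t' != t & {subset [seq v <- t | v != d] <= t'}).
Proof.
move=> tT dt; have [fB|[t' [t'T t't] st']] := tet_tri cs1 tT dt; last first.
  by right; exists t' => //; rewrite mem_cat t'T.
have [fg|fg] := eqVneq [seq v <- t | v != d] g; last first.
  by left; rewrite mem_cat mem_filter fg fB.
right; have [t2 [t2T gt2] _] := tri_tet cs2 gB2.
exists t2; last by rewrite fg.
split; first by rewrite mem_cat t2T orbT.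
apply/eqP => t2t; have [_ zt] := tet_sorted cs1 tT; have [_ zg] := tri_sorted cs1 gB1.
have : (size t <= size g)%N.
  apply: uniq_leq_size (tet_uniq cs1 tT) _ => v vt.
  by apply: (common tT t2T) => //; rewrite t2t.
by rewrite zt zg.
Qed.

(** An edge whose boundary triangle is the glued one lies, by [tri_across], in another boundary
    triangle of the same piece; for a single vertex any edge of [g] at it will do. *)
Lemma glue_tet_edge t u v : t \in T1 -> u \in t -> v \in t ->
  exists2 b, b \in B & u \in b /\ v \in b.
Proof.
move=> tT ut vt; have [b bB [ub vb]] := tet_edge cs1 tT ut vt.
have [bg|bg] := eqVneq b g; last first.
  by exists b => //; rewrite mem_cat mem_filter bg bB.
have use w : w \in b -> u != w -> (v == u) || (v == w) ->
    exists2 b, b \in B & u \in b /\ v \in b.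
  move=> wb uw vuw; have [b' [b'B b'b ub' wb'] _] := tri_across cs1 bB ub wb uw.
  exists b'; first by rewrite mem_cat mem_filter -bg b'b b'B.
  by split=> //; case/orP: vuw => /eqP->.
have [uv|uv] := eqVneq u v; last by apply: (use v vb uv); rewrite eqxx orbT.
have [A1 [A2 [A3 [bE [n12 n13 n23]]]]] := triP cs1 bB.
have [uA|uA] := eqVneq u A1.
  by apply: (use A2); rewrite ?bE ?uA ?inE ?eqxx ?orbT -?uv ?uA ?eqxx.
by apply: (use A1); rewrite ?bE ?inE ?eqxx ?orbT -?uv ?eqxx.
Qed.

(** Along an edge of [g] the neighbours of [g] in the two pieces become neighbours of each other. *)
Lemma glue_across b u v : b \in B1 -> b != g -> u \in b -> v \in b -> u != v ->
  exists2 b', [/\ b' \in B, b' != b, u \in b' & v \in b']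
  & {in B, forall b'', b'' != b -> u \in b'' -> v \in b'' -> b'' = b'}.
Proof.
move=> bB bg ub vb uv; have [b' [b'B b'b ub' vb'] bu] := tri_across cs1 bB ub vb uv.
have [b'g|b'g] := eqVneq b' g; last first.
  exists b'; first by rewrite mem_cat mem_filter b'g b'B.
  move=> b''; rewrite mem_cat !mem_filter => /orP[/andP[_ /bu //]|/andP[_ b''B]] _ ub'' vb''.
  case/eqP: b'g; symmetry; apply: bu => //; first by rewrite eq_sym.
    exact: (glue_common bB b''B).
  exact: (glue_common bB b''B).
move: ub' vb'; rewrite b'g => ug vg.
have [g2 [g2B g2g ug2 vg2] gu] := tri_across cs2 gB2 ug vg uv.
exists g2.
  split=> //; first by rewrite mem_cat !mem_filter g2g g2B orbT.
  by apply: contraNneq bg => g2b; apply/eqP/glue_disjoint; rewrite -?g2b // g2b.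
move=> b''; rewrite mem_cat !mem_filter => /orP[/andP[b''g b''B]|/andP[b''g b''B]] b''b ub'' vb''.
  by case/eqP: b''g; rewrite -b'g; exact: bu.
exact: gu.
Qed.

Lemma glue_count u (B' T' : seq (seq nat)) : closed_surface T' B' -> g \in B' ->
  count (fun b => u \in b) [seq b <- B' | b != g] =
  (count (fun b => u \in b) B' - (u \in g))%N.
Proof.
by move=> cs gB'; rewrite -(rem_filter g (tri_uniq cs)) count_rem gB'.
Qed.

(** A vertex of [g] loses one triangle in each piece, and at least 2 + 2 remain. *)
Lemma glue_vertex b u : b \in B1 -> b != g -> u \in b ->
  (3 <= count (fun b' => u \in b') B)%N.
Proof.
move=> bB bg ub; rewrite count_cat (glue_count u cs1 gB1) (glue_count u cs2 gB2).
have := tri_vertex cs1 bB ub.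
case ug: (u \in g); last by rewrite !subn0 => h; rewrite (leq_trans h) // leq_addr.
have := tri_vertex cs1 gB1 ug; have := tri_vertex cs2 gB2 ug.
by rewrite /nat_of_bool; lia.
Qed.

End Glue.

(** The preceding lemmas speak of the first piece; each is used a second time with the pieces
    exchanged, which changes the lists only in their order. *)
Lemma glue_closed T1 B1 T2 B2 g :
  closed_surface T1 B1 -> closed_surface T2 B2 -> g \in B1 -> g \in B2 ->
  (forall t1 t2 v, t1 \in T1 -> t2 \in T2 -> v \in t1 -> v \in t2 -> v \in g) ->
  closed_surface (T1 ++ T2)
    ([seq b <- B1 | b != g] ++ [seq b <- B2 | b != g]).
Proof.
move=> cs1 cs2 gB1 gB2 common.
have common' t1 t2 v : t1 \in T2 -> t2 \in T1 -> v \in t1 -> v \in t2 -> v \in g.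
  by move=> h1 h2 h3 h4; exact: (common t2 t1).
have swapT t : (t \in T1 ++ T2) = (t \in T2 ++ T1) by rewrite !mem_cat orbC.
set B := [seq b <- B1 | b != g] ++ _; pose B' := [seq b <- B2 | b != g] ++ [seq b <- B1 | b != g].
have swapB b : (b \in B) = (b \in B') by rewrite /B /B' !mem_cat orbC.
have inB b : b \in B -> (b \in B1 \/ b \in B2) /\ b != g.
  by rewrite /B mem_cat !mem_filter => /orP[]/andP[bg bB]; split=> //; [left|right].
split.
- by move=> t; rewrite mem_cat => /orP[/(tet_sorted cs1)|/(tet_sorted cs2)].
- by move=> b /inB[[/(tri_sorted cs1)|/(tri_sorted cs2)]].
- rewrite cat_uniq !filter_uniq ?(tri_uniq cs1) ?(tri_uniq cs2) //= andbT.
  apply/hasPn => b; rewrite !mem_filter => /andP[bg b2].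
  rewrite bg /=; apply: contra bg => b1.
  by rewrite (glue_disjoint cs1 cs2 gB1 common b1 b2).
- move=> b /inB[[bB|bB] bg]; first exact: (glue_tri_tet cs1 gB1 common bB bg).
  have [t [tT bt] tu] := glue_tri_tet cs2 gB2 common' bB bg.
  by exists t; [rewrite swapT|move=> t' ; rewrite swapT; exact: tu].
- move=> t; rewrite mem_cat => /orP[tT|tT] d dt.
    exact: (glue_tet_tri cs1 cs2 gB1 gB2 common tT dt).
  have [fB|[t' [t'T t't] st']] := glue_tet_tri cs2 cs1 gB2 gB1 common' tT dt.
    by left; rewrite swapB.
  by right; exists t' => //; rewrite swapT.
- move=> t; rewrite mem_cat => /orP[tT|tT] u v ut vt.
    exact: (@glue_tet_edge T1 B1 B2 g cs1 t u v tT ut vt).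
  have [b bB uvb] := @glue_tet_edge T2 B2 B1 g cs2 t u v tT ut vt.
  by exists b => //; rewrite swapB.
- move=> b /inB[[bB|bB] bg] u v ub vb uv.
    exact: (glue_across cs1 cs2 gB1 gB2 common bB bg ub vb uv).
  have [b' [b'B b'b ub' vb'] bu] := glue_across cs2 cs1 gB2 gB1 common' bB bg ub vb uv.
  exists b'; first by rewrite swapB.
  by move=> b''; rewrite swapB; exact: bu.
- move=> b /inB[[bB|bB] bg] u ub; first exact: (glue_vertex cs1 cs2 gB1 gB2 bB bg ub).
  have := glue_vertex cs2 cs1 gB2 gB1 bB bg ub.
  by rewrite !count_cat addnC.
Qed.

Definition closed_surfaceb (T B : seq (seq nat)) : bool :=
  let sub (b t : seq nat) := all (mem t) b in
  [&& all (fun t : seq nat => sorted ltn t && (size t == 4%N)) T,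
      all (fun b : seq nat => sorted ltn b && (size b == 3%N)) B,
      uniq B,
      all (fun b : seq nat => has (fun t => sub b t &&
        all (fun t' => sub b t' ==> (t' == t)) T) T) B &
  [&& all (fun t : seq nat => all (fun d => ([seq v <- t | v != d] \in B) ||
        has (fun t' => (t' != t) && sub [seq v <- t | v != d] t') T) t) T,
      all (fun t : seq nat => all (fun u => all (fun v =>
        has (fun b : seq nat => (u \in b) && (v \in b)) B) t) t) T,
      all (fun b : seq nat => all (fun u => all (fun v => (u != v) ==>
        has (fun b' : seq nat => [&& b' != b, u \in b', v \in b' &
          all (fun b'' : seq nat => [&& b'' != b, u \in b'' & v \in b''] ==> (b'' == b')) B])
          B) b) b) B &
      all (fun b : seq nat => all (fun u => (3 <= count (fun b' : seq nat => u \in b') B)%N) b) B]].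

Lemma closed_surfaceP T B : closed_surfaceb T B -> closed_surface T B.
Proof.
case/and5P=> /allP h1 /allP h2 h3 /allP h4 /and4P[/allP h5 /allP h6 /allP h7 /allP h8].
split=> //.
- by move=> t /h1/andP[? /eqP].
- by move=> t /h2/andP[? /eqP].
- move=> b /h4/hasP[t tT /andP[/allP bt /allP tu]].
  exists t; first by split=> // v /bt.
  by move=> t' /tu/implyP h bt'; apply/eqP/h/allP => v /bt'.
- move=> t /h5/allP h d /h/orP[|/hasP[t' t'T /andP[t't /allP st]]]; first by left.
  by right; exists t' => // v /st.
- by move=> t /h6/allP h u v /h/allP h' /h'/hasP[b bB /andP[]]; exists b.
- move=> b /h7/allP h u v /h/allP h' /h'/implyP h'' /h''/hasP[b' b'B].
  case/and4P=> b'b ub' vb' /allP bu; exists b' => // b'' /bu/implyP bu' k1 k2 k3.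
  by apply/eqP/bu'; rewrite k1 k2 k3.
- by move=> b /h8/allP h u /h.
Qed.

(** * The chain of tori *)

(* The Csaszar torus: all 21 edges on 7 vertices occur. *)
Definition block_tets : seq (seq nat) :=
  [:: [:: 0; 1; 2; 6]; [:: 0; 1; 3; 4]; [:: 0; 1; 3; 6]; [:: 0; 3; 4; 5];
      [:: 1; 2; 5; 6]; [:: 2; 3; 4; 5]; [:: 2; 4; 5; 6]]%N.

Definition block_sides : seq (seq nat) :=
  [:: [:: 0; 1; 4]; [:: 0; 2; 6]; [:: 0; 3; 5]; [:: 0; 3; 6]; [:: 0; 4; 5];
      [:: 1; 2; 5]; [:: 1; 3; 4]; [:: 1; 3; 6]; [:: 1; 5; 6]; [:: 2; 3; 4];
      [:: 2; 3; 5]; [:: 2; 4; 6]]%N.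

(** The step 4 makes the labels 4, 5, 6 of a block coincide with 0, 1, 2 of the next one ([gateE]),
    so that consecutive blocks share exactly a gate. *)
Definition shift i (s : seq nat) : seq nat := map (addn (4 * i)) s.

Definition block_tris := block_sides ++ [:: [:: 0; 1; 2]; [:: 4; 5; 6]]%N.

Definition gate i : seq nat := shift i [:: 0; 1; 2]%N.

Fixpoint chain_tets m : seq (seq nat) :=
  if m is m'.+1 then chain_tets m' ++ map (shift m) block_tets
  else block_tets.

Fixpoint chain_tris m : seq (seq nat) :=
  if m is m'.+1 then
    [seq b <- chain_tris m' | b != gate m] ++
    [seq b <- map (shift m) block_tris | b != gate m]
  else block_tris.

(** The stacked tetrahedra form a fan around the edge of 0 and 1. Its rim starts at the label 2, so
    that [lid m 0] is the first gate, and goes on with fresh labels from [4 * m + 7]. *)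
Definition crest m j : nat := if j is j'.+1 then (4 * m + 7 + j')%N else 2%N.

Definition cap_tet m j : seq nat := [:: 0%N; 1%N; crest m j; crest m j.+1].
Definition lid m j : seq nat := [:: 0%N; 1%N; crest m j].

Fixpoint toroid_tets m k : seq (seq nat) :=
  if k is j.+1 then toroid_tets m j ++ [:: cap_tet m j] else chain_tets m.

Fixpoint toroid_tris m k : seq (seq nat) :=
  if k is j.+1 then
    [seq b <- toroid_tris m j | b != lid m j] ++
    [seq b <- [:: lid m j; lid m j.+1; [:: 0%N; crest m j; crest m j.+1];
       [:: 1%N; crest m j; crest m j.+1]] | b != lid m j]
  else chain_tris m.

Lemma shift0 s : shift 0 s = s.
Proof. by rewrite /shift muln0 -[RHS]map_id; apply: eq_map. Qed.

Lemma block_closed : closed_surface block_tets block_tris.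
Proof. by apply: closed_surfaceP; vm_compute. Qed.

Lemma block_tet_lt t v : t \in block_tets -> v \in t -> (v < 7)%N.
Proof.
have : all (all (gtn 7)) block_tets by [].
by move=> /allP h /h/allP h' /h'.
Qed.

Lemma block_tri_lt b v : b \in block_tris -> v \in b -> (v < 7)%N.
Proof.
have : all (all (gtn 7)) block_tris by [].
by move=> /allP h /h/allP h' /h'.
Qed.

Lemma mem_chain_tets m t : t \in chain_tets m <->
  exists i t0, [/\ (i <= m)%N, t0 \in block_tets & t = shift i t0].
Proof.
elim: m t => [|m IH] t; rewrite /chain_tets -/chain_tets.
  split=> [tT|[i [t0 [+ t0T ->]]]].
    by exists 0%N, t; rewrite shift0.
  by rewrite leqn0 => /eqP->; rewrite shift0.
rewrite mem_cat; split=> [/orP[/IH[i [t0 [im t0T ->]]]|/mapP[t0 t0T ->]]|].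
- by exists i, t0; split=> //; exact: leqW.
- by exists m.+1, t0.
move=> [i [t0 [+ t0T ->]]]; rewrite leq_eqVlt => /orP[/eqP->|im].
  by rewrite map_f ?orbT.
by apply/orP; left; apply/IH; exists i, t0.
Qed.

Lemma chain_tet_lt m t v : t \in chain_tets m -> v \in t -> (v < 4 * m + 7)%N.
Proof.
move=> /mem_chain_tets[i [t0 [im t0T ->]]] /mapP[r rt ->].
by have := block_tet_lt t0T rt; lia.
Qed.

Lemma shift_inj i : injective (shift i).
Proof. by apply: inj_map => x y /addnI. Qed.

Lemma gateE i : gate i.+1 = shift i [:: 4; 5; 6]%N.
Proof. by rewrite /gate /shift /=; congr [:: _; _; _]; lia. Qed.

Lemma mem_block_tris b : (b \in block_tris) =
  [|| b \in block_sides, b == [:: 0; 1; 2]%N | b == [:: 4; 5; 6]%N].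
Proof. by rewrite mem_cat mem_seq2. Qed.

Lemma chain_trisS m : chain_tris m.+1 = [seq b <- chain_tris m | b != gate m.+1] ++
  [seq b <- map (shift m.+1) block_tris | b != gate m.+1].
Proof. by []. Qed.

(** Inner gates cancel in the gluing and nothing else does: a side triangle differs from the gates
    of its own block by inspection, and from the other gates by the range of its labels. *)
Lemma mem_chain_tris m b : b \in chain_tris m <->
  [\/ exists i b0, [/\ (i <= m)%N, b0 \in block_sides & b = shift i b0],
      b = gate 0 | b = gate m.+1].
Proof.
have sideS i b0 : b0 \in block_sides -> shift i b0 != gate i /\ shift i b0 != gate i.+1.
  rewrite gateE /gate !(inj_eq (@shift_inj i)).
  have : all (fun b => (b != [:: 0; 1; 2]%N) && (b != [:: 4; 5; 6]%N)) block_sides by [].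
  by move=> /allP h /h/andP.
have gate_inj i j : gate i = gate j -> i = j.
  by rewrite /gate /shift /= => -[]; lia.
have sideN i j b0 : b0 \in block_sides -> shift i b0 <> gate j.
  move=> b0B; have [/eqP n1 /eqP n2] := sideS i b0 b0B => e.
  case: (ltngtP j i) => [ji|ij|ij].
  - have : all (fun b => size b == 3%N) block_sides by [].
    move=> /allP/(_ _ b0B); case: b0 b0B n1 n2 e => [|x [|y [|z []]]] //= _ _ _.
    by rewrite /gate /shift /= => -[]; lia.
  - case: (ltngtP j i.+1) => [|ij'|ij']; first by rewrite ltnS leqNgt ij.
      have lt7 v : v \in b0 -> (v < 7)%N by apply: block_tri_lt; rewrite mem_cat b0B.
      have : all (fun b => size b == 3%N) block_sides by [].
      move=> /allP/(_ _ b0B); case: b0 b0B n1 n2 lt7 e => [|x [|y [|z []]]] //= _ _ _ lt7.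
      by rewrite /gate /shift /= => -[]; have := lt7 x (mem_head _ _); lia.
    by apply: n2; rewrite e ij'.
  - by apply: n1; rewrite e ij.
elim: m b => [|m IH] b.
  rewrite -[chain_tris 0]/block_tris mem_block_tris.
  split=> [/or3P[bB|/eqP->|/eqP->]|[[i [b0 [+ b0B ->]]]|->|->]].
  - by constructor 1; exists 0%N, b; rewrite shift0.
  - by constructor 2; rewrite /gate shift0.
  - by constructor 3.
  - by rewrite leqn0 => /eqP->; rewrite shift0 b0B.
  - by rewrite /gate shift0 eqxx !orbT.
  - by rewrite gateE shift0 eqxx !orbT.
rewrite chain_trisS mem_cat !mem_filter; split.
  move=> /orP[/andP[bg /IH[[i [b0 [im b0B ->]]]|->|bE]]|/andP[bg /mapP[b0 + bE]]].
  - by constructor 1; exists i, b0; split=> //; exact: leqW.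
  - by constructor 2.
  - by move: bg; rewrite bE eqxx.
  - rewrite mem_block_tris => /or3P[b0B|/eqP b0E|/eqP b0E].
    + by constructor 1; exists m.+1, b0.
    + by move: bg; rewrite bE b0E eqxx.
    + by constructor 3; rewrite gateE bE b0E.
case=> [[i [b0 [+ b0B bE]]]|->|->].
- rewrite leq_eqVlt => /orP[/eqP im|im].
    apply/orP; right; rewrite bE im map_f ?mem_block_tris ?b0B // andbT.
    by have [] := sideS m.+1 b0 b0B.
  apply/orP; left; apply/andP; split; first by rewrite bE; apply/eqP/sideN.
  by apply/IH; constructor 1; exists i, b0.
- apply/orP; left; apply/andP; split; first by apply/eqP => /gate_inj.
  by apply/IH; constructor 2.
- apply/orP; right; apply/andP; split; first by apply/eqP => /gate_inj; lia.
  by rewrite gateE map_f // mem_block_tris eqxx !orbT.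
Qed.

Lemma chain_closed m : closed_surface (chain_tets m) (chain_tris m).
Proof.
elim: m => [|m IH]; first exact: block_closed.
apply: glue_closed => //.
- apply: relabel_closed block_closed => x y; exact: ltn_add2l.
- by apply/mem_chain_tris; constructor 3.
- by rewrite /gate map_f // mem_block_tris eqxx !orbT.
move=> t1 t2 v t1T /mapP[t0 t0T ->] v1 /mapP[r rt vE].
have := chain_tet_lt t1T v1; rewrite vE => r3.
by apply: map_f; rewrite !inE; lia.
Qed.

Lemma toroid_tet_lt m k t v : t \in toroid_tets m k -> v \in t ->
  (v < 4 * m + 7 + k)%N.
Proof.
elim: k t => [|k IH] t /=; first by rewrite addn0; exact: chain_tet_lt.
rewrite mem_cat !inE => /orP[tT vt|/eqP->]; first by have := IH t tT vt; lia.
rewrite !inE => /or4P[]/eqP->; rewrite ?/crest; try lia.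
by case: k {IH} => [|k]; lia.
Qed.

Lemma crest_lt m i j : (i < j)%N -> (crest m i < crest m j)%N.
Proof. by rewrite /crest; case: i j => [|i] [|j] //=; lia. Qed.

Lemma crest_gt1 m j : (1 < crest m j)%N.
Proof. by rewrite /crest; case: j => [|j] //; lia. Qed.

Lemma tetra_closed a b c d : (a < b)%N -> (b < c)%N -> (c < d)%N ->
  closed_surface [:: [:: a; b; c; d]]
    [:: [:: a; b; c]; [:: a; b; d]; [:: a; c; d]; [:: b; c; d]].
Proof.
(* Every increasing quadruple is a relabelling of 0, 1, 2, 3; the default value [d + i] keeps [f]
   strictly increasing beyond the list. *)
move=> ab bc cd; pose f i := nth (d + i)%N [:: a; b; c; d] i.
have fm : {mono f : x y / (x < y)%N}.
  have f_lt x y : (x < y)%N -> (f x < f y)%N.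
    by rewrite /f; case: x => [|[|[|[|x]]]]; case: y => [|[|[|[|y]]]] //=; rewrite ?nth_nil; lia.
  move=> x y; case: (ltngtP x y) => [/f_lt-> //|/f_lt h|->]; last exact: ltnn.
  by apply/negbTE; rewrite -leqNgt ltnW.
have := @relabel_closed f [:: [:: 0; 1; 2; 3]]%N
  [:: [:: 0; 1; 2]; [:: 0; 1; 3]; [:: 0; 2; 3]; [:: 1; 2; 3]]%N fm.
by apply; apply: closed_surfaceP; vm_compute.
Qed.

Lemma toroid_trisS m k : toroid_tris m k.+1 =
  [seq b <- toroid_tris m k | b != lid m k] ++
  [seq b <- [:: lid m k; lid m k.+1; [:: 0%N; crest m k; crest m k.+1];
     [:: 1%N; crest m k; crest m k.+1]] | b != lid m k].
Proof. by []. Qed.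

Lemma lid_toroid m k : lid m k \in toroid_tris m k.
Proof.
case: k => [|k]; first by apply/mem_chain_tris; constructor 2.
rewrite toroid_trisS mem_cat !mem_filter; apply/orP; right; apply/andP; split.
  by apply/eqP => -[]; have := @crest_lt m k k.+1 (ltnSn k); rewrite /crest; lia.
by rewrite in_cons mem_head orbT.
Qed.

Lemma toroid_closed m k : closed_surface (toroid_tets m k) (toroid_tris m k).
Proof.
elim: k => [|k IH]; first exact: chain_closed.
apply: glue_closed => //.
- by apply: tetra_closed => //; [exact: crest_gt1|exact: crest_lt].
- exact: lid_toroid.
- by rewrite mem_head.
move=> t1 t2 v t1T; rewrite inE => /eqP-> v1; rewrite !inE.
case/or4P=> /eqP vE; rewrite vE ?eqxx ?orbT //.
by have := toroid_tet_lt t1T v1; rewrite vE /=; lia.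
Qed.

(** * Determinants and separating planes *)

Section Volume.
Variable R : realType.
Implicit Types (p q r s x : 'rV[R]_3).

Definition pt (a b c : R) : 'rV[R]_3 := \row_(j < 3) nth 0 [:: a; b; c] j.

Lemma ptE a b c : (pt a b c 0 0 = a) * (pt a b c 0 1 = b) * (pt a b c 0 2 = c).
Proof. by rewrite !mxE. Qed.

(** Determinant of the edge vectors at [p], that is, six times the signed volume, written out so
    that [ring] and [field] can evaluate it. *)
Definition vol p q r s : R :=
  (q 0 0 - p 0 0) * ((r 0 1 - p 0 1) * (s 0 2 - p 0 2) - (r 0 2 - p 0 2) * (s 0 1 - p 0 1))
  - (q 0 1 - p 0 1) * ((r 0 0 - p 0 0) * (s 0 2 - p 0 2) - (r 0 2 - p 0 2) * (s 0 0 - p 0 0))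
  + (q 0 2 - p 0 2) * ((r 0 0 - p 0 0) * (s 0 1 - p 0 1) - (r 0 1 - p 0 1) * (s 0 0 - p 0 0)).

Lemma ord3E : (ord0 = 0 :> 'I_3) * (lift ord0 ord0 = 1 :> 'I_3) *
  (lift ord0 (lift ord0 ord0) = 2 :> 'I_3).
Proof. by split; first split; apply: val_inj. Qed.

Lemma sum3 (V : nmodType) (F : 'I_3 -> V) : \sum_k F k = F 0 + F 1 + F 2.
Proof. by rewrite !big_ord_recl big_ord0 addr0 !ord3E addrA. Qed.

Lemma det3 (A : 'M[R]_3) : \det A =
  A 0 0 * (A 1 1 * A 2 2 - A 1 2 * A 2 1) - A 0 1 * (A 1 0 * A 2 2 - A 1 2 * A 2 0)
  + A 0 2 * (A 1 0 * A 2 1 - A 1 1 * A 2 0).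
Proof.
rewrite (expand_det_row _ 0) sum3 /cofactor.
rewrite !(expand_det_row _ 0) !big_ord_recl !big_ord0 /cofactor !det_mx11 !mxE.
have E0 : lift 0 (0 : 'I_2) = 1 :> 'I_3 by apply: val_inj.
have E1 : lift 0 (ord0 : 'I_2) = 1 :> 'I_3 by apply: val_inj.
have E2 : lift 0 (lift 0 (0 : 'I_1)) = 2 :> 'I_3 by apply: val_inj.
have E3 : lift 0 (lift ord0 (0 : 'I_1)) = 2 :> 'I_3 by apply: val_inj.
have E4 : lift 0 (lift ord0 (ord0 : 'I_1)) = 2 :> 'I_3 by apply: val_inj.
have E5 : lift 0 (lift (lift ord0 (ord0 : 'I_1)) (0 : 'I_1)) = 1 :> 'I_3 by apply: val_inj.
have E6 : lift 1 (ord0 : 'I_2) = 0 :> 'I_3 by apply: val_inj.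
have E7 : lift 1 (lift ord0 (0 : 'I_1)) = 2 :> 'I_3 by apply: val_inj.
have E8 : lift 1 (lift ord0 (ord0 : 'I_1)) = 2 :> 'I_3 by apply: val_inj.
have E9 : lift 1 (lift (lift ord0 (ord0 : 'I_1)) (0 : 'I_1)) = 0 :> 'I_3 by apply: val_inj.
have E10 : lift 2 (ord0 : 'I_2) = 0 :> 'I_3 by apply: val_inj.
have E11 : lift 2 (lift ord0 (0 : 'I_1)) = 1 :> 'I_3 by apply: val_inj.
have E12 : lift 2 (lift ord0 (ord0 : 'I_1)) = 1 :> 'I_3 by apply: val_inj.
have E13 : lift 2 (lift (lift ord0 (ord0 : 'I_1)) (0 : 'I_1)) = 0 :> 'I_3 by apply: val_inj.
rewrite ?E0 ?E1 ?E2 ?E3 ?E4 ?E5 ?E6 ?E7 ?E8 ?E9 ?E10 ?E11 ?E12 ?E13.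
rewrite !addr0 /= !mulNr ?expr0 ?expr1 ?mul1r; ring.
Qed.

Lemma nondegenerate_vol (f : 'I_4 -> 'rV[R]_3) :
  Defs.nondegenerate [tuple f j | j < 4] <-> vol (f 0) (f 1) (f 2) (f 3) != 0.
Proof.
rewrite /Defs.nondegenerate det3 !mxE !tnth_mktuple.
have -> : ord0 = 0 :> 'I_4 by apply: val_inj.
have -> : lift 0 (0 : 'I_3) = 1 :> 'I_4 by apply: val_inj.
have -> : lift 0 (1 : 'I_3) = 2 :> 'I_4 by apply: val_inj.
have -> : lift 0 (2 : 'I_3) = 3 :> 'I_4 by apply: val_inj.
by [].
Qed.

Lemma coplanar_vol (S : seq 'rV[R]_3) p q r s : coplanar S ->
  p \in S -> q \in S -> r \in S -> s \in S -> vol p q r s = 0.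
Proof.
move=> [u u0 Su] pS qS rS sS; apply/eqP; apply: contraNT u0 => vol0.
pose f (j : 'I_4) := nth 0 [:: p; q; r; s] j.
have /nondegenerate_vol : vol (f 0) (f 1) (f 2) (f 3) != 0 by [].
rewrite /Defs.nondegenerate; set D := (X in \det X) => D0.
have uD : D \in unitmx by rewrite unitmxE unitfE.
suff Du : D *m u = 0 by rewrite -(mulKmx uD u) Du mulmx0.
have fS j : f j \in S by rewrite /f; case: j => [[|[|[|[|]]]]].
apply/row_matrixP => i; rewrite row_mul rowK row0 !tnth_mktuple mulmxBl.
by rewrite (Su _ _ (fS _) (fS ord0)) subrr.
Qed.

Definition col3 (a b d : R) : 'cV[R]_3 := \col_(j < 3) nth 0 [:: a; b; d] j.

Lemma aff_col3 c a b d x : aff c (col3 a b d) x = c + a * x 0 0 + b * x 0 1 + d * x 0 2.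
Proof. by rewrite /aff mxE sum3 !mxE /=; ring. Qed.

(** At a common point the separating function is nonpositive and nonnegative, hence zero, so both
    weight vectors live on vertices in the plane. These all belong to the nondegenerate tetrahedron
    [t0], on which [place] is injective. *)
Lemma place_inj_sep N (pos : nat -> 'rV[R]_3) (t t' t0 : seq nat) c u
    (c0 : nat -> R) (u0 : nat -> 'cV[R]_3) (w w' : 'rV[R]_N) :
  barycentric pos t0 c0 u0 ->
  {in t, forall v, aff c u (pos v) <= 0} ->
  {in t', forall v, 0 <= aff c u (pos v)} ->
  {in t, forall v, aff c u (pos v) = 0 -> v \in t0} ->
  {in t', forall v, aff c u (pos v) = 0 -> v \in t0} ->
  asimplex t w -> asimplex t' w' -> place pos w = place pos w' -> w = w'.
Proof.
move=> cu0 t_le t'_ge t_eq t'_eq wt w't' e.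
have [w0 w1 ws] := wt; have [w'0 w'1 w's] := w't'.
have le0 : forall i, w 0 i * aff c u (pos i) <= 0.
  move=> i; have [->|/ws/t_le h] := eqVneq (w 0 i) 0; first by rewrite mul0r.
  by rewrite mulr_ge0_le0.
have ge0 : forall i, 0 <= w' 0 i * aff c u (pos i).
  move=> i; have [->|/w's/t'_ge h] := eqVneq (w' 0 i) 0; first by rewrite mul0r.
  by rewrite mulr_ge0.
have s_le0 : aff c u (place pos w) <= 0 by rewrite aff_place // sumr_le0.
have s_ge0 : 0 <= aff c u (place pos w) by rewrite e aff_place // sumr_ge0.
have s0 : aff c u (place pos w) = 0 by apply/le_anti; rewrite s_le0 s_ge0.
have z i : w 0 i * aff c u (pos i) = 0.
  apply/eqP; rewrite -oppr_eq0; move: i; apply/forallP.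
  have /eqP := s0; rewrite aff_place // -oppr_eq0 -sumrN psumr_eq0 => [/allP h|i _].
    by apply/forallP => i; apply: h; rewrite mem_index_enum.
  by rewrite oppr_ge0.
have z' i : w' 0 i * aff c u (pos i) = 0.
  apply/eqP; move: i; apply/forallP.
  have /eqP := s0; rewrite e aff_place // psumr_eq0 => [/allP h|i _ //].
  by apply/forallP => i; apply: h; rewrite mem_index_enum.
apply: (place_inj cu0 _ _ e); split=> // i wi.
  by apply: t_eq; [exact: ws|move/eqP: (z i); rewrite mulf_eq0 (negbTE wi) => /eqP].
by apply: t'_eq; [exact: w's|move/eqP: (z' i); rewrite mulf_eq0 (negbTE wi) => /eqP].
Qed.

End Volume.

(* Vertex [4 * i + r] of the chain, for [r < 11]: the vertices of block [i] are
   [r < 7], those of block [i + 1] are [4 <= r < 11]. *)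
Definition vx : seq int := [:: 0; 0; 0; 2; 4; 4; 4; 6; 8; 8; 8].
Definition vy : seq int := [:: -1; 1; 4; 0; -1; 1; 4; 0; -1; 1; 4].
Definition vz : seq int := [:: 2; 4; 6; 0; -2; -4; -6; 0; 2; 4; 6].

Definition volz (p q r s : nat) : int :=
  let d (t : seq int) a := t`_a - t`_p in
  d vx q * (d vy r * d vz s - d vz r * d vy s)
  - d vy q * (d vx r * d vz s - d vz r * d vx s)
  + d vz q * (d vx r * d vy s - d vy r * d vx s).

(* Coefficients of affine functions [c + a * x + b * y + d * z] one of which
   separates any two tetrahedra of a block. *)
Definition block_planes : seq (int * int * int * int) :=
  [:: (2, -1, -2, 0); (2, -1, 2, 0); (10, -9, 2, -3); (22, -11, -2, -5);
      (6, -3, -2, -2); (6, -3, 2, -2); (2, -1, 0, -1); (10, -6, 2, -3);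
      (12, -13, 4, -4); (26, -9, -2, -3); (40, -13, -4, -4)].

Definition evalz (f : int * int * int * int) (v : nat) : int :=
  let: (c, a, b, d) := f in c + a * vx`_v + b * vy`_v + d * vz`_v.

Definition oppf (f : int * int * int * int) : int * int * int * int :=
  let: (c, a, b, d) := f in (- c, - a, - b, - d).

(** Integer version of the sign hypotheses of [place_inj_sep]. *)
Definition separates f (t t' t0 : seq nat) : bool :=
  [&& all (fun v => evalz f v <= 0) t, all (fun v => 0 <= evalz f v) t',
      all (fun v => (evalz f v == 0) ==> (v \in t0)) t &
      all (fun v => (evalz f v == 0) ==> (v \in t0)) t'].

(** The vertices in the plane must belong to one of the two tetrahedra, which then plays the role of
    [t0] in [place_inj_sep]. *)
Lemma block_separated : all (fun t => all (fun t' => (t != t') ==>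
  has (fun f => separates f t t' t || separates f t t' t')
    (block_planes ++ map oppf block_planes)) block_tets) block_tets.
Proof. by vm_compute. Qed.

(** General position, used both for nondegenerate tetrahedra and for non-coplanar neighbouring
    triangles of one block. *)
Lemma block_general : all (fun a => all (fun b => all (fun c => all (fun d =>
  uniq [:: a; b; c; d] ==> (volz a b c d != 0)) (iota 0 7)) (iota 0 7)) (iota 0 7))
  (iota 0 7).
Proof. by vm_compute. Qed.

(** * Position of the vertices *)

Section Position.
Variable R : realType.

(** In the first block the points 4, 5, 6 are the points 0, 1, 2 moved by 4 in [x] and reflected in
    [z]. Translating by [4 * i] and reflecting for odd [i] therefore makes consecutive blocks agree
    on their common gate ([bpt_next]). *)
Definition bpt (i r : nat) : 'rV[R]_3 :=
  pt ((4 * i)%:R + (vx`_r)%:~R) (vy`_r)%:~R ((-1) ^+ i * (vz`_r)%:~R).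

Definition chain_pos (v : nat) : 'rV[R]_3 := bpt (v %/ 4) (v %% 4).

(* Seen along the edge [0 1] these points lie on a strictly convex curve. *)
Definition cap_pt (j : nat) : 'rV[R]_3 :=
  pt (- j%:R) (4 / j.+1%:R) (3 + 3 / j.+1%:R - 6 * j%:R).

Definition position m (v : nat) : 'rV[R]_3 :=
  if (v < 4 * m + 7)%N then chain_pos v else cap_pt (v - (4 * m + 7)).+1.

Lemma bpt_next i r : (r < 7)%N -> bpt i (4 + r) = bpt i.+1 r.
Proof.
case: r => [|[|[|[|[|[|[|r]]]]]]] // _; rewrite /bpt /=; congr pt;
  by rewrite ?mulnS ?natrD ?exprS; ring.
Qed.

Lemma chain_posE i r : (r < 11)%N -> chain_pos (4 * i + r) = bpt i r.
Proof.
have lt4 j s : (s < 4)%N -> chain_pos (4 * j + s) = bpt j s.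
  by move=> s4; rewrite /chain_pos mulnC divnMDl // modnMDl divn_small // modn_small // addn0.
have lt8 j s : (s < 8)%N -> chain_pos (4 * j + s) = bpt j s.
  move=> s8; have [/lt4 //|s4] := ltnP s 4.
  have -> : (4 * j + s = 4 * j.+1 + (s - 4))%N by lia.
  by rewrite lt4 -?bpt_next; [congr bpt; lia|lia..].
move=> s11; have [/lt8 //|s8] := ltnP r 8.
have -> : (4 * i + r = 4 * i.+1 + (r - 4))%N by lia.
by rewrite lt8 -?bpt_next; [congr bpt; lia|lia..].
Qed.

Lemma vol_bpt i p q r s : vol (bpt i p) (bpt i q) (bpt i r) (bpt i s) =
  (-1) ^+ i * (volz p q r s)%:~R.
Proof.
rewrite /vol /bpt /volz /= !ptE.
rewrite !(rmorphD, rmorphB, rmorphM, rmorphN) /=; ring.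
Qed.

Lemma signr_neq0 i : (-1) ^+ i != 0 :> R.
Proof. by rewrite expf_neq0 // oppr_eq0 oner_eq0. Qed.

Lemma vol_block_neq0 i p q r s : uniq [:: p; q; r; s] ->
  {in [:: p; q; r; s], forall v, (v < 7)%N} ->
  vol (bpt i p) (bpt i q) (bpt i r) (bpt i s) != 0.
Proof.
move=> u lt7; rewrite vol_bpt mulf_neq0 ?signr_neq0 // intr_eq0.
have I v : v \in [:: p; q; r; s] -> v \in iota 0 7.
  by move=> /lt7 v7; rewrite mem_iota.
have /allP/(_ p (I _ _)) := block_general.
rewrite !inE eqxx => /(_ isT)/allP/(_ q (I _ _)).
rewrite !inE eqxx orbT => /(_ isT)/allP/(_ r (I _ _)).
rewrite !inE eqxx !orbT => /(_ isT)/allP/(_ s (I _ _)).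
by rewrite !inE eqxx !orbT => /(_ isT)/implyP; apply.
Qed.

(** An integer affine function for the first block, carried to block [i] by the same translation and
    reflection as the vertices. *)
Definition planef (i : nat) (f : int * int * int * int) : R * 'cV[R]_3 :=
  let: (c, a, b, d) := f in
  (c%:~R - a%:~R * (4 * i)%:R, col3 a%:~R b%:~R ((-1) ^+ i * d%:~R)).

Lemma aff_planef i f r :
  aff (planef i f).1 (planef i f).2 (bpt i r) = (evalz f r)%:~R.
Proof.
case: f => [[[c a] b] d]; rewrite /= aff_col3 /bpt !ptE /evalz.
have s2 : (-1) ^+ i * (-1) ^+ i = 1 :> R by rewrite -expr2 sqrr_sign.
rewrite !(rmorphD, rmorphM) /=.
have -> : (-1) ^+ i * d%:~R * ((-1) ^+ i * (vz`_r)%:~R) = d%:~R * (vz`_r)%:~R :> R.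
  by rewrite mulrACA s2 mul1r.
ring.
Qed.

Lemma position_chain m v : (v < 4 * m + 7)%N -> position m v = chain_pos v.
Proof. by rewrite /position => ->. Qed.

Lemma position_block m i r : (i <= m)%N -> (r < 7)%N ->
  position m (4 * i + r) = bpt i r.
Proof. by move=> im r7; rewrite position_chain ?chain_posE //; lia. Qed.

Lemma position_crest m j : position m (crest m j) = cap_pt j.
Proof.
case: j => [|j]; last first.
  by rewrite /crest /position ifF; [congr cap_pt; lia|lia].
rewrite /crest position_chain; last by lia.
rewrite -[2%N]/(4 * 0 + 2)%N chain_posE // /bpt /cap_pt /=.
by congr pt; rewrite ?muln0 ?invr1 ?expr0; ring.
Qed.

End Position.

Section ToroidGeometry.
Variables (R : realType) (m k : nat).
Let N := (4 * m + 7 + k)%N.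
Let pos := @position R m.

Lemma natrS1 (n : nat) : n.+1%:R = n%:R + 1 :> R. Proof. by rewrite -natr1. Qed.

Lemma natr_ge0 (n : nat) : 0 <= n%:R :> R. Proof. exact: ler0n. Qed.

Lemma pos0 : pos 0 = pt 0 (-1) 2.
Proof.
rewrite -[0%N]/(4 * 0 + 0)%N /pos position_block // /bpt /=.
by congr pt; rewrite ?muln0 ?expr0; ring.
Qed.

Lemma pos1 : pos 1 = pt 0 1 4.
Proof.
rewrite -[1%N]/(4 * 0 + 1)%N /pos position_block // /bpt /=.
by congr pt; rewrite ?muln0 ?expr0; ring.
Qed.

Lemma pos2 : pos 2 = pt 0 4 6.
Proof.
rewrite -[2%N]/(4 * 0 + 2)%N /pos position_block // /bpt /=.
by congr pt; rewrite ?muln0 ?expr0; ring.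
Qed.

Lemma pos4 : pos 4 = pt 4 (-1) (-2).
Proof.
rewrite -[4%N]/(4 * 0 + 4)%N /pos position_block // /bpt /=.
by congr pt; rewrite ?muln0 ?expr0; ring.
Qed.

Lemma pos5 : pos 5 = pt 4 1 (-4).
Proof.
rewrite -[5%N]/(4 * 0 + 5)%N /pos position_block // /bpt /=.
by congr pt; rewrite ?muln0 ?expr0; ring.
Qed.

Lemma pos6 : pos 6 = pt 4 4 (-6).
Proof.
rewrite -[6%N]/(4 * 0 + 6)%N /pos position_block // /bpt /=.
by congr pt; rewrite ?muln0 ?expr0; ring.
Qed.

Lemma vol_cap j : vol (pos 0) (pos 1) (cap_pt R j) (cap_pt R j.+1) =
  4 / (j%:R + 2).
Proof.
rewrite pos0 pos1 /cap_pt /vol !ptE !natrS1.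
have := natr_ge0 j; move: (j%:R) => x x0; field; lra.
Qed.

Lemma vol_cap0 j :
  vol (pos 0) (cap_pt R j) (cap_pt R j.+1) (cap_pt R j.+2) =
  - (2 / ((j%:R + 1) * (j%:R + 2) * (j%:R + 3))).
Proof.
rewrite pos0 /cap_pt /vol !ptE !natrS1.
have := natr_ge0 j; move: (j%:R) => x x0; field; lra.
Qed.

Lemma vol_cap1 j :
  vol (pos 1) (cap_pt R j) (cap_pt R j.+1) (cap_pt R j.+2) =
  2 / ((j%:R + 1) * (j%:R + 2) * (j%:R + 3)).
Proof.
rewrite pos1 /cap_pt /vol !ptE !natrS1.
have := natr_ge0 j; move: (j%:R) => x x0; field; lra.
Qed.

(** The block triangles on the edges 01, 02 and 12 of the first gate have third vertices 4, 6 and 5;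
    this determinant and the next two compare them with the triangles of the stacked part on the
    same edges. *)
Lemma vol_cap014 j : vol (pos 0) (pos 1) (cap_pt R j) (pos 4) < 0.
Proof.
have -> : vol (pos 0) (pos 1) (cap_pt R j) (pos 4) =
    - (8 / (j%:R + 1) + 56 * j%:R).
  rewrite pos0 pos1 pos4 /cap_pt /vol !ptE !natrS1.
  have := natr_ge0 j; move: (j%:R) => x x0; field; lra.
have x0 := natr_ge0 j; have h : 0 < 8 / (j%:R + 1) :> R by rewrite divr_gt0 //; lra.
lra.
Qed.

Lemma vol_cap026 : vol (pos 0) (pos 2) (cap_pt R 1) (pos 6) != 0.
Proof.
have -> : vol (pos 0) (pos 2) (cap_pt R 1) (pos 6) = - 178.
  by rewrite pos0 pos2 pos6 /cap_pt /vol !ptE; field.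
by rewrite oppr_eq0 pnatr_eq0.
Qed.

Lemma vol_cap125 : vol (pos 1) (pos 2) (cap_pt R 1) (pos 5) != 0.
Proof.
have -> : vol (pos 1) (pos 2) (cap_pt R 1) (pos 5) = - 98.
  by rewrite pos1 pos2 pos5 /cap_pt /vol !ptE; field.
by rewrite oppr_eq0 pnatr_eq0.
Qed.

Lemma mem_toroid_tets t : t \in toroid_tets m k <->
  t \in chain_tets m \/ exists2 j, (j < k)%N & t = cap_tet m j.
Proof.
elim: (k) t => [|n IH] t /=; first by split=> [?|[//|[]//]]; left.
rewrite mem_cat mem_seq1; split=> [/orP[/IH[?|[j jn ->]]|/eqP->]|].
- by left.
- by right; exists j => //; exact: ltnW.
- by right; exists n.
move=> [tT|[j]]; first by apply/orP; left; apply/IH; left.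
rewrite ltnS leq_eqVlt => /orP[/eqP-> ->|jn ->]; first by rewrite eqxx orbT.
by apply/orP; left; apply/IH; right; exists j.
Qed.

Lemma gate0 : gate 0 = [:: 0; 1; 2]%N. Proof. by rewrite /gate shift0. Qed.

Lemma crest_inj : injective (crest m).
Proof.
by move=> i j; case: (ltngtP i j) => // /(crest_lt m) + e; rewrite e ltnn.
Qed.

(** Every lid except the last cancels against the next stacked tetrahedron; the first gate is the
    lid of index 0. *)
Lemma mem_toroid_tris b : b \in toroid_tris m k <->
  [\/ b \in chain_tris m /\ b != gate 0,
      exists2 j, (j < k)%N & b = [:: 0%N; crest m j; crest m j.+1] \/
                             b = [:: 1%N; crest m j; crest m j.+1]
    | b = lid m k].
Proof.
have lid_inj i j : lid m i = lid m j -> i = j by case=> /crest_inj.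
have side_lid i j (x : nat) : (x < 2)%N -> [:: x; crest m i; crest m i.+1] <> lid m j.
  by move=> x2; case=> _ h _; have := crest_gt1 m i; rewrite h.
have chain_lid i : lid m i.+1 \notin chain_tris m.
  apply/negP => /(tri_tet (chain_closed m))[t [tT st] _].
  have /(chain_tet_lt tT) : crest m i.+1 \in t by apply: st; rewrite !inE eqxx !orbT.
  by rewrite /crest; lia.
elim: (k) b => [|n IH] b.
  split=> [bB|[[]//|[j]//|->]]; last exact: lid_toroid.
  have [->|bg] := eqVneq b (gate 0); last by constructor 1.
  by constructor 3; rewrite gate0.
rewrite toroid_trisS mem_cat !mem_filter; split.
  move=> /orP[/andP[bl /IH[?|[j jn bE]|bE]]|/andP[bl]].
  - by constructor 1.
  - by constructor 2; exists j => //; exact: ltnW.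
  - by move: bl; rewrite bE eqxx.
  rewrite !in_cons orbF => /or4P[/eqP bE|/eqP->|/eqP->|/eqP->].
  - by move: bl; rewrite bE eqxx.
  - by constructor 3.
  - by constructor 2; exists n => //; left.
  - by constructor 2; exists n => //; right.
case=> [[bB bg]|[j jn bE]|->].
- apply/orP; left; apply/andP; split; last by apply/IH; constructor 1.
  case: n {IH} => [|n]; first by rewrite /lid /= -gate0.
  by apply: contraTneq bB => ->; exact: chain_lid.
- have nl i : b != lid m i by case: bE => ->; apply/eqP/side_lid.
  move: jn; rewrite ltnS leq_eqVlt => /orP[/eqP jn|jn].
    apply/orP; right; rewrite nl !in_cons /=; move: bE; rewrite jn.
    by case=> ->; rewrite eqxx ?orbT.
  by apply/orP; left; rewrite nl; apply/IH; constructor 2; exists j.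
apply/orP; right; apply/andP; split; last by rewrite !in_cons eqxx orbT.
by apply/eqP => /lid_inj; lia.
Qed.

Lemma toroid_labels : {in toroid_tets m k, forall t, all (gtn N) t}.
Proof. by move=> t tT; apply/allP => v vt; exact: (toroid_tet_lt tT vt). Qed.

Lemma block_tet_sorted t : t \in block_tets -> sorted ltn t /\ size t = 4%N.
Proof. exact: (tet_sorted block_closed). Qed.

Lemma toroid_nondegenerate : {in toroid_tets m k, forall t,
  Defs.nondegenerate [tuple pos (nth 0%N t j) | j < 4]}.
Proof.
move=> t /mem_toroid_tets[/mem_chain_tets[i [t0 [im t0T ->]]]|[j jk ->]].
  apply/nondegenerate_vol; have [s0 z0] := block_tet_sorted t0T.
  have u0 := sorted_uniq ltn_trans ltnn s0.
  have lt7 := block_tet_lt t0T.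
  case: t0 t0T s0 z0 u0 lt7 => [|a [|b [|c [|d []]]]] //= _ _ _ u0 lt7.
  have h v : v \in [:: a; b; c; d] -> pos (4 * i + v) = bpt R i v.
    by move=> /lt7; exact: position_block.
  rewrite /pos in h *; rewrite !h ?inE ?eqxx ?orbT //.
  exact: vol_block_neq0.
apply/nondegenerate_vol.
rewrite -[vol _ _ _ _]/(vol (pos 0) (pos 1) (pos (crest m j)) (pos (crest m j.+1))).
rewrite [pos (crest m j)]position_crest [pos (crest m j.+1)]position_crest vol_cap.
by rewrite mulf_neq0 ?pnatr_eq0 // invr_eq0; have := natr_ge0 j; lra.
Qed.

Lemma toroid_coords : {in toroid_tets m k, forall t,
  exists (c : nat -> R) (u : nat -> 'cV[R]_3), barycentric pos t c u}.
Proof.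
move=> t tT; have [st zt] := tet_sorted (toroid_closed m k) tT.
apply: nondegenerate_barycentric (toroid_nondegenerate tT).
  exact: (sorted_uniq ltn_trans ltnn st).
apply: (@eq_from_nth _ 0); first by rewrite size_tuple size_map zt.
move=> j; rewrite size_tuple => j4.
by rewrite -(tnth_nth _ _ (Ordinal j4)) tnth_mktuple (nth_map 0%N) ?zt.
Qed.

End ToroidGeometry.

(** * Injectivity of the placement *)

Section ToroidEmbedding.
Variables (R : realType) (m k : nat).
Let N := (4 * m + 7 + k)%N.
Let pos := @position R m.

Lemma bpt_x i r : bpt R i r 0 0 = (4 * i)%:R + (vx`_r)%:~R.
Proof. by rewrite /bpt ptE. Qed.

Lemma bpt_x_bounds i r : (r < 7)%N ->
  [/\ (4 * i)%:R <= bpt R i r 0 0, bpt R i r 0 0 <= (4 * i.+1)%:R,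
      bpt R i r 0 0 = (4 * i)%:R -> (r < 3)%N
    & bpt R i r 0 0 = (4 * i.+1)%:R -> (4 <= r)%N].
Proof.
have -> : (4 * i.+1)%:R = (4 * i)%:R + 4 :> R by rewrite mulnS natrD addrC.
rewrite bpt_x; move: ((4 * i)%:R) => a.
by case: r => [|[|[|[|[|[|[|r]]]]]]] // _; split=> //=; lra.
Qed.

Lemma cap_x j : cap_pt R j 0 0 = - j%:R. Proof. by rewrite /cap_pt ptE. Qed.

Definition separable (t t' : seq nat) := forall w w' : 'rV[R]_N,
  asimplex t w -> asimplex t' w' -> place pos w = place pos w' -> w = w'.

Lemma separable_sym t t' : separable t t' -> separable t' t.
Proof. by move=> h w w' wt w't' e; rewrite (h w' w). Qed.

Lemma gate_tet j : (j <= m)%N -> shift j [:: 0; 1; 2; 6]%N \in toroid_tets m k.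
Proof.
by move=> jm; apply/mem_toroid_tets; left; apply/mem_chain_tets; exists j, [:: 0; 1; 2; 6]%N.
Qed.

Lemma chain_mem i t0 : (i <= m)%N -> t0 \in block_tets -> shift i t0 \in toroid_tets m k.
Proof.
by move=> im tT; apply/mem_toroid_tets; left; apply/mem_chain_tets; exists i, t0.
Qed.

Lemma separable_block i t t' : (i <= m)%N -> t \in block_tets -> t' \in block_tets ->
  separable (shift i t) (shift i t').
Proof.
move=> im tT t'T; have [->|tt'] := eqVneq t t'.
  have [c [u cu]] := toroid_coords (k := k) R (chain_mem im t'T).
  by move=> w w'; exact: (place_inj cu).
have E r f : (r < 7)%N ->
    aff (planef R i f).1 (planef R i f).2 (pos (4 * i + r)) = (evalz f r)%:~R.
  by move=> r7; rewrite /pos position_block // aff_planef.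
have [f [t0 t0T /and4P[/allP f1 /allP f2 /allP f3 /allP f4]]] :
    exists f, exists2 t0, t0 \in block_tets & separates f t t' t0.
  have /allP/(_ t tT)/allP/(_ t' t'T) := block_separated.
  by rewrite tt' => /hasP[f _ /orP[h|h]]; exists f; [exists t|exists t'].
have [c [u cu]] := toroid_coords (k := k) R (chain_mem im t0T).
move=> w w'; apply: (place_inj_sep (c := (planef R i f).1) (u := (planef R i f).2) cu).
- move=> _ /mapP[r rt ->]; rewrite E ?(block_tet_lt tT rt) // lerz0; exact: f1.
- move=> _ /mapP[r rt ->]; rewrite E ?(block_tet_lt t'T rt) // ler0z; exact: f2.
- move=> _ /mapP[r rt ->]; rewrite E ?(block_tet_lt tT rt) // => /eqP.
  by rewrite intr_eq0 => h; rewrite map_f //; have /implyP := f3 r rt; apply.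
- move=> _ /mapP[r rt ->]; rewrite E ?(block_tet_lt t'T rt) // => /eqP.
  by rewrite intr_eq0 => h; rewrite map_f //; have /implyP := f4 r rt; apply.
Qed.

(** The plane is [x = 4 * j]. The vertices on it are those of gate [j], which fit in the tetrahedron
    on 0, 1, 2, 6 of block [j]. *)
Lemma separable_blocks i j t t' : (i < j)%N -> (j <= m)%N ->
  t \in block_tets -> t' \in block_tets -> separable (shift i t) (shift j t').
Proof.
move=> ij jm tT t'T; have im : (i <= m)%N by rewrite (leq_trans (ltnW ij)).
have [c [u cu]] := toroid_coords (k := k) R (gate_tet jm).
have E v : aff (- (4 * j)%:R) (col3 1 0 0) (pos v) = pos v 0 0 - (4 * j)%:R.
  by rewrite aff_col3; ring.
have ij4 : (4 * i.+1)%:R <= (4 * j)%:R :> R by rewrite ler_nat leq_mul2l.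
move=> w w'; apply: (place_inj_sep (c := - (4 * j)%:R) (u := col3 1 0 0) cu).
- move=> _ /mapP[r rt ->]; have r7 := block_tet_lt tT rt.
  rewrite E /pos position_block //; have [_ h _ _] := bpt_x_bounds i r7.
  by rewrite subr_le0 (le_trans h).
- move=> _ /mapP[r rt ->]; have r7 := block_tet_lt t'T rt.
  by rewrite E /pos position_block //; have [h _ _ _] := bpt_x_bounds j r7; rewrite subr_ge0.
- move=> _ /mapP[r rt ->]; have r7 := block_tet_lt tT rt.
  rewrite E /pos position_block // => /eqP; rewrite subr_eq0 => /eqP h.
  have [_ h1 _ h2] := bpt_x_bounds i r7.
  have ji : j = i.+1.
    by apply/eqP; rewrite eqn_leq ij andbT; move: h1; rewrite h ler_nat leq_mul2l.
  move: h; rewrite ji => /h2 r4.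
  have -> : (4 * i + r = 4 * i.+1 + (r - 4))%N by lia.
  by rewrite map_f // !inE; lia.
- move=> _ /mapP[r rt ->]; have r7 := block_tet_lt t'T rt.
  rewrite E /pos position_block // => /eqP; rewrite subr_eq0 => /eqP h.
  have [_ _ /(_ h) r3 _] := bpt_x_bounds j r7.
  by rewrite map_f // !inE; lia.
Qed.

(** The same argument with the plane [x = 0] of the first gate, the crest points of positive index
    having negative [x]. *)
Lemma separable_cap_block i j t : (j < k)%N -> (i <= m)%N -> t \in block_tets ->
  separable (cap_tet m j) (shift i t).
Proof.
move=> jk im tT; have [c [u cu]] := toroid_coords (k := k) R (gate_tet (leq0n m)).
have E v : aff 0 (col3 1 0 0) (pos v) = pos v 0 0.
  by rewrite aff_col3; ring.
have p0 : pos 0 0 0 = 0 by rewrite /pos pos0 ptE.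
have p1 : pos 1 0 0 = 0 by rewrite /pos pos1 ptE.
have pq l : pos (crest m l) 0 0 = - l%:R by rewrite /pos position_crest cap_x.
move=> w w'; apply: (place_inj_sep (c := 0) (u := col3 1 0 0) cu).
- move=> v; rewrite !inE E => /or4P[]/eqP->; rewrite ?p0 ?p1 ?pq ?lexx //;
    by rewrite oppr_le0.
- move=> _ /mapP[r rt ->]; have r7 := block_tet_lt tT rt.
  rewrite E /pos position_block //; have [h _ _ _] := bpt_x_bounds i r7.
  exact: le_trans h.
- move=> v; rewrite E shift0 !inE => /or4P[]/eqP->; rewrite ?pq //.
    by case: (j) => // l /eqP; rewrite oppr_eq0 pnatr_eq0.
  by move=> /eqP; rewrite oppr_eq0 pnatr_eq0.
- move=> _ /mapP[r rt ->]; have r7 := block_tet_lt tT rt.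
  rewrite E /pos position_block // => h0.
  have [h1 _ h2 _] := bpt_x_bounds i r7.
  have i0 : i = 0%N.
    by apply/eqP; move: h1; rewrite h0 lern0 muln_eq0.
  move: h2; rewrite h0 i0 muln0 => /(_ erefl) r3.
  by rewrite shift0 !inE; lia.
Qed.

(** The separating plane passes through the edge 01 and [crest m i.+1]. Since [y - z + 3 + 6 x]
    vanishes on that edge and equals [1 / (l + 1)] at [crest m l], the function used has the value
    [l - s / (l + 1)] there, increasing in [l]; the choice of [s] puts its zero at [l = i + 1]. *)
Lemma separable_caps i j : (i < j)%N -> (j < k)%N ->
  separable (cap_tet m i) (cap_tet m j).
Proof.
move=> ij jk.
have iT : cap_tet m i \in toroid_tets m k.
  by apply/mem_toroid_tets; right; exists i => //; exact: ltn_trans jk.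
have [c [u cu]] := toroid_coords R iT.
pose s : R := (i%:R + 1) * (i%:R + 2).
have E v : aff (- 3 * s) (col3 (- 1 - 6 * s) (- s) s) (pos v) =
    - pos v 0 0 - s * (pos v 0 1 - pos v 0 2 + 3 + 6 * pos v 0 0).
  by rewrite aff_col3; ring.
have p0 : aff (- 3 * s) (col3 (- 1 - 6 * s) (- s) s) (pos 0) = 0.
  by rewrite E /pos pos0 !ptE; ring.
have p1 : aff (- 3 * s) (col3 (- 1 - 6 * s) (- s) s) (pos 1) = 0.
  by rewrite E /pos pos1 !ptE; ring.
have pq l : aff (- 3 * s) (col3 (- 1 - 6 * s) (- s) s) (pos (crest m l)) =
    (l%:R * (l%:R + 1) - s) / (l%:R + 1).
  rewrite E /pos position_crest /cap_pt !ptE (natrS1 R l).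
  have := natr_ge0 R l; move: (l%:R) => x x0; field; lra.
have i0 := natr_ge0 R i.
have lpos l : 0 < l%:R + 1 :> R by have := natr_ge0 R l; lra.
have pi : aff (- 3 * s) (col3 (- 1 - 6 * s) (- s) s) (pos (crest m i)) < 0.
  by rewrite pq pmulr_llt0 ?invr_gt0 // /s; nra.
have pi1 : aff (- 3 * s) (col3 (- 1 - 6 * s) (- s) s) (pos (crest m i.+1)) = 0.
  rewrite pq; have -> : i.+1%:R * (i.+1%:R + 1) - s = 0; last by rewrite mul0r.
  by rewrite /s (natrS1 R i); ring.
have pbig l : (i.+1 < l)%N ->
    0 < aff (- 3 * s) (col3 (- 1 - 6 * s) (- s) s) (pos (crest m l)).
  move=> il; rewrite pq divr_gt0 // /s.
  have : i%:R + 2 <= l%:R :> R by rewrite -natrD addn2 ler_nat.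
  by nra.
move=> w w'; apply: (place_inj_sep (c := - 3 * s)
  (u := col3 (- 1 - 6 * s) (- s) s) cu).
- move=> v; rewrite !inE => /or4P[]/eqP->; rewrite ?p0 ?p1 ?pi1 //; exact: ltW.
- move=> v; rewrite !inE => /or4P[]/eqP->; rewrite ?p0 ?p1 //.
    by move: ij; rewrite leq_eqVlt => /orP[/eqP<-|/pbig/ltW//]; rewrite pi1.
  by apply/ltW/pbig.
- by [].
- move=> v; rewrite !inE => /or4P[]/eqP->; rewrite ?eqxx ?orbT // => h.
    move: ij; rewrite leq_eqVlt => /orP[/eqP<-|/pbig]; first by rewrite eqxx !orbT.
    by rewrite h ltxx.
  by have := pbig j.+1 ij; rewrite h ltxx.
Qed.

Lemma toroid_separable t t' : t \in toroid_tets m k -> t' \in toroid_tets m k ->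
  separable t t'.
Proof.
move=> tT t'T; have [c [u cu]] := toroid_coords R tT.
move: tT t'T cu => /mem_toroid_tets[/mem_chain_tets[i [t0 [im t0T ->]]]|[i ik ->]]
  /mem_toroid_tets[/mem_chain_tets[j [t1 [jm t1T ->]]]|[j jk ->]] cu.
- case: (ltngtP i j) => [ij|ji|ij].
  + exact: separable_blocks.
  + exact/separable_sym/separable_blocks.
  + by rewrite -ij; exact: separable_block.
- exact/separable_sym/separable_cap_block.
- exact: separable_cap_block.
- case: (ltngtP i j) => [ij|ji|ij].
  + exact: separable_caps.
  + exact/separable_sym/separable_caps.
  + by rewrite -ij => w w'; exact: (place_inj cu).
Qed.

Lemma toroid_inj (w w' : 'rV[R]_N) :
  realization (toroid_tets m k) w -> realization (toroid_tets m k) w' ->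
  place pos w = place pos w' -> w = w'.
Proof. by move=> [t tT wt] [t' t'T w't']; exact: (toroid_separable tT t'T). Qed.

End ToroidEmbedding.

(** * Faces sharing an edge are not coplanar *)

Section ToroidBend.
Variables (R : realType) (m : nat).
Let pos := @position R m.

Lemma vol_noncoplanar (b b' : seq nat) (x y z t : nat) :
  {subset [:: x; y; z; t] <= b ++ b'} ->
  vol (pos x) (pos y) (pos z) (pos t) != 0 ->
  ~ coplanar (map pos b ++ map pos b').
Proof.
move=> sub v0 cop; case/eqP: v0; rewrite -map_cat in cop.
by apply: (coplanar_vol cop); apply: map_f; apply: sub; rewrite !inE eqxx ?orbT.
Qed.

Lemma coplanarC (s s' : seq 'rV[R]_3) : coplanar (s ++ s') -> coplanar (s' ++ s).
Proof.
move=> [u u0 h]; exists u => // a b; rewrite mem_cat orbC -mem_cat => ha.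
by rewrite mem_cat orbC -mem_cat; exact: h.
Qed.

(** Two distinct triangles have at least four vertices together, and these are in general
    position. *)
Lemma block_bend i b b' : (i <= m)%N -> b \in block_tris -> b' \in block_tris ->
  b != b' -> ~ coplanar (map pos (shift i b) ++ map pos (shift i b')).
Proof.
move=> im bB b'B bb'.
have [sb zb] := tri_sorted block_closed bB.
have [sb' zb'] := tri_sorted block_closed b'B.
have [d db' db] : exists2 d, d \in b' & d \notin b.
  apply/hasP; rewrite has_predC; apply: contra bb' => /allP h.
  by rewrite eq_sym; apply/eqP/sorted_ltn_sub; rewrite // zb zb'.
have lt7 := block_tri_lt bB; have d7 := block_tri_lt b'B db'.
have ub := sorted_uniq ltn_trans ltnn sb.
case: b zb ub {sb bb' bB} lt7 db => [|x [|y [|z []]]] //= _ ub lt7 db.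
have P r : r \in [:: x; y; z; d] -> pos (4 * i + r) = bpt R i r.
  move=> rb; rewrite /pos position_block //.
  by move: rb; rewrite !inE => /or4P[]/eqP->; rewrite // lt7 // !inE eqxx ?orbT.
apply: (@vol_noncoplanar (shift i [:: x; y; z]) (shift i b')
  (4 * i + x)%N (4 * i + y)%N (4 * i + z)%N (4 * i + d)%N).
  move=> v; rewrite mem_cat !inE => /or4P[]/eqP->; rewrite ?eqxx ?orbT //.
  by rewrite (map_f (addn (4 * i)) db') orbT.
rewrite !P ?inE ?eqxx ?orbT //; apply: vol_block_neq0.
  rewrite -[[:: x; y; z; d]]/(rcons [:: x; y; z] d) rcons_uniq.
  by apply/andP; split.
by move=> v; rewrite !inE => /or4P[]/eqP->; rewrite // lt7 // !inE eqxx ?orbT.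
Qed.

(** For side triangles of consecutive blocks with a common edge on the gate between them. Vertex [y]
    of the second block is entry [4 + y] of the coordinate lists, which is why these lists have 11
    entries. *)
Lemma gate_bend : all (fun b => all (fun b' => all (fun u => all (fun v =>
  [&& u != v, (4 + u)%N \in b, (4 + v)%N \in b, u \in b' & v \in b'] ==>
  has (fun x => has (fun y => volz (4 + u) (4 + v) x (4 + y) != 0) b') b)
  (iota 0 3)) (iota 0 3)) block_sides) block_sides.
Proof. by vm_compute. Qed.

Lemma blocks_bend i b b' u v : (i.+1 <= m)%N ->
  b \in block_sides -> b' \in block_sides -> u != v ->
  u \in shift i b -> v \in shift i b -> u \in shift i.+1 b' -> v \in shift i.+1 b' ->
  ~ coplanar (map pos (shift i b) ++ map pos (shift i.+1 b')).
Proof.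
move=> im bB b'B uv.
have bt : b \in block_tris by rewrite mem_block_tris bB.
have bt' : b' \in block_tris by rewrite mem_block_tris b'B.
move=> /mapP[ru rub uE] /mapP[rv rvb vE] /mapP[su sub' uE'] /mapP[sv svb' vE'].
have ru7 := block_tri_lt bt rub; have rv7 := block_tri_lt bt rvb.
have Eu : ru = (4 + su)%N by move: uE'; rewrite uE; lia.
have Ev : rv = (4 + sv)%N by move: vE'; rewrite vE; lia.
have uv' : su != sv by apply: contra uv => /eqP e; rewrite uE' vE' e.
have su3 : su \in iota 0 3 by rewrite mem_iota; lia.
have sv3 : sv \in iota 0 3 by rewrite mem_iota; lia.
have /allP/(_ b bB)/allP/(_ b' b'B)/allP/(_ su su3)/allP/(_ sv sv3) := gate_bend.
rewrite uv' -Eu -Ev rub rvb sub' svb' => /hasP[x xb /hasP[y yb' v0]].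
have im' : (i <= m)%N by exact: ltnW.
have x7 := block_tri_lt bt xb; have y7 := block_tri_lt bt' yb'.
apply: (@vol_noncoplanar (shift i b) (shift i.+1 b')
  (4 * i + ru)%N (4 * i + rv)%N (4 * i + x)%N (4 * i.+1 + y)%N).
  move=> z; rewrite mem_cat !inE => /or4P[]/eqP->;
    rewrite ?(map_f (addn (4 * i)) rub) ?(map_f (addn (4 * i)) rvb)
      ?(map_f (addn (4 * i)) xb) ?(map_f (addn (4 * i.+1)) yb') ?orbT //.
rewrite /pos !position_block // -bpt_next // vol_bpt mulf_neq0 ?signr_neq0 //.
by rewrite intr_eq0.
Qed.

Lemma shift_lt i j b b' u : b \in block_tris -> b' \in block_tris -> (i < j)%N ->
  u \in shift i b -> u \in shift j b' -> j = i.+1 /\ (4 * i + 4 <= u)%N.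
Proof.
move=> bB b'B ij /mapP[r rb ->] /mapP[s sb' e].
by have := block_tri_lt bB rb; lia.
Qed.

Lemma chain_block b : b \in chain_tris m -> exists i b0,
  [/\ (i <= m)%N, b = shift i b0 &
     [\/ b0 \in block_sides, b0 = [:: 0; 1; 2]%N /\ i = 0%N
       | b0 = [:: 4; 5; 6]%N /\ i = m]].
Proof.
move=> /mem_chain_tris[[i [b0 [im b0B ->]]]|->|->].
- by exists i, b0; split=> //; constructor 1.
- by exists 0%N, [:: 0; 1; 2]%N; split=> //; constructor 2.
- by exists m, [:: 4; 5; 6]%N; rewrite gateE; split=> //; constructor 3.
Qed.

Lemma block_tri_of i b0 :
  [\/ b0 \in block_sides, b0 = [:: 0; 1; 2]%N /\ i = 0%N
       | b0 = [:: 4; 5; 6]%N /\ i = m] -> b0 \in block_tris.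
Proof.
by rewrite mem_block_tris; case=> [->|[-> _]|[-> _]] //; rewrite eqxx ?orbT.
Qed.

Lemma chain_bend_lt i b i' b' u v : (i' <= m)%N -> (i < i')%N ->
  [\/ b \in block_sides, b = [:: 0; 1; 2]%N /\ i = 0%N
       | b = [:: 4; 5; 6]%N /\ i = m] ->
  [\/ b' \in block_sides, b' = [:: 0; 1; 2]%N /\ i' = 0%N
       | b' = [:: 4; 5; 6]%N /\ i' = m] -> u != v ->
  u \in shift i b -> v \in shift i b -> u \in shift i' b' -> v \in shift i' b' ->
  ~ coplanar (map pos (shift i b) ++ map pos (shift i' b')).
Proof.
move=> i'm ii' bC b'C uv ub vb ub' vb'.
have bB := block_tri_of bC; have b'B := block_tri_of b'C.
have [i'E u4] := shift_lt bB b'B ii' ub ub'.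
have [_ v4] := shift_lt bB b'B ii' vb vb'.
case: bC => [bS|[bE _]|[_ im]]; last by lia.
  case: b'C => [b'S|[_ i0]|[b'E _]]; first 1 last.
  - by lia.
  - move: ub'; rewrite b'E i'E => /mapP[s + e].
    move: ub => /mapP[r rb e']; have := block_tri_lt bB rb.
    by rewrite !inE; move: e; rewrite e'; lia.
  by move: i'm ub' vb'; rewrite i'E => i'm ub' vb'; exact: blocks_bend i'm bS b'S uv ub vb ub' vb'.
by move: ub; rewrite bE => /mapP[r]; rewrite !inE => + e; move: u4; rewrite e; lia.
Qed.

Lemma chain_bend b b' u v : b \in chain_tris m -> b' \in chain_tris m -> b != b' ->
  u != v -> u \in b -> v \in b -> u \in b' -> v \in b' ->
  ~ coplanar (map pos b ++ map pos b').
Proof.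
move=> /chain_block[i [b0 [im -> bC]]] /chain_block[i' [b0' [im' -> bC']]].
move=> bb' uv ub vb ub' vb'; case: (ltngtP i i') => [ii'|ii'|ii'].
- exact: chain_bend_lt im' ii' bC bC' uv ub vb ub' vb'.
- by move=> /coplanarC; exact: chain_bend_lt im ii' bC' bC uv ub' vb' ub vb.
rewrite -ii' in bb' bC' *.
apply: block_bend => //; [exact: block_tri_of bC|exact: block_tri_of bC'|].
by apply: contraNneq bb' => ->.
Qed.

Lemma chain_tri_lt b v : b \in chain_tris m -> v \in b -> (v < 4 * m + 7)%N.
Proof.
move=> /(tri_tet (chain_closed m))[t [tT bt] _] /bt; exact: chain_tet_lt.
Qed.

(** One side triangle lies on each edge of the first gate; its third vertex is the one that enters
    [vol_cap014], [vol_cap026] or [vol_cap125]. *)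
Lemma low_tri b u v : b \in chain_tris m -> b != gate 0 -> u != v ->
  (u < 3)%N -> (v < 3)%N -> u \in b -> v \in b ->
  [/\ (u \in [:: 0; 1]%N -> v \in [:: 0; 1]%N -> 4%N \in b),
      (u \in [:: 0; 2]%N -> v \in [:: 0; 2]%N -> 6%N \in b)
    & (u \in [:: 1; 2]%N -> v \in [:: 1; 2]%N -> 5%N \in b)].
Proof.
move=> /chain_block[i [b0 [im -> bC]]] bg uv u3 v3 ub vb.
have i0 : i = 0%N by move: ub => /mapP[r _]; lia.
move: bg ub vb; rewrite i0 !shift0 gate0 => bg ub vb.
case: bC => [b0S|[b0E _]|[b0E _]]; last 2 first.
- by move: bg; rewrite b0E eqxx.
- by move: ub; rewrite b0E !inE; lia.
have : all (fun b => all (fun u => all (fun v =>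
    [&& u != v, u \in b & v \in b] ==>
    [&& ((u \in [:: 0; 1]%N) && (v \in [:: 0; 1]%N)) ==> (4%N \in b),
        ((u \in [:: 0; 2]%N) && (v \in [:: 0; 2]%N)) ==> (6%N \in b)
      & ((u \in [:: 1; 2]%N) && (v \in [:: 1; 2]%N)) ==> (5%N \in b)])
    (iota 0 3)) (iota 0 3)) block_sides by vm_compute.
have u3' : u \in iota 0 3 by rewrite mem_iota.
have v3' : v \in iota 0 3 by rewrite mem_iota.
move=> /allP/(_ b0 b0S)/allP/(_ u u3')/allP/(_ v v3').
rewrite uv ub vb /= => /and3P[/implyP h1 /implyP h2 /implyP h3].
by split=> hu hv; [apply: h1|apply: h2|apply: h3]; rewrite hu hv.
Qed.

Lemma crestE i j : (crest m i == crest m j) = (i == j).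
Proof. exact: (inj_eq (@crest_inj m)). Qed.

Lemma crest_ge3 j : (0 < j)%N -> (4 * m + 7 <= crest m j)%N.
Proof. by case: j => // j _; rewrite /crest leq_addr. Qed.

Lemma vol_cap_neq0 j :
  vol (pos 0) (pos 1) (pos (crest m j)) (pos (crest m j.+1)) != 0.
Proof.
rewrite [pos (crest m j)]position_crest [pos (crest m j.+1)]position_crest vol_cap.
by rewrite mulf_neq0 ?pnatr_eq0 // invr_eq0; have := natr_ge0 R j; lra.
Qed.

Lemma vol_ridge_neq0 x j : (x < 2)%N ->
  vol (pos x) (pos (crest m j)) (pos (crest m j.+1)) (pos (crest m j.+2)) != 0.
Proof.
have h : (j%:R + 1) * (j%:R + 2) * (j%:R + 3) != 0 :> R.
  by have := natr_ge0 R j => x0; rewrite !mulf_neq0 //; lra.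
rewrite [pos (crest m j)]position_crest [pos (crest m j.+1)]position_crest.
rewrite [pos (crest m j.+2)]position_crest.
case: x => [|[|]] // _; rewrite ?vol_cap0 ?vol_cap1 ?oppr_eq0 mulf_neq0 ?invr_eq0 //;
  by rewrite pnatr_eq0.
Qed.
End ToroidBend.

(** * The polyhedron *)

Section ToroidPolyhedron.
Variables (R : realType) (m k : nat).
Let N := (4 * m + 7 + k)%N.
Let pos := @position R m.

Lemma ridgeP x j u : (x < 2)%N -> u \in [:: x; crest m j; crest m j.+1] ->
  u = x \/ exists2 a, u = crest m a & (a == j) || (a == j.+1).
Proof.
move=> x2; rewrite !inE => /or3P[]/eqP->; first by left.
- by right; exists j; rewrite ?eqxx.
- by right; exists j.+1; rewrite ?eqxx ?orbT.
Qed.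

Lemma crest_neq x j : (x < 2)%N -> x <> crest m j.
Proof. by move=> x2 e; have := crest_gt1 m j; rewrite -e; lia. Qed.

(** A shared edge forces the same apex and consecutive indices, so the four vertices are an apex and
    three consecutive crest points. *)
Lemma ridge_ridge_bend x y i j u v : (x < 2)%N -> (y < 2)%N -> (i < j)%N ->
  u != v ->
  u \in [:: x; crest m i; crest m i.+1] -> v \in [:: x; crest m i; crest m i.+1] ->
  u \in [:: y; crest m j; crest m j.+1] -> v \in [:: y; crest m j; crest m j.+1] ->
  ~ coplanar (map pos [:: x; crest m i; crest m i.+1] ++
              map pos [:: y; crest m j; crest m j.+1]).
Proof.
move=> x2 y2 ij uv /(ridgeP x2) hu /(ridgeP x2) hv /(ridgeP y2) hu' /(ridgeP y2) hv'.
have key w : w = x \/ (exists2 a, w = crest m a & (a == i) || (a == i.+1)) ->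
    w = y \/ (exists2 a, w = crest m a & (a == j) || (a == j.+1)) ->
    (w = x /\ x = y) \/ (w = crest m i.+1 /\ j = i.+1).
  move=> [->|[a -> ha]] [e|[a' e ha']].
  - by left.
  - by case: (crest_neq x2 e).
  - by case: (@crest_neq y a) => //; rewrite e.
  - have := crest_inj e => aa'; right.
    by have [-> ->] : a = i.+1 /\ j = i.+1 by lia.
have [[ux xy]|[uc ji]] := key u hu hu'; have [[vx _]|[vc ji']] := key v hv hv'.
- by case/eqP: uv; rewrite ux vx.
- rewrite ji'; apply: (@vol_noncoplanar R m _ _ x (crest m i) (crest m i.+1) (crest m i.+2)).
    by move=> z; rewrite mem_cat !inE => /or4P[]/eqP->; rewrite eqxx ?orbT.
  exact: vol_ridge_neq0.
- rewrite ji; apply: (@vol_noncoplanar R m _ _ x (crest m i) (crest m i.+1) (crest m i.+2)).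
    by move=> z; rewrite mem_cat !inE => /or4P[]/eqP->; rewrite eqxx ?orbT.
  exact: vol_ridge_neq0.
- by case/eqP: uv; rewrite uc vc.
Qed.

(** The common edge must be that of [x] and 2, with [j = 0], as the other crest labels do not occur
    in the chain. *)
Lemma ridge_chain_bend x j b u v : (x < 2)%N -> b \in chain_tris m -> b != gate 0 ->
  u != v -> u \in [:: x; crest m j; crest m j.+1] ->
  v \in [:: x; crest m j; crest m j.+1] -> u \in b -> v \in b ->
  ~ coplanar (map pos [:: x; crest m j; crest m j.+1] ++ map pos b).
Proof.
move=> x2 bB bg uv /(ridgeP x2) hu /(ridgeP x2) hv ub vb.
have low w : w \in b -> w = x \/ (exists2 a, w = crest m a & (a == j) || (a == j.+1)) ->
    w = x \/ (w = 2%N /\ j = 0%N).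
  move=> wb [->|[a wa ha]]; first by left.
  have := chain_tri_lt bB wb; rewrite wa.
  case: a {wa} ha => [|a] ha; last by move=> /=; lia.
  by move=> _; right; split=> //; lia.
have two w w' : w != w' -> w \in b -> w' \in b ->
    w = x -> w' = 2%N -> j = 0%N ->
    ~ coplanar (map pos [:: x; crest m j; crest m j.+1] ++ map pos b).
  move=> ww' wb w'b wx w'2 j0; have w3 : (w < 3)%N by rewrite wx; lia.
  have w'3 : (w' < 3)%N by rewrite w'2.
  have [_ h026 h125] := low_tri bB bg ww' w3 w'3 wb w'b.
  move: x2 h026 h125; rewrite wx w'2 j0; case: (x) => [|[|]] // _ h026 h125.
    apply: (@vol_noncoplanar R m _ _ 0 2 (crest m 1) 6)%N.
      by move=> z; rewrite mem_cat !inE => /or4P[]/eqP->; rewrite ?eqxx ?(h026 isT isT) ?orbT.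
    by rewrite [position R m (crest m 1)]position_crest vol_cap026.
  apply: (@vol_noncoplanar R m _ _ 1 2 (crest m 1) 5)%N.
    by move=> z; rewrite mem_cat !inE => /or4P[]/eqP->; rewrite ?eqxx ?(h125 isT isT) ?orbT.
  by rewrite [position R m (crest m 1)]position_crest vol_cap125.
have [ux|[u2 j0]] := low u ub hu; have [vx|[v2 j0']] := low v vb hv.
- by case/eqP: uv; rewrite ux vx.
- exact: (two u v).
- by apply: (two v u) => //; rewrite eq_sym.
- by case/eqP: uv; rewrite u2 v2.
Qed.

(** Without stacked vertices the lid is the first gate and [chain_bend] applies; otherwise the
    common edge is 01. *)
Lemma lid_chain_bend b u v : b \in chain_tris m -> b != gate 0 ->
  u != v -> u \in lid m k -> v \in lid m k -> u \in b -> v \in b ->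
  ~ coplanar (map pos (lid m k) ++ map pos b).
Proof.
move=> bB bg uv ul vl ub vb; case: (posnP k) => [k0|k0].
  move: ul vl; rewrite k0 -[lid m 0]/([:: 0; 1; 2]%N) -gate0 => ul vl.
  apply: (chain_bend (u := u) (v := v)) => //; last by rewrite eq_sym.
  by apply/mem_chain_tris; constructor 2.
have low w : w \in b -> w \in lid m k -> w \in [:: 0; 1]%N.
  move=> wb; rewrite !inE => /or3P[-> //|->|/eqP wk]; rewrite ?orbT //.
  by have := chain_tri_lt bB wb; have := crest_ge3 m k0; rewrite wk; lia.
have u01 := low u ub ul; have v01 := low v vb vl.
have lt3 w : w \in [:: 0; 1]%N -> (w < 3)%N by rewrite !inE; lia.
have [/(_ u01 v01) h _ _] := low_tri bB bg uv (lt3 _ u01) (lt3 _ v01) ub vb.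
apply: (@vol_noncoplanar R m _ _ 0 1 (crest m k) 4)%N.
  by move=> z; rewrite mem_cat !inE => /or4P[]/eqP->; rewrite ?eqxx ?h ?orbT.
by rewrite [position R m (crest m k)]position_crest lt_eqF // vol_cap014.
Qed.

Lemma ridge_lid_bend x j u v : (x < 2)%N -> (j < k)%N -> u != v ->
  u \in [:: x; crest m j; crest m j.+1] -> v \in [:: x; crest m j; crest m j.+1] ->
  u \in lid m k -> v \in lid m k ->
  ~ coplanar (map pos [:: x; crest m j; crest m j.+1] ++ map pos (lid m k)).
Proof.
move=> x2 jk uv /(ridgeP x2) hu /(ridgeP x2) hv ul vl.
have crest_case w a : w = crest m a -> (a == j) || (a == j.+1) -> w \in lid m k ->
    k = j.+1.
  move=> -> ha; rewrite !inE => /or3P[/eqP e|/eqP e|]; last by rewrite crestE; lia.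
    by case: (@crest_neq 0 a).
  by case: (@crest_neq 1 a).
have kj : k = j.+1.
  case: hu => [ux|[a ua ha]]; last exact: (crest_case u a).
  case: hv => [vx|[a va ha]]; last exact: (crest_case v a).
  by case/eqP: uv; rewrite ux vx.
rewrite kj; apply: (@vol_noncoplanar R m _ _ 0 1 (crest m j) (crest m j.+1)).
  by move=> z; rewrite mem_cat !inE => /or4P[]/eqP->; rewrite ?eqxx ?orbT.
exact: vol_cap_neq0.
Qed.

Lemma ridge_pair_bend j :
  ~ coplanar (map pos [:: 0%N; crest m j; crest m j.+1] ++
              map pos [:: 1%N; crest m j; crest m j.+1]).
Proof.
apply: (@vol_noncoplanar R m _ _ 0 1 (crest m j) (crest m j.+1)).
  by move=> z; rewrite mem_cat !inE => /or4P[]/eqP->; rewrite ?eqxx ?orbT.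
exact: vol_cap_neq0.
Qed.

Lemma toroid_tri_cases b : b \in toroid_tris m k ->
  [\/ b \in chain_tris m /\ b != gate 0,
      exists x j, [/\ (x < 2)%N, (j < k)%N & b = [:: x; crest m j; crest m j.+1]]
    | b = lid m k].
Proof.
move=> /mem_toroid_tris[?|[j jk [->|->]]|?]; [by constructor 1|..|by constructor 3].
- by constructor 2; exists 0%N, j.
- by constructor 2; exists 1%N, j.
Qed.

Lemma toroid_bend : {in toroid_tris m k &, forall b b' : seq nat, b != b' ->
  forall u v, u != v -> u \in b -> v \in b -> u \in b' -> v \in b' ->
  ~ coplanar (map pos b ++ map pos b')}.
Proof.
move=> b b' /toroid_tri_cases[[bB bg]|[x [j [x2 jk ->]]]|->]
  /toroid_tri_cases[[b'B b'g]|[x' [j' [x'2 j'k ->]]]|->] bb' u v uv ub vb ub' vb'.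
- exact: (chain_bend bB b'B bb' uv).
- by move=> /coplanarC; exact: (ridge_chain_bend x'2 bB bg uv).
- by move=> /coplanarC; exact: (lid_chain_bend bB bg uv).
- exact: (ridge_chain_bend x2 b'B b'g uv).
- case: (ltngtP j j') => [jj'|jj'|jj'].
  + exact: (ridge_ridge_bend x2 x'2 jj' uv).
  + by move=> /coplanarC; exact: (ridge_ridge_bend x'2 x2 jj' uv).
  move: bb'; rewrite -jj'; case: (x) (x') x2 x'2 => [|[|]] // [|[|]] // _ _;
    rewrite ?eqxx // => _; first exact: ridge_pair_bend.
  by move=> /coplanarC; exact: ridge_pair_bend.
- exact: (ridge_lid_bend x2 jk uv).
- exact: (lid_chain_bend b'B b'g uv).
- by move=> /coplanarC; exact: (ridge_lid_bend x'2 j'k uv).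
- by rewrite eqxx in bb'.
Qed.

Definition toroid_polyhedron : polyhedron R :=
  solid_polyhedron (toroid_closed m k) (@toroid_labels m k)
    (@toroid_coords R m k) (@toroid_inj R m k) toroid_bend.

Lemma toroid_vertex v : (v < N)%N -> exists2 b, b \in toroid_tris m k & v \in b.
Proof.
move=> vN; have [v_lt|v_ge] := ltnP v (4 * m + 7).
  have [i [r [im r7 vE]]] : exists i r, [/\ (i <= m)%N, (r < 7)%N & v = (4 * i + r)%N].
    have [v4|v4] := leqP (v %/ 4) m.
      by exists (v %/ 4)%N, (v %% 4)%N; split=> //; lia.
    by exists m, (v - 4 * m)%N; split=> //; lia.
  have : has (fun t => r \in t) block_tets.
    by have := r7; case: (r) => [|[|[|[|[|[|[|]]]]]]].
  move=> /hasP[t tT rt]; have [b bB [vb _]] := tet_edge (toroid_closed m k)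
    (chain_mem k im tT) (map_f (addn (4 * i)) rt) (map_f (addn (4 * i)) rt).
  by exists b => //; rewrite vE.
have [j jk vE] : exists2 j, (j < k)%N & v = crest m j.+1.
  by exists (v - (4 * m + 7))%N; rewrite /crest; lia.
have tT : cap_tet m j \in toroid_tets m k by apply/mem_toroid_tets; right; exists j.
have vt : v \in cap_tet m j by rewrite vE !inE eqxx !orbT.
by have [b bB [vb _]] := tet_edge (toroid_closed m k) tT vt vt; exists b.
Qed.

Lemma size_vertices : size (vertices toroid_polyhedron) = N.
Proof.
have lab b v : b \in toroid_tris m k -> v \in b -> (v < N)%N.
  move=> bB vb; exact: (allP (tri_labels (toroid_closed m k) (@toroid_labels m k) bB) _ vb).
rewrite -[RHS](size_iota 0) -(size_map pos); apply: perm_size; apply: uniq_perm.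
- exact: undup_uniq.
- rewrite map_inj_in_uniq ?iota_uniq // => u v; rewrite !mem_iota /= !add0n => uN vN e.
  have [b bB ub] := toroid_vertex uN; have [b' b'B vb'] := toroid_vertex vN.
  exact: (pos_inj (toroid_closed m k) (@toroid_labels m k) (@toroid_inj R m k) bB b'B ub vb' e).
move=> x; apply/idP/mapP => [/mem_vertices[b bB [v vb ->]]|[v + ->]].
  by exists v => //; rewrite mem_iota /= add0n (lab b).
rewrite mem_iota /= add0n => vN; have [b bB vb] := toroid_vertex vN.
by apply/mem_vertices; exists b => //; exists v.
Qed.

Lemma size_toroid_tets : size (toroid_tets m k) = (7 * m.+1 + k)%N.
Proof.
elim: (k) => [|n IH] /=; last by rewrite size_cat IH addn1 addnS.
by elim: m => [|n IH] //=; rewrite size_cat IH /=; lia.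
Qed.

Lemma uniq_toroid_tets : uniq (toroid_tets m k).
Proof.
elim: (k) => [|n IH] /=; last first.
  rewrite cat_uniq IH /= andbT orbF; apply/negP => /toroid_tet_lt h.
  have := h (crest m n.+1); rewrite !inE eqxx !orbT => /(_ isT).
  by rewrite /crest; lia.
elim: m => [|n IH]; first by [].
rewrite -[chain_tets n.+1]/(chain_tets n ++ map (shift n.+1) block_tets) cat_uniq IH.
rewrite (map_inj_uniq (@shift_inj n.+1)) andbT andTb.
apply/hasPn => _ /mapP[t tT ->]; apply/negP => tT'.
have : has (fun r => (3 <= r)%N) t.
  have : all (has (fun r => (3 <= r)%N)) block_tets by [].
  by move=> /allP; apply.
move=> /hasP[r rt r3]; have := chain_tet_lt tT' (map_f (addn (4 * n.+1)) rt).
by lia.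
Qed.

Lemma toroid_triangulable : triangulable_in toroid_polyhedron (7 * m.+1 + k).
Proof.
rewrite -size_toroid_tets.
exists (tet pos (T := toroid_tets m k)).
exact: (triangulation_tet (toroid_closed m k) (@toroid_labels m k)
  (@toroid_coords R m k) (@toroid_inj R m k) toroid_bend uniq_toroid_tets
  (@toroid_nondegenerate R m k)).
Qed.

End ToroidPolyhedron.

(** * Uniqueness of the triangulation *)

(** The plane through three vertices, with the cross product of two edges as normal vector. *)
Definition planez (p q r : nat) : int * int * int * int :=
  let d (t : seq int) a := t`_a - t`_p in
  let a := d vy q * d vz r - d vz q * d vy r in
  let b := d vz q * d vx r - d vx q * d vz r in
  let c := d vx q * d vy r - d vy q * d vx r in
  (- (a * vx`_p + b * vy`_p + c * vz`_p), a, b, c).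

Definition facet_planes (t : seq nat) : seq (int * int * int * int) :=
  let n := nth 0%N t in
  let F := [:: planez (n 0%N) (n 1%N) (n 2%N); planez (n 0%N) (n 1%N) (n 3%N);
               planez (n 0%N) (n 2%N) (n 3%N); planez (n 1%N) (n 2%N) (n 3%N)] in
  F ++ map oppf F.

(** The value of an affine function at the point of [q] with weights [w], times the total weight;
    leaving out the division keeps the computation in the integers. *)
Definition combz (w : seq nat) (f : nat -> int) (q : seq nat) : int :=
  let term j := (nth 0%N w j)%:Z * f (nth 0%N q j) in
  term 0%N + term 1%N + term 2%N + term 3%N.

(** The point lies strictly between the end planes of the block, so only tetrahedra of this block
    could contain it, and each of them has a facet plane that excludes it. *)
Definition escapes (q w : seq nat) : bool :=
  [&& 0 < combz w (fun=> 1) q, 0 < combz w (nth 0 vx) q,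
     combz w (nth 0 vx) q < 4 * combz w (fun=> 1) q &
     all (fun t => has (fun f => all (fun v => 0 <= evalz f v) t &&
       (combz w (evalz f) q < 0)) (facet_planes t)) block_tets].

(** Candidate witnesses. Each has exactly one zero weight and so lies in a facet of the quadruple;
    the first four are the centroids of the facets. *)
Definition escape_weights : seq (seq nat) :=
  [:: [:: 0; 1; 1; 1]; [:: 1; 0; 1; 1]; [:: 1; 1; 0; 1]; [:: 1; 1; 1; 0];
      [:: 1; 1; 0; 3]; [:: 0; 3; 1; 1]; [:: 1; 1; 2; 0]; [:: 0; 2; 1; 1];
      [:: 3; 1; 1; 0]]%N.

(* Conditionals, because [vm_compute] would evaluate both arguments of [||] and
   [==>]. *)
Lemma block_escape_compute : all (fun a => all (fun b => all (fun c => all (fun d =>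
  if [&& a < b, b < c & c < d]%N then
    if [:: a; b; c; d] \in block_tets then true
    else has (escapes [:: a; b; c; d]) escape_weights
  else true) (iota 0 7)) (iota 0 7)) (iota 0 7)) (iota 0 7).
Proof. by vm_compute. Qed.

Lemma block_escape a b c d : (a < b)%N -> (b < c)%N -> (c < d)%N -> (d < 7)%N ->
  [:: a; b; c; d] \notin block_tets ->
  exists2 w, w \in escape_weights & escapes [:: a; b; c; d] w.
Proof.
move=> ab bc cd d7 /negbTE nT; have i7 x : (x < 7)%N -> x \in iota 0 7.
  by rewrite mem_iota.
have c7 := ltn_trans cd d7; have b7 := ltn_trans bc c7; have a7 := ltn_trans ab b7.
have /allP/(_ _ (i7 _ a7))/allP/(_ _ (i7 _ b7)) := block_escape_compute.
move=> /allP/(_ _ (i7 _ c7))/allP/(_ _ (i7 _ d7)); rewrite ab bc cd nT.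
by move=> /hasP[w wW ew]; exists w.
Qed.

Lemma cap_z_le0 (R : realType) j : cap_pt R j.+1 0 2 <= 0.
Proof.
rewrite /cap_pt ptE (natrS1 R j.+1) (natrS1 R j).
have := natr_ge0 R j; move: (j%:R) => x x0; rewrite -subr_ge0.
have -> : 0 - (3 + 3 / (x + 1 + 1) - 6 * (x + 1)) =
    (6 * x * x + 15 * x + 3) / (x + 2) by field; lra.
by rewrite divr_ge0 //; nra.
Qed.

Section UniqueTriangulation.
Variables (R : realType) (m k : nat).
Let N := (4 * m + 7 + k)%N.
Let pos := @position R m.
Let X (v : nat) : R := pos v 0 0.
Let Z (v : nat) : R := pos v 0 2.
Let tets := toroid_tets m k.
Let body := solid N pos tets.

(** The signs on which [no_crossing] rests: height at least 2 towards its own side for a gate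
    vertex, height 0 for the middle vertex of a block, and for the stacked vertices a height that is
    not on the side of the first gate. *)
Lemma label_cases v : (v < N)%N ->
  [\/ exists j r, [/\ (j <= m.+1)%N, (r < 3)%N, v = (4 * j + r)%N,
        X v = (4 * j)%:R & 2 <= (-1) ^+ j * Z v],
      exists j, [/\ (j <= m)%N, v = (4 * j + 3)%N, X v = (4 * j)%:R + 2 & Z v = 0]
    | exists j, [/\ (0 < j <= k)%N, v = crest m j, X v = - j%:R & Z v <= 0]].
Proof.
move=> vN; have [v_lt|v_ge] := ltnP v (4 * m + 7); last first.
  constructor 3; exists (v - (4 * m + 7)).+1; have E : v = crest m (v - (4 * m + 7)).+1.
    by rewrite /crest; lia.
  split=> //; first by lia.
    by rewrite /X {1}E /pos position_crest cap_x.
  by rewrite /Z {1}E /pos position_crest cap_z_le0.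
pose j := (v %/ 4)%N; pose r := (v %% 4)%N.
have vE : v = (4 * j + r)%N by rewrite /j /r; lia.
have r4 : (r < 4)%N by rewrite /r; lia.
have PE : pos v = bpt R j r.
  by rewrite vE /pos position_chain -?vE // vE chain_posE //; lia.
have s2 : (-1) ^+ j * (-1) ^+ j = 1 :> R by rewrite -expr2 sqrr_sign.
have [r3|r3] := ltnP r 3.
  constructor 1; exists j, r; split=> //; first by lia.
    rewrite /X PE bpt_x; move: r3; case: (r) => [|[|[|]]] //= _; ring.
  rewrite /Z PE /bpt ptE mulrA s2 mul1r.
  by move: r3; case: (r) => [|[|[|]]] //= _; lra.
have r3' : r = 3%N by lia.
constructor 2; exists j; split; first by lia.
- by rewrite {1}vE r3'.
- by rewrite /X PE bpt_x r3'.
- by rewrite /Z PE /bpt ptE r3' /= mulr0.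
Qed.

(** A nonnegative sum of nonpositive terms has only zero terms. *)
Lemma support_le0 (t : seq nat) c u (w : 'rV[R]_N) : asimplex t w ->
  {in t, forall v, aff c u (pos v) <= 0} -> 0 <= aff c u (place pos w) ->
  forall i : 'I_N, w 0 i != 0 -> aff c u (pos i) = 0.
Proof.
move=> [w0 w1 ws] le0 ge0 i wi.
have le i' : w 0 i' * aff c u (pos i') <= 0.
  have [->|/ws/le0 h] := eqVneq (w 0 i') 0; first by rewrite mul0r.
  by rewrite mulr_ge0_le0.
have := ge0; rewrite aff_place // (bigD1 i) //= => s0.
have r0 : \sum_(j < N | j != i) w 0 j * aff c u (pos j) <= 0 by apply: sumr_le0.
have : w 0 i * aff c u (pos i) = 0 by apply/le_anti; rewrite le /=; lra.
by move=> /eqP; rewrite mulf_eq0 (negbTE wi) => /eqP.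
Qed.

Lemma tet_side t i : t \in tets -> (i <= m)%N ->
  {in t, forall v, X v <= (4 * i)%:R} \/ {in t, forall v, (4 * i)%:R <= X v}.
Proof.
move=> /mem_toroid_tets[/mem_chain_tets[j [t0 [jm t0T ->]]]|[j jk ->]] im.
  have [ij|ij] := leqP i j; [right|left] => _ /mapP[r rt ->];
    have r7 := block_tet_lt t0T rt; rewrite /X /pos position_block //;
    have [h1 h2 _ _] := bpt_x_bounds R j r7.
    by apply: le_trans h1; rewrite ler_nat leq_mul2l.
  by apply: le_trans h2 _; rewrite ler_nat leq_mul2l.
left=> v; have p0 : X 0 = 0 by rewrite /X /pos pos0 ptE.
have p1 : X 1 = 0 by rewrite /X /pos pos1 ptE.
have pq l : X (crest m l) = - l%:R by rewrite /X /pos position_crest cap_x.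
rewrite !inE => /or4P[]/eqP->; rewrite ?p0 ?p1 ?pq //;
  by rewrite (@le_trans _ _ 0) // oppr_le0.
Qed.

(** Every tetrahedron lies on one side of the plane of gate [i], so a point of the body in that
    plane is a combination of vertices in it, and these are gate vertices. *)
Lemma body_gate y i : (i <= m)%N -> body y -> y 0 0 = (4 * i)%:R ->
  2 <= (-1) ^+ i * y 0 2.
Proof.
move=> im [w [t tT wt] <-] yx.
have supp (j : 'I_N) : w 0 j != 0 -> X j = (4 * i)%:R.
  have E v : aff (- (4 * i)%:R) (col3 1 0 0) v = v 0 0 - (4 * i)%:R.
    by rewrite aff_col3; ring.
  have E' v : aff ((4 * i)%:R) (col3 (- 1) 0 0) v = (4 * i)%:R - v 0 0.
    by rewrite aff_col3; ring.
  have [le|ge] := tet_side tT im => wj.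
    apply/eqP; rewrite -subr_eq0 -E; apply/eqP.
    apply: (support_le0 wt _ _ wj); last by rewrite E yx subrr.
    by move=> v /le; rewrite E subr_le0.
  apply/eqP; rewrite eq_sym -subr_eq0 -E'; apply/eqP.
  apply: (support_le0 wt _ _ wj); last by rewrite E' yx subrr.
  by move=> v /ge; rewrite E' subr_le0.
have [w0 w1 _] := wt.
have -> : (-1) ^+ i * place pos w 0 2 = \sum_j w 0 j * ((-1) ^+ i * Z j).
  by rewrite /place summxE mulr_sumr; apply: eq_bigr => j _; rewrite mxE mulrCA.
have -> : 2 = \sum_j w 0 j * 2 :> R by rewrite -mulr_suml w1 mul1r.
apply: ler_sum => j _; have [->|wj] := eqVneq (w 0 j) 0; first by rewrite !mul0r.
apply: ler_wpM2l => //; have Xj := supp j wj.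
have [[j' [r [_ _ _ Xj' Zj]]]|[j' [_ _ Xj' _]]|[j' [/andP[j'0 _] _ Xj' _]]] :=
  label_cases (ltn_ord j).
- have e : i = j'.
    have : (4 * i)%:R = (4 * j')%:R :> R by rewrite -Xj -Xj'.
    by move=> /eqP; rewrite eqr_nat; lia.
  by rewrite e.
- have : (4 * i)%:R = (4 * j' + 2)%:R :> R by rewrite natrD -Xj -Xj'.
  by move=> /eqP; rewrite eqr_nat; lia.
- have := ler0n R (4 * i); rewrite -Xj Xj' oppr_ge0 lern0 => /eqP e.
  by rewrite e in j'0.
Qed.

Section Inside.
Variable s : seq nat.
Hypothesis labels_s : {in s, forall v, (v < N)%N}.
Hypothesis inside : hull (map pos s) `<=` body.
Hypothesis uniq_s : uniq s.

Lemma inside_segment v w tau : v \in s -> w \in s -> 0 <= tau <= 1 ->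
  body (pos v + tau *: (pos w - pos v)).
Proof.
move=> vs ws t01; apply: inside.
have sN : all (gtn N) s by apply/allP.
have vN := labels_s vs; have wN := labels_s ws.
rewrite (hull_place pos uniq_s sN).
have S z : z \in s -> asimplex s (uniform R N [:: z]).
  move=> zs; apply: (@asimplexW _ _ [:: z]); first by move=> z'; rewrite inE => /eqP->.
  by apply: asimplex_uniform => //=; rewrite andbT; exact: labels_s.
exists (uniform R N [:: v] + tau *: (uniform R N [:: w] - uniform R N [:: v])).
  by apply: asimplex_step => //; exact: S.
by rewrite -place_step !place_vertex.
Qed.

Lemma segment_crossing v w i : v \in s -> w \in s -> (i <= m)%N ->
  X v < (4 * i)%:R -> (4 * i)%:R < X w ->
  exists tau, [/\ 0 <= tau <= 1, (1 - tau) * X v + tau * X w = (4 * i)%:R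
    & 2 <= (-1) ^+ i * ((1 - tau) * Z v + tau * Z w)].
Proof.
move=> vs ws im xv xw; pose tau := ((4 * i)%:R - X v) / (X w - X v).
have d0 : 0 < X w - X v by lra.
have tE : tau * (X w - X v) = (4 * i)%:R - X v by rewrite divfK // gt_eqF.
have t01 : 0 <= tau <= 1.
  by rewrite divr_ge0 /= ?ler_pdivrMr //; lra.
have xE : (1 - tau) * X v + tau * X w = (4 * i)%:R by lra.
exists tau; split=> //.
have E (l : 'I_3) : (pos v + tau *: (pos w - pos v)) 0 l =
    (1 - tau) * pos v 0 l + tau * pos w 0 l.
  by rewrite !mxE; ring.
rewrite -/Z /Z -E; apply: body_gate => //; first exact: inside_segment.
by rewrite E.
Qed.

(** Measure heights towards the side of gate [i]. The segment has height at least 2 where it crosses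
    the plane of the gate. On either side of the crossing it has a point of nonpositive height:
    where it crosses the neighbouring gate plane, or else its end point. Height is affine along the
    segment, so this is impossible. *)
Lemma no_crossing v w i : v \in s -> w \in s -> (i <= m)%N ->
  X v < (4 * i)%:R -> (4 * i)%:R < X w -> False.
Proof.
move=> vs ws im xv xw.
have [tg [/andP[tg0 tg1] tgx tgz]] := segment_crossing vs ws im xv xw.
pose f (tau : R) := (1 - tau) * X v + tau * X w.
pose g (tau : R) := (-1) ^+ i * ((1 - tau) * Z v + tau * Z w).
have sgS : (-1) ^+ i.+1 = - (-1) ^+ i :> R by rewrite exprS mulN1r.
(* The end point serves if it is on gate [i - 1], if it is the middle vertex of block [i - 1], or if
   [i = 0] and it is a stacked vertex; otherwise the segment crosses the plane of gate [i - 1]. *)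
have left_pt : exists tau, f tau < (4 * i)%:R /\ g tau <= 0.
  have [[j [r [_ r3 _ Xj Zj]]]|[j [_ _ Xj Zj]]|[j [/andP[j0 _] _ Xj Zj]]] :=
    label_cases (labels_s vs).
  - have ji : (j < i)%N by move: xv; rewrite Xj ltr_nat ltn_pmul2l.
    have [iE|ij] := eqVneq i j.+1.
      exists 0; rewrite /f /g subr0 !mul1r !mul0r !addr0; split=> //.
      by rewrite iE exprS mulN1r mulNr oppr_le0 (le_trans _ Zj).
    have i1 : i = i.-1.+1 by clear -ji; lia.
    have [|||t [_ tx tz]] := segment_crossing vs ws (i := i.-1).
    + by clear -im i1; lia.
    + by rewrite Xj ltr_nat ltn_pmul2l //; clear -ji ij i1; lia.
    + by apply: lt_trans xw; rewrite ltr_nat ltn_pmul2l //; clear -i1; lia.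
    exists t; rewrite /f tx ltr_nat ltn_pmul2l //; split; first by clear -i1; lia.
    by rewrite /g {1}i1 exprS mulN1r mulNr oppr_le0 (le_trans _ tz).
  - have ji : (j < i)%N.
      have : (4 * j)%:R < (4 * i)%:R :> R by move: xv; rewrite Xj; lra.
      by rewrite ltr_nat ltn_pmul2l.
    have [iE|ij] := eqVneq i j.+1.
      by exists 0; rewrite /f /g Zj subr0 !mul1r !mul0r !addr0 mulr0.
    have i1 : i = i.-1.+1 by clear -ji; lia.
    have [|||t [_ tx tz]] := segment_crossing vs ws (i := i.-1).
    + by clear -im i1; lia.
    + have : (4 * j + 4)%:R <= (4 * i.-1)%:R :> R by rewrite ler_nat; clear -ji ij i1; lia.
      by rewrite natrD Xj; lra.
    + by apply: lt_trans xw; rewrite ltr_nat ltn_pmul2l //; clear -i1; lia.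
    exists t; rewrite /f tx ltr_nat ltn_pmul2l //; split; first by clear -i1; lia.
    by rewrite /g {1}i1 exprS mulN1r mulNr oppr_le0 (le_trans _ tz).
  - have [iE|i0] := posnP i.
      by exists 0; rewrite /f /g subr0 !mul1r !mul0r !addr0; split=> //; rewrite iE expr0 mul1r.
    have i1 : i = i.-1.+1 by clear -i0; lia.
    have Xneg : X v < (4 * i.-1)%:R.
      by apply: lt_le_trans (ler0n R _); rewrite Xj oppr_lt0 ltr0n.
    have [|||t [_ tx tz]] := segment_crossing vs ws (i := i.-1).
    + by clear -im i1; lia.
    + exact: Xneg.
    + by apply: lt_trans xw; rewrite ltr_nat ltn_pmul2l //; clear -i1; lia.
    exists t; rewrite /f tx ltr_nat ltn_pmul2l //; split; first by clear -i1; lia.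
    by rewrite /g {1}i1 exprS mulN1r mulNr oppr_le0 (le_trans _ tz).
have right_pt : exists tau, (4 * i)%:R < f tau /\ g tau <= 0.
  (* [body_gate] covers the gates up to [m] only; the bounds on [j] ensure [i + 1 <= m]. *)
  have far j : (i.+1 < j)%N -> (j <= m.+1)%N -> (4 * j)%:R <= X w ->
      exists tau, (4 * i)%:R < f tau /\ g tau <= 0.
    move=> ij jm Xj.
    have [|||t [_ tx tz]] := segment_crossing vs ws (i := i.+1).
    + by clear -ij jm; lia.
    + by apply: lt_trans xv _; rewrite ltr_nat ltn_pmul2l.
    + by apply: lt_le_trans Xj; rewrite ltr_nat ltn_pmul2l.
    exists t; rewrite /f tx ltr_nat ltn_pmul2l //; split=> //.
    by move: tz; rewrite sgS mulNr => tz; rewrite /g -oppr_ge0 (le_trans _ tz).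
  have [[j [r [jm r3 _ Xj Zj]]]|[j [jm _ Xj Zj]]|[j [_ _ Xj Zj]]] :=
    label_cases (labels_s ws).
  - have ij : (i < j)%N by move: xw; rewrite Xj ltr_nat ltn_pmul2l.
    have [jE|ji] := eqVneq j i.+1; last by apply: (far j); rewrite ?Xj //; lia.
    exists 1; rewrite /f /g subrr !mul1r !mul0r !add0r; split=> //.
    by move: Zj; rewrite jE sgS mulNr => tz; rewrite -oppr_ge0 (le_trans _ tz).
  - have ij : (i <= j)%N.
      have : (4 * i)%:R < (4 * j + 2)%:R :> R by rewrite natrD -Xj.
      by rewrite ltr_nat; lia.
    exists 1; rewrite /f /g Zj subrr !mul1r !mul0r !add0r mulr0; split=> //.
  - by move: xw; rewrite Xj ltNge (le_trans _ (ler0n R (4 * i))) // oppr_le0.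
have [tl [fl gl]] := left_pt; have [tr [fr gr]] := right_pt.
have d0 : 0 < X w - X v by lra.
have tlg : tl < tg by move: fl; rewrite -tgx /f => h; nra.
have tgr : tg < tr by move: fr; rewrite -tgx /f => h; nra.
rewrite -/(g tg) in tgz.
(* The parameter of the crossing lies between the other two, so its height is a weighted mean of
   theirs. *)
have : (tr - tl) * g tg = (tr - tg) * g tl + (tg - tl) * g tr by rewrite /g; ring.
by nra.
Qed.

End Inside.
End UniqueTriangulation.

Lemma aff_place_ge0 (R : realType) N pos (t : seq nat) c u (w : 'rV[R]_N) :
  asimplex t w -> {in t, forall v, 0 <= aff c u (pos v)} -> 0 <= aff c u (place pos w).
Proof.
move=> [w0 w1 wt] ge0; rewrite aff_place //; apply: sumr_ge0 => i _.
by have [->|/wt/ge0 h] := eqVneq (w 0 i) 0; [rewrite mul0r|rewrite mulr_ge0].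
Qed.

Lemma hull4 (R : realType) (p q r s : 'rV[R]_3) a b c d :
  [/\ 0 <= a, 0 <= b, 0 <= c & 0 <= d] -> a + b + c + d = 1 ->
  hull [:: p; q; r; s] (a *: p + b *: q + c *: r + d *: s).
Proof.
move=> [a0 b0 c0 d0] e; exists (fun i : 'I_4 => [:: a; b; c; d]`_i); split.
- by case=> [[|[|[|[|]]]]].
- by rewrite !big_ord_recl big_ord0 /= addr0 !addrA.
- by rewrite !big_ord_recl big_ord0 /= addr0 !addrA.
Qed.

Lemma aff4 (R : realType) (p q r s : 'rV[R]_3) a b c d e u :
  a + b + c + d = 1 -> aff e u (a *: p + b *: q + c *: r + d *: s) =
  a * aff e u p + b * aff e u q + c * aff e u r + d * aff e u s.
Proof.
rewrite /aff => h; rewrite !mulmxDl -!scalemxAl !mxE -[LHS]addr0 -[e in LHS]mul1r -h.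
ring.
Qed.

(** * Vertex quadruples inside the body *)

Section OnlyTets.
Variables (R : realType) (m k : nat).
Let N := (4 * m + 7 + k)%N.
Let pos := @position R m.
Let tets := toroid_tets m k.
Let body := solid N pos tets.
Variable s : seq nat.
Hypothesis labels_s : {in s, forall v, (v < N)%N}.
Hypothesis inside : hull (map pos s) `<=` body.
Hypothesis uniq_s : uniq s.
Hypothesis size_s : size s = 4%N.

Lemma hull_sub s' : uniq s' -> {subset s' <= s} -> hull (map pos s') `<=` body.
Proof.
move=> us' ss'; apply: subset_trans inside.
have sN : all (gtn N) s by apply/allP.
have s'N : all (gtn N) s' by apply/allP => v /ss'/labels_s.
rewrite !(hull_place (N := N)) //; apply: image_subset => w; exact: asimplexW.
Qed.

Lemma block_label v i : (4 * i <= v)%N -> (v < 4 * i + 7)%N -> (i <= m)%N ->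
  pos v = bpt R i (v - 4 * i).
Proof.
by move=> iv vi im; rewrite /pos -[v in LHS](subnKC iv) position_block //; lia.
Qed.

(** A stacked vertex has negative [x], so [no_crossing] at gate 0 forbids vertices of positive [x],
    and only the first gate and the crest remain. Without stacked vertices, no inner gate separates
    two labels strictly, so all of them lie in the block of the smallest one. *)
Lemma label_case :
  (exists2 i, (i <= m)%N & {in s, forall v, (4 * i <= v < 4 * i + 7)%N}) \/
  {in s, forall v, v \in [:: 0; 1]%N \/ exists2 j, (j <= k)%N & v = crest m j}.
Proof.
have [/hasP[w ws wm]|] := boolP (has (leq (4 * m + 7)) s).
  right=> v vs.
  have Xw : pos w 0 0 < (4 * 0)%:R.
    have E : w = crest m (w - (4 * m + 7)).+1 by rewrite /crest; lia.
    by rewrite E /pos position_crest cap_x oppr_lt0 ltr0n.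
  have Xv : pos v 0 0 <= (4 * 0)%:R.
    rewrite leNgt; apply/negP => Xv.
    exact: (no_crossing labels_s inside uniq_s ws vs (leq0n m) Xw Xv).
  rewrite muln0 in Xv.
  have [[j [r [_ r3 vE Xj _]]]|[j [_ _ Xj _]]|[j [/andP[_ jk] vE _ _]]] :=
    label_cases R (labels_s vs).
  - move: Xv; rewrite Xj lern0 => /eqP j0; have {}vE : v = r by lia.
    by rewrite vE; case: r r3 {vE} => [|[|[|]]] // _; [left|left|right; exists 0%N].
  - by move: Xv; rewrite Xj; have := ler0n R (4 * j); lra.
  - by right; exists j.
move=> /hasPn small; left.
have sm v : v \in s -> (v < 4 * m + 7)%N by move=> /small; rewrite -ltnNge.
have s0 : s != [::] by rewrite -size_eq0 size_s.
pose a := nth 0%N (sort leq s) 0.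
have as_ : a \in s by rewrite -(mem_sort leq) mem_nth // size_sort size_s.
have amin v : v \in s -> (a <= v)%N.
  rewrite -(mem_sort leq) => /(nthP 0%N)[i isz <-].
  by apply: (sorted_leq_nth leq_trans leqnn) => //;
    rewrite ?inE ?size_sort ?size_s // (sort_sorted leq_total).
have ma := sm a as_.
(* A smallest label from [4 * m + 4] on belongs to the last gate, and its quotient by 4 would not be
   a block index; block [m] is taken instead. *)
have [am|am] := ltnP a (4 * m + 4); last first.
  by exists m => // v vs; have := amin v vs; have := sm v vs; lia.
exists (a %/ 4)%N; first by lia.
move=> v vs; have := amin v vs; have := sm v vs => vm av.
apply/andP; split; first by lia.
rewrite ltnNge; apply/negP => vbig.
have im : ((a %/ 4).+1 <= m)%N by lia.
apply: (no_crossing labels_s inside uniq_s as_ vs im).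
- have -> : position R m a = bpt R (a %/ 4) (a - 4 * (a %/ 4)) by apply: block_label; lia.
  have := @bpt_x_bounds R (a %/ 4) (a - 4 * (a %/ 4)); case; first by lia.
  move=> _ le _ eq; rewrite lt_neqAle le andbT; apply/eqP => /eq; lia.
(* With this block index the local label of [v] is between 3 and 6, so [v] lies strictly to the
   right of the plane [x = 4 * j]. *)
- pose j := ((v - 3) %/ 4)%N.
  have -> : position R m v = bpt R j (v - 4 * j) by apply: block_label; rewrite /j; lia.
  have [|ge _ eq _] := @bpt_x_bounds R j (v - 4 * j); first by rewrite /j; lia.
  rewrite lt_neqAle; apply/andP; split; last first.
    by apply: le_trans ge; rewrite ler_nat /j; lia.
  have [ij|ij] := eqVneq (a %/ 4).+1 j.
    by rewrite ij eq_sym; apply/eqP => /eq; rewrite /j; lia.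
  rewrite lt_eqF //; apply: lt_le_trans ge; rewrite ltr_nat.
  by move: ij; rewrite /j; lia.
Qed.


Definition block_pt i (q w : seq nat) : 'rV[R]_3 :=
  let W := combz w (fun=> 1) q in
  let c j := (nth 0%N w j)%:R / W%:~R in
  let p j := bpt R i (nth 0%N q j) in
  c 0%N *: p 0%N + c 1%N *: p 1%N + c 2%N *: p 2%N + c 3%N *: p 3%N.

Lemma block_pt_coef (q w : seq nat) : 0 < combz w (fun=> 1) q ->
  let W := combz w (fun=> 1) q in
  let c j := (nth 0%N w j)%:R / W%:~R : R in c 0%N + c 1%N + c 2%N + c 3%N = 1.
Proof.
move=> W0 /=; rewrite -!mulrDl -!natrD.
have -> : (nth 0 w 0 + nth 0 w 1 + nth 0 w 2 + nth 0 w 3)%N%:R = (combz w (fun=> 1) q)%:~R :> R.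
  by rewrite /combz !mulr1 -!PoszD.
by rewrite divff // intr_eq0 gt_eqF.
Qed.

Lemma aff_block_pt i f q w : 0 < combz w (fun=> 1) q ->
  aff (planef R i f).1 (planef R i f).2 (block_pt i q w) =
  (combz w (evalz f) q)%:~R / (combz w (fun=> 1) q)%:~R.
Proof.
move=> W0; rewrite /block_pt aff4; last exact: block_pt_coef.
rewrite !aff_planef; move: (_^-1) => iW.
rewrite [in RHS]/combz !rmorphD !rmorphM /= -!pmulrn; ring.
Qed.


Lemma hull_block_pt i a b c d w : 0 < combz w (fun=> 1) [:: a; b; c; d] ->
  hull [:: bpt R i a; bpt R i b; bpt R i c; bpt R i d] (block_pt i [:: a; b; c; d] w).
Proof.
move=> W0; apply: hull4; last exact: block_pt_coef W0.
have iW : 0 <= ((combz w (fun=> 1) [:: a; b; c; d])%:~R : R)^-1.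
  by rewrite invr_ge0 ler0z ltW.
by split; rewrite mulr_ge0 // ler0n.
Qed.

Lemma escape_outside i q w : (i <= m)%N -> escapes q w -> ~ body (block_pt i q w).
Proof.
move=> im /and4P[W0 x0 x4 /allP out] [y [t tT yt] e].
have W0' : 0 < (combz w (fun=> 1) q)%:~R :> R by rewrite ltr0z.
have AX f : aff (planef R i f).1 (planef R i f).2 (place pos y) =
    (combz w (evalz f) q)%:~R / (combz w (fun=> 1) q)%:~R.
  by rewrite e aff_block_pt.
have xE : combz w (nth 0 vx) q = combz w (evalz (0, 1, 0, 0)) q.
  by rewrite /combz /evalz; ring.
have xE' : combz w (evalz (4, -1, 0, 0)) q =
    4 * combz w (fun=> 1) q - combz w (nth 0 vx) q.
  by rewrite /combz /evalz; ring.
have X1 : 0 < place pos y 0 0 - (4 * i)%:R.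
  have -> : place pos y 0 0 - (4 * i)%:R =
      aff (planef R i (0, 1, 0, 0)).1 (planef R i (0, 1, 0, 0)).2 (place pos y).
    by rewrite /= aff_col3; ring.
  by rewrite AX -xE divr_gt0 // ltr0z.
have X2 : 0 < (4 * i)%:R + 4 - place pos y 0 0.
  have -> : (4 * i)%:R + 4 - place pos y 0 0 =
      aff (planef R i (4, -1, 0, 0)).1 (planef R i (4, -1, 0, 0)).2 (place pos y).
    by rewrite /= aff_col3; ring.
  by rewrite AX xE' divr_gt0 // ltr0z subr_gt0.
have le0 (a : R) : {in t, forall v, pos v 0 0 <= a} -> place pos y 0 0 <= a.
  move=> h; rewrite -subr_ge0.
  have -> : a - place pos y 0 0 = aff a (col3 (-1) 0 0) (place pos y).
    by rewrite aff_col3; ring.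
  apply: (aff_place_ge0 yt) => v /h; rewrite aff_col3 => ?; lra.
have ge0 (a : R) : {in t, forall v, a <= pos v 0 0} -> a <= place pos y 0 0.
  move=> h; rewrite -subr_ge0.
  have -> : place pos y 0 0 - a = aff (- a) (col3 1 0 0) (place pos y).
    by rewrite aff_col3; ring.
  apply: (aff_place_ge0 yt) => v /h; rewrite aff_col3 => ?; lra.
have [left|right] := tet_side R tT im.
  by have := le0 _ left; lra.
have {right ge0} : exists2 t0, t0 \in block_tets & t = shift i t0.
  move: tT => /mem_toroid_tets[/mem_chain_tets[j [t0 [jm t0T tE]]]|[j jk tE]].
    have [ij|ji|ij] := ltngtP i j; last by exists t0; rewrite // ij.
      have h : (4 * i)%:R + 4 <= place pos y 0 0.
        apply: ge0; rewrite tE => _ /mapP[r rt ->].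
        rewrite /pos position_block ?(block_tet_lt t0T) //.
        have [h _ _ _] := @bpt_x_bounds R j r (block_tet_lt t0T rt).
        apply: le_trans h; rewrite -[4 in leLHS]/(4%:R) -natrD ler_nat; lia.
      by rewrite subr_gt0 ltNge h in X2.
    have h : place pos y 0 0 <= (4 * i)%:R.
      apply: le0; rewrite tE => _ /mapP[r rt ->].
      rewrite /pos position_block ?(block_tet_lt t0T) //.
      have [_ h _ _] := @bpt_x_bounds R j r (block_tet_lt t0T rt).
      by apply: le_trans h _; rewrite ler_nat; lia.
    by rewrite subr_gt0 ltNge h in X1.
  have h : place pos y 0 0 <= (4 * i)%:R.
    have pq l : pos (crest m l) 0 0 <= (4 * i)%:R.
      by rewrite /pos position_crest cap_x (@le_trans _ _ 0) // oppr_le0.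
    apply: le0 => v; rewrite tE !inE => /or4P[]/eqP-> //.
      by rewrite /pos pos0 ptE.
    by rewrite /pos pos1 ptE.
  by rewrite subr_gt0 ltNge h in X1.
move=> [t0 t0T tE]; have /hasP[f _ /andP[/allP f0 neg]] := out t0 t0T.
have : 0 <= aff (planef R i f).1 (planef R i f).2 (place pos y).
  apply: (aff_place_ge0 yt); rewrite tE => _ /mapP[r rt ->].
  by rewrite /pos position_block ?(block_tet_lt t0T) // aff_planef ler0z f0.
by rewrite AX leNgt pmulr_llt0 ?invr_gt0 // ltrz0 neg.
Qed.

(** After transport to the first block and sorting, a quadruple that is not one of the tetrahedra
    has a witness by [block_escape], and the witness lies outside the body. *)
Lemma block_tetrahedron i : (i <= m)%N ->
  {in s, forall v, (4 * i <= v < 4 * i + 7)%N} -> exists2 t, t \in tets & s =i t.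
Proof.
move=> im bnd; pose q := sort leq (map (subn^~ (4 * i)) s).
have sE : s =i shift i q.
  move=> v; apply/idP/mapP => [vs|[r]].
    have /andP[iv _] := bnd v vs.
    exists (v - 4 * i)%N; last by rewrite subnKC.
    by rewrite mem_sort; apply: map_f vs.
  by rewrite mem_sort => /mapP[u us ->] ->; have /andP[iu _] := bnd u us; rewrite subnKC.
have uq : uniq q.
  rewrite sort_uniq map_inj_in_uniq // => u v /bnd/andP[u0 _] /bnd/andP[v0 _] /= e.
  by rewrite -(subnKC u0) e subnKC.
have q7 r : r \in q -> (r < 7)%N.
  by rewrite mem_sort => /mapP[u /bnd/andP[? ?] ->]; lia.
have sq : sorted ltn q by rewrite ltn_sorted_uniq_leq uq (sort_sorted leq_total).
have [qT|qT] := boolP (q \in block_tets).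
  by exists (shift i q) => //; apply/mem_toroid_tets; left; apply/mem_chain_tets; exists i, q.
have zq : size q = 4%N by rewrite size_sort size_map.
clearbody q; case: q => [|a [|b [|c [|d [|e q]]]]] // in zq uq q7 sq qT sE *.
move: sq => /and4P[ab bc cd _].
have d7 : (d < 7)%N by apply: q7; rewrite !inE eqxx !orbT.
have [w _ ew] := block_escape ab bc cd d7 qT.
exfalso; apply: (escape_outside im ew).
have := @hull_sub (shift i [:: a; b; c; d]); apply.
- by rewrite map_inj_uniq // => u v /addnI.
- by move=> v; rewrite sE.
rewrite /shift -map_comp /= /pos !position_block ?q7 ?inE ?eqxx ?orbT //.
by apply: hull_block_pt; have /andP[] := ew.
Qed.

(* On the crest the function [y - z + 3 + 6 x] takes the values [1 / (j + 1)],
   which are convex in [j = - x]; this one is a positive multiple of the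
   excess over the chord through [crest i] and [crest (i + 1)]. *)
Lemma aff_chord (i l : nat) : let D : R := (i%:R + 1) * (i%:R + 2) in
  aff (3 * D - 2 * (i%:R + 1)) (col3 (6 * D - 1) D (- D)) (cap_pt R l) =
  (l%:R - i%:R) * (l%:R - i%:R - 1) / (l%:R + 1).
Proof.
rewrite /= aff_col3 /cap_pt !ptE (natrS1 R l).
have := natr_ge0 R l; move: (l%:R) (i%:R) => x y x0.
by field; lra.
Qed.

(** A product of two consecutive integers is nonnegative and vanishes only if one of them does. *)
Lemma chord_ge0 (i l : nat) :
  0 <= (l%:R - i%:R) * (l%:R - i%:R - 1) / (l%:R + 1) :> R /\
  (l != i -> l != i.+1 -> 0 < (l%:R - i%:R) * (l%:R - i%:R - 1) / (l%:R + 1) :> R).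
Proof.
have l0 : 0 < (l%:R + 1)^-1 :> R by rewrite invr_gt0 ltr_wpDl.
have [li|li|->] := ltngtP l i; last by rewrite subrr !mul0r; split.
  have h : (l%:R - i%:R < 0 :> R) by rewrite subr_lt0 ltr_nat.
  have h' : l%:R - i%:R - 1 < 0 :> R by rewrite subr_lt0 (lt_trans h).
  have p : 0 < (l%:R - i%:R) * (l%:R - i%:R - 1) / (l%:R + 1) :> R.
    by rewrite pmulr_lgt0 // nmulr_rgt0.
  by split=> [|_ _] //; exact: ltW.
have [->|li'] := eqVneq l i.+1.
  by rewrite natrS1 addrAC subrr add0r subrr mulr0 mul0r; split.
have h' : 0 < l%:R - i%:R - 1 :> R.
  by rewrite -addrA -opprD subr_gt0 natr1 ltr_nat; lia.
have h : 0 < l%:R - i%:R :> R by rewrite subr_gt0 ltr_nat.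
by split=> [|_ _]; [apply: ltW|]; rewrite pmulr_lgt0 // mulr_gt0.
Qed.

(** The midpoint of two crest points that are not adjacent has negative [x], so it would lie in some
    [cap_tet m i]. The function of [aff_chord] is nonpositive on that tetrahedron, but positive at
    the midpoint, because the two ends are not both among [crest m i] and [crest m i.+1]. *)
Lemma crest_adjacent a b : (a < b)%N -> (b <= k)%N ->
  crest m a \in s -> crest m b \in s -> b = a.+1.
Proof.
move=> ab bk as_ bs; apply/eqP; apply: contraT => nab; exfalso.
have half : 0 <= (2^-1 : R) <= 1 by apply/andP; split; lra.
have [y [t tT yt] e] := inside_segment labels_s inside uniq_s as_ bs half.
have xneg : place pos y 0 0 < 0.
  rewrite e !mxE !position_crest !cap_x.
  have : 0 < b%:R :> R by rewrite ltr0n; lia.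
  have := natr_ge0 R a; move: (a%:R) (b%:R) => u v ? ?; lra.
have : exists2 i, (i < k)%N & t = cap_tet m i.
  move: tT => /mem_toroid_tets[/mem_chain_tets[j [t0 [jm t0T tE]]]|//].
  have : 0 <= aff 0 (col3 1 0 0) (place pos y).
    apply: (aff_place_ge0 yt); rewrite tE => _ /mapP[r rt ->].
    rewrite /pos position_block ?(block_tet_lt t0T) // aff_col3 add0r mul1r !mul0r !addr0.
    have [h _ _ _] := @bpt_x_bounds R j r (block_tet_lt t0T rt).
    by apply: le_trans h; exact: ler0n.
  by rewrite aff_col3 add0r mul1r !mul0r !addr0 leNgt xneg.
move=> [i ik tE]; pose D : R := (i%:R + 1) * (i%:R + 2).
pose c : R := 3 * D - 2 * (i%:R + 1); pose u := col3 (6 * D - 1) D (- D).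
have i0 := natr_ge0 R i.
have affN x : aff (- c) (- u) x = - aff c u x.
  by rewrite /aff mulmxN [RHS]opprD; congr (_ + _); rewrite [LHS]mxE.
have le0 : 0 <= aff (- c) (- u) (place pos y).
  apply: (aff_place_ge0 yt) => v; rewrite affN oppr_ge0 tE !inE => /or4P[]/eqP->.
  - rewrite /pos pos0 /u aff_col3 !ptE /c.
    rewrite [leLHS](_ : _ = - (2 * (i%:R + 1))); last by ring.
    by rewrite oppr_le0 mulr_ge0 // addr_ge0.
  - rewrite /pos pos1 /u aff_col3 !ptE /c.
    rewrite [leLHS](_ : _ = - (2 * (i%:R + 1))); last by ring.
    by rewrite oppr_le0 mulr_ge0 // addr_ge0.
  - by rewrite /pos position_crest aff_chord subrr !mul0r.
  - by rewrite /pos position_crest aff_chord natrS1 addrAC subrr add0r subrr mulr0 mul0r.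
move: le0; rewrite affN oppr_ge0 e affD.
have -> : (2^-1 *: (position R m (crest m b) - position R m (crest m a)) *m u) 0 0 =
    2^-1 * (aff c u (cap_pt R b) - aff c u (cap_pt R a)).
  by rewrite /aff !position_crest -scalemxAl mulmxBl !mxE; ring.
rewrite position_crest !aff_chord.
have [ga gt_a] := chord_ge0 i a; have [gb gt_b] := chord_ge0 i b.
have pos_sum : 0 < (a%:R - i%:R) * (a%:R - i%:R - 1) / (a%:R + 1) +
    (b%:R - i%:R) * (b%:R - i%:R - 1) / (b%:R + 1) :> R.
  have [ai|ai] := boolP ((a == i) || (a == i.+1)).
    have bi : b != i /\ b != i.+1.
      by move: ai ab nab; clear; lia.
    exact: (ltr_wpDl ga (gt_b bi.1 bi.2)).
  by move: ai; rewrite negb_or => /andP[ai ai']; exact: (ltr_pwDl (gt_a ai ai') gb).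
move: pos_sum; move: (_ / (a%:R + 1)) (_ / (b%:R + 1)) => g h gh.
rewrite leNgt [X in 0 < X](_ : _ = 2^-1 * (g + h)); last by field.
by rewrite mulr_gt0 // invr_gt0 ltr0n.
Qed.

(** Of three crest labels the extreme two would not be adjacent, so at most two occur; the others
    are 0 and 1, and the two crest labels are consecutive. *)
Lemma cap_tetrahedron :
  {in s, forall v, v \in [:: 0; 1]%N \/ exists2 j, (j <= k)%N & v = crest m j} ->
  exists2 t, t \in tets & s =i t.
Proof.
move=> cases.
have us : uniq (sort leq s) by rewrite sort_uniq.
have ss : sorted ltn (sort leq s) by rewrite ltn_sorted_uniq_leq us (sort_sorted leq_total).
have sE v : (v \in s) = (v \in sort leq s) by rewrite mem_sort.
have zs : size (sort leq s) = 4%N by rewrite size_sort.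
have adj a b : (a < b)%N -> (b <= k)%N -> crest m a \in sort leq s ->
    crest m b \in sort leq s -> b = a.+1.
  by rewrite -!sE; exact: crest_adjacent.
have {}cases v : v \in sort leq s -> v \in [:: 0; 1]%N \/ exists2 j, (j <= k)%N & v = crest m j.
  by rewrite -sE => /cases.
suff [t tT st] : exists2 t, t \in tets & (sort leq s : seq nat) =i t.
  by exists t => // v; rewrite sE st.
move: (sort leq s) us ss zs adj cases => q _.
case: q => [|x [|y [|z [|w [|]]]]] // /and4P[xy yz zw _] _ adj cases.
have crest_case v : v \in [:: x; y; z; w] -> (1 < v)%N ->
    exists2 j, (j <= k)%N & v = crest m j.
  by move=> /cases[|//]; rewrite !inE => /orP[]/eqP->.
have lt_crest a b : (crest m a < crest m b)%N -> (a < b)%N.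
  by rewrite !ltnNge; apply: contra; rewrite leq_eqVlt => /orP[/eqP->//|/crest_lt/ltnW].
have [wc wk wE] : exists2 j, (j <= k)%N & w = crest m j.
  by apply: crest_case; [rewrite !inE eqxx !orbT|lia].
have [zc zk zE] : exists2 j, (j <= k)%N & z = crest m j.
  by apply: crest_case; [rewrite !inE eqxx !orbT|lia].
have zwc : (zc < wc)%N by apply: lt_crest; rewrite -zE -wE.
have inw : crest m wc \in [:: x; y; z; w] by rewrite -wE !inE eqxx !orbT.
have [y1|y1] := ltnP 1 y.
  have [yc yk yE] : exists2 j, (j <= k)%N & y = crest m j.
    by apply: crest_case => //; rewrite !inE eqxx !orbT.
  have yzc : (yc < zc)%N by apply: lt_crest; rewrite -zE -yE.
  have : wc = yc.+1.
    apply: adj => //; first by lia.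
    by rewrite -yE !inE eqxx !orbT.
  by lia.
have wz : wc = zc.+1 by apply: adj; rewrite // -zE !inE eqxx !orbT.
exists (cap_tet m zc).
  by apply/mem_toroid_tets; right; exists zc => //; rewrite -wz.
have -> : x = 0%N by lia.
have -> : y = 1%N by lia.
by move=> v; rewrite zE wE wz.
Qed.

Lemma only_toroid_tets : exists2 t, t \in tets & s =i t.
Proof.
have [[i im bnd]|cases] := label_case; first exact: block_tetrahedron im bnd.
exact: cap_tetrahedron.
Qed.

End OnlyTets.

Lemma Tmin_toroid (R : realType) (m k : nat) (hP : triangulable (toroid_polyhedron R m k)) :
  Tmin hP = (7 * m.+1 + k)%N.
Proof.
rewrite /Tmin; case: ex_minnP => n /asboolP nP min; apply/eqP; rewrite eqn_leq min /=; last first.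
  by apply/asboolP; exact: toroid_triangulable.
rewrite -size_toroid_tets; apply: triangulation_size nP; first exact: uniq_toroid_tets.
move=> s us zs ls hs; apply: only_toroid_tets hs us zs => v /ls[b bB vb].
exact: (allP (tri_labels (toroid_closed m k) (@toroid_labels m k) bB) _ vb).
Qed.

(** * Stellar moves *)

Section Stellar.
Variable R : realType.

(** Equality of the generated complexes, insensitive to the order of labels and to redundant
    faces. *)
Definition same_sets (K K' : seq (seq nat)) : bool :=
  all (fun t => has (fun t' => all (mem t') t) K') K &&
  all (fun t => has (fun t' => all (mem t') t) K) K'.

Definition matched N (Ks Ks' : seq (seq (seq nat))) (f g : 'rV[R]_N -> 'rV[R]_N) :=
  forall j w, realization (nth [::] Ks j) w ->
    realization (nth [::] Ks' j) (f w) /\ g (f w) = w.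

(* Families of complexes, so that the same pair of maps also respects
   distinguished subcomplexes. *)
Definition matchable N (Ks Ks' : seq (seq (seq nat))) :=
  exists f g : 'rV[R]_N -> 'rV[R]_N,
    [/\ continuous f, continuous g, matched Ks Ks' f g & matched Ks' Ks g f].

Lemma matchable_sym N Ks Ks' : matchable N Ks Ks' -> matchable N Ks' Ks.
Proof. by move=> [f [g [? ? ? ?]]]; exists g, f. Qed.

Lemma matchable_trans N Ks Ks' Ks'' :
  matchable N Ks Ks' -> matchable N Ks' Ks'' -> matchable N Ks Ks''.
Proof.
move=> [f [g [fc gc fg gf]]] [f' [g' [fc' gc' fg' gf']]]; exists (f' \o f), (g \o g').
split.
- by move=> x; apply: continuous_comp; [exact: fc|exact: fc'].
- by move=> x; apply: continuous_comp; [exact: gc'|exact: gc].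
- by move=> j w /fg[/fg'[h e] e'] /=; rewrite e.
- by move=> j w /gf'[/gf[h e] e'] /=; rewrite e.
Qed.

Lemma same_realization N K K' : same_sets K K' ->
  @realization R N K = @realization R N K'.
Proof.
move=> /andP[/allP KK' /allP K'K]; apply/seteqP; split=> w [t tK wt].
  by have /hasP[t' t'K /allP h] := KK' t tK; exists t' => //; apply: asimplexW wt.
by have /hasP[t' t'K /allP h] := K'K t tK; exists t' => //; apply: asimplexW wt.
Qed.

Lemma matchable_same N Ks Ks' : size Ks = size Ks' -> all2 same_sets Ks Ks' ->
  matchable N Ks Ks'.
Proof.
move=> sz h; exists idfun, idfun.
have E j : @realization R N (nth [::] Ks j) = @realization R N (nth [::] Ks' j).
  have [jK|jK] := ltnP j (size Ks); last by rewrite !nth_default // -sz.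
  apply: same_realization; move: h; rewrite all2E sz eqxx /= => /allP.
  move=> /(_ (nth [::] Ks j, nth [::] Ks' j)); apply.
  by rewrite -nth_zip // mem_nth // size_zip sz minnn -sz.
by split=> [||j w|j w]; rewrite ?E //; exact: continuous_idfun.
Qed.

Definition star_split (sigma : seq nat) (d : nat) (t : seq nat) : seq (seq nat) :=
  if all (mem t) sigma then [seq d :: rem v t | v <- sigma] else [:: t].

Definition stellar sigma d (K : seq (seq nat)) : seq (seq nat) :=
  flatten (map (star_split sigma d) K).

Variables (N : nat) (sigma : seq nat) (d : nat).

(** Weights in a simplex are at most 1, so the starting value 1 does not change the minimum over a
    nonempty [sigma]. *)
Definition least (w : 'rV[R]_N) : R :=
  foldr (fun (i : 'I_N) a => if (i : nat) \in sigma then Num.min (w 0 i) a else a) 1 (enum 'I_N).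

Lemma least_le w (i : 'I_N) : (i : nat) \in sigma -> least w <= w 0 i.
Proof.
move=> si; rewrite /least; have : i \in enum 'I_N by rewrite mem_enum.
elim: (enum _) => // j s IH; rewrite inE /= => /orP[/eqP<-|/IH h].
  by rewrite si ge_min lexx.
by case: ifP => // _; rewrite ge_min h orbT.
Qed.

Lemma least_eq w : least w = 1 \/ exists2 i : 'I_N, (i : nat) \in sigma & least w = w 0 i.
Proof.
rewrite /least; elim: (enum _) => [|j s IH] /=; first by left.
case: ifP => // sj; rewrite minEle; case: ifP => // _.
by right; exists j.
Qed.

Lemma continuous_least : continuous least.
Proof.
rewrite /least; elim: (enum _) => [|j s IH] /=; first exact: continuous_cst.
case: ((j : nat) \in sigma) => // x; apply: continuous_min; last exact: IH.
exact: (@coord_continuous R 1 N 0 j).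
Qed.

(** The homeomorphism onto the subdivision: the common part [least w] of the weights on [sigma] is
    moved to [d], which stands for the barycentre of [sigma]. This part is 0 on a simplex that does
    not contain [sigma], so one formula serves the whole complex. *)
Definition raise (w : 'rV[R]_N) : 'rV[R]_N :=
  \row_(i < N) (w 0 i + ((i == d :> nat) * size sigma)%:R * least w - ((i : nat) \in sigma)%:R * least w).

(** Sends [d] to the barycentre: its weight is spread evenly over [sigma]. *)
Definition lower (w : 'rV[R]_N) : 'rV[R]_N :=
  let a := \sum_(i < N | (i : nat) == d) w 0 i in
  \row_(i < N) (w 0 i + ((i : nat) \in sigma)%:R * (a / (size sigma)%:R) - (i == d :> nat)%:R * a).

Lemma continuous_raise : continuous raise.
Proof.
apply: continuous_row => i; under eq_fun do rewrite mxE -mulNr.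
by do !apply: continuous_add; do ?apply: continuous_mul; first [exact: continuous_cst|
  exact: continuous_least|exact: (@coord_continuous R 1 N 0 i)].
Qed.

Lemma continuous_lower : continuous lower.
Proof.
apply: continuous_row => i; under eq_fun do rewrite mxE -mulNr.
have ac : continuous (fun w : 'rV[R]_N => \sum_(i < N | (i : nat) == d) w 0 i).
  under eq_fun do rewrite -big_filter; apply: continuous_sum => j.
  exact: (@coord_continuous R 1 N 0 j).
by do !apply: continuous_add; do ?apply: continuous_mul; first [exact: continuous_cst|
  exact: ac|exact: (@coord_continuous R 1 N 0 i)].
Qed.

Hypotheses (dN : (d < N)%N) (sigma_uniq : uniq sigma) (sigma0 : (0 < size sigma)%N).
Hypotheses (sigmaN : all (gtn N) sigma) (dsigma : d \notin sigma).
Let o := Ordinal dN.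

Let lower_coef (w : 'rV[R]_N) : \sum_(i < N | (i : nat) == d) w 0 i = w 0 o.
Proof. by rewrite (big_pred1 o) // => i; rewrite -(inj_eq val_inj). Qed.

Let size_neq0 : (size sigma)%:R != 0 :> R.
Proof. by rewrite pnatr_eq0 -lt0n. Qed.

Let sum_sigma (a : R) : \sum_(i < N) ((i : nat) \in sigma)%:R * a = (size sigma)%:R * a.
Proof.
rewrite -mulr_suml -(@sum_seq_ord N _ (fun i => (i \in sigma)%:R) sigma) //.
  rewrite (eq_big_seq (fun=> 1)) => [|i ->] //.
  by rewrite big_const_seq count_predT iter_addr_0.
by move=> i /negbTE->.
Qed.

Let sum_d (a : R) : \sum_(i < N) (i == d :> nat)%:R * a = a.
Proof.
rewrite (bigD1 o) //= eqxx mul1r big1 ?addr0 // => i; rewrite -(inj_eq val_inj) /= => /negbTE->.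
by rewrite mul0r.
Qed.

Let least_ge0 t w : asimplex t w -> 0 <= least w.
Proof. by move=> [w0 _ _]; have [->|[i _ ->]] := least_eq w. Qed.

Let least_attained t w : asimplex t w -> exists2 i : 'I_N, (i : nat) \in sigma & least w = w 0 i.
Proof.
move=> [w0 w1 _]; have [e|//] := least_eq w.
have [v vs] : exists v, v \in sigma by case: (sigma) sigma0 => // v s _; exists v; rewrite inE eqxx.
have vN : (v < N)%N := allP sigmaN v vs.
exists (Ordinal vN) => //; apply/eqP; rewrite eq_le least_le //= e -w1.
by rewrite (bigD1 (Ordinal vN)) //= lerDl sumr_ge0.
Qed.

Let least0 t w : ~~ all (mem t) sigma -> asimplex t w -> least w = 0.
Proof.
move=> /allPn[v vs vt] wt; have vN : (v < N)%N := allP sigmaN v vs.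
have wv : w 0 (Ordinal vN) = 0 by have [_ _ ws] := wt; apply: contraNeq vt => /ws.
apply/eqP; rewrite eq_le (least_ge0 wt) andbT -wv.
exact: least_le.
Qed.

Let raise0 (w : 'rV[R]_N) : least w = 0 -> raise w = w.
Proof. by move=> e; apply/rowP => i; rewrite mxE e !mulr0 addr0 subr0. Qed.

Let lower0 (w : 'rV[R]_N) : w 0 o = 0 -> lower w = w.
Proof. by move=> e; apply/rowP => i; rewrite mxE lower_coef e mul0r !mulr0 addr0 subr0. Qed.

(** The vertex of [sigma] at which the minimum is attained loses all its weight, so the result lies
    in the simplex of the star that omits it. *)
Lemma raise_star t (w : 'rV[R]_N) : d \notin t -> asimplex t w -> 
  realization (star_split sigma d t) (raise w) /\ lower (raise w) = w.
Proof.
move=> dt wt; have [w0 w1 ws] := wt.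
have wd : w 0 o = 0 by apply: contraNeq dt => /ws.
split; last first.
  apply/rowP => i; rewrite mxE lower_coef !mxE eqxx mul1n (negbTE dsigma) mul0r subr0 wd add0r.
  rewrite mulrAC divff // mul1r natrM; ring.
rewrite /star_split; case: ifP => [/allP st|/negbT st]; last first.
  by rewrite (raise0 (least0 st wt)); exists t; rewrite ?inE.
have [v vs vE] := least_attained wt.
exists (d :: rem (v : nat) t); first exact: map_f vs.
split=> [i||i].
- rewrite mxE -addrA addrCA addr_ge0 // ?mulr_ge0 ?(least_ge0 wt) //.
  have [si|] := boolP ((i : nat) \in sigma); last by rewrite mul0r subr0.
  by rewrite mul1r subr_ge0 least_le.
- under eq_bigr do rewrite mxE natrM -mulrA.
  by rewrite sumrB big_split /= w1 sum_sigma sum_d addrK.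
rewrite mxE inE; have [//|id] := eqVneq (i : nat) d; rewrite mul0n mul0r addr0 /=.
have [e|iv] := eqVneq (i : nat) v.
  by rewrite (_ : i = v) ?vs ?mul1r ?vE ?subrr ?eqxx //; exact: val_inj.
have [si _|_] := boolP ((i : nat) \in sigma); first exact: (rem_mem iv (st _ si)).
by rewrite mul0r subr0 => /ws; exact: rem_mem.
Qed.

(** A simplex of the star omits some [v] of [sigma]. After [lower] the minimum over [sigma] is
    attained at [v] and equals the share received from [d], so [raise] takes back exactly that
    share. *)
Lemma lower_star t (w : 'rV[R]_N) : d \notin t -> uniq t -> realization (star_split sigma d t) w ->
  asimplex t (lower w) /\ raise (lower w) = w.
Proof.
move=> dt ut; rewrite /star_split; case: ifP => [/allP st|/negbT st] [t']; last first.
  rewrite inE => /eqP-> wt; have [w0 w1 ws] := wt.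
  have wd : w 0 o = 0 by apply: contraNeq dt => /ws.
  by rewrite lower0 // (raise0 (least0 st wt)).
move=> /mapP[v vs ->] wt; have [w0 w1 ws] := wt.
have wl : asimplex t (lower w).
  split=> [i||i].
  - rewrite mxE lower_coef; have [e|_] := eqVneq (i : nat) d.
      by rewrite e (negbTE dsigma) mul0r addr0 mul1r (_ : i = o) ?subrr //; apply: val_inj.
    by rewrite mul0r subr0 addr_ge0 ?mulr_ge0 ?invr_ge0.
  - under eq_bigr do rewrite mxE lower_coef.
    by rewrite sumrB big_split /= w1 sum_sigma sum_d mulrC divfK // addrK.
  rewrite mxE lower_coef; have [e|id] := eqVneq (i : nat) d.
    by rewrite e (negbTE dsigma) mul0r addr0 mul1r (_ : i = o) ?subrr ?eqxx //; apply: val_inj.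
  have [si _|_] := boolP ((i : nat) \in sigma); first exact: (st _ si).
  by rewrite !mul0r addr0 subr0 => /ws; rewrite inE (negbTE id) => /mem_rem.
split=> //; have vN : (v < N)%N := allP sigmaN v vs.
have wv : w 0 (Ordinal vN) = 0.
  apply: contraTeq isT => /ws; rewrite inE /= mem_rem_uniq // !inE eqxx orbF => /eqP e.
  by move: dsigma; rewrite -e vs.
have E : least (lower w) = w 0 o / (size sigma)%:R.
  have [i si iE] := least_attained wl.
  apply/eqP; rewrite eq_le; apply/andP; split.
    apply: le_trans (least_le _ (i := Ordinal vN) vs) _.
    rewrite mxE lower_coef wv vs mul1r add0r (_ : (v == d) = false) ?mul0r ?subr0 //.
    by apply: contraNF dsigma => /eqP<-.
  rewrite iE mxE lower_coef si mul1r (_ : ((i : nat) == d) = false).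
    by rewrite mul0r subr0 lerDr.
  by apply: contraNF dsigma => /eqP<-.
apply/rowP => i; rewrite mxE E mxE lower_coef natrM.
have bE : (size sigma)%:R * (w 0 o / (size sigma)%:R) = w 0 o by rewrite mulrC divfK.
by rewrite -[X in _ + X - _]mulrA bE; ring.
Qed.

Definition fresh (K : seq (seq nat)) : bool := all (fun t => uniq t && (d \notin t)) K.

Lemma matchable_stellar Ks : all fresh Ks -> matchable N Ks (map (stellar sigma d) Ks).
Proof.
move=> /allP fr; exists raise, lower.
have E j : nth [::] (map (stellar sigma d) Ks) j = stellar sigma d (nth [::] Ks j).
  have [jK|jK] := ltnP j (size Ks); first by rewrite (nth_map [::]).
  by rewrite !nth_default // size_map.
have F j t : t \in nth [::] Ks j -> uniq t /\ d \notin t.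
  have [jK|jK] := ltnP j (size Ks); last by rewrite nth_default.
  by move=> tK; have /allP/(_ t tK)/andP := fr _ (mem_nth [::] jK).
split; [exact: continuous_raise|exact: continuous_lower|move=> j w..].
  rewrite E => -[t tK wt]; have [ut dt] := F j t tK.
  have [[t' t't' wt'] e] := raise_star dt wt; split=> //.
  by exists t' => //; apply/flattenP; exists (star_split sigma d t) => //; exact: map_f.
rewrite E => -[t' /flattenP[_ /mapP[t tK ->] t't] wt']; have [ut dt] := F j t tK.
by have [] := @lower_star t w dt ut; [exists t'|move=> h e; split=> //; exists t].
Qed.

End Stellar.

(** * From the torus to a block with a tunnel *)

(** Candidate inverse of [stellar]: of the simplices of a star only the one omitting the first
    vertex of [sigma] is kept, with [d] replaced by this vertex. In each use [connected_by] checks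
    that subdividing the result gives back the original. *)
Definition weld (sigma : seq nat) (d : nat) (K : seq (seq nat)) : seq (seq nat) :=
  let h := head 0%N sigma in
  flatten [seq if d \in t then if h \in t then [::] else [:: h :: rem d t] else [:: t] | t <- K].

(* A move with [split = true] subdivides at [sigma] with the new vertex [d]; one
   with [split = false] undoes this. *)
Fixpoint connected_by (moves : seq (bool * seq nat * nat)) (Ks Ks' : seq (seq (seq nat))) : bool :=
  if moves is (split, sigma, d) :: moves' then
    let Ls := map ((if split then stellar else weld) sigma d) Ks in
    [&& uniq sigma, (0 < size sigma)%N, d \notin sigma,
        all (fresh d) (if split then Ks else Ls),
        split || (size Ks == size Ls) && all2 same_sets Ks (map (stellar sigma d) Ls)
      & connected_by moves' Ls Ks']
  else (size Ks == size Ks') && all2 same_sets Ks Ks'.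

Lemma connected_matchable (R : realType) N moves Ks Ks' :
  all (fun mv : bool * seq nat * nat => (mv.2 < N)%N && all (gtn N) mv.1.2) moves ->
  connected_by moves Ks Ks' -> matchable R N Ks Ks'.
Proof.
elim: moves Ks => [|[[split sigma] d] moves IH] Ks.
  by move=> _ /andP[/eqP]; exact: matchable_same.
case: split => /andP[/andP[dN sN] mN] /and5P[us s0 ds fr /andP[sp /(IH _ mN) h]].
  by apply: matchable_trans h; exact: matchable_stellar.
move: sp => /andP[/eqP sz sa]; apply: matchable_trans h.
apply: (@matchable_trans _ _ _ (map (stellar sigma d) (map (weld sigma d) Ks))).
  by apply: matchable_same; rewrite // !size_map.
by apply: matchable_sym; exact: matchable_stellar.
Qed.

(* A triangulation of the boundary of the box [0, 4] x [0, 3] x [0, 1] with the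
   tunnel ]1, 3[ x ]1, 2[ drilled through it; the two lists [box_left] and
   [box_right] cover the sides [x = 0] and [x = 4]. *)
Definition lx : seq int := [:: 0; 0; 0; 3; 4; 4; 4; 0; 4; 1; 1; 1; 1; 3; 3; 3].
Definition ly : seq int := [:: 0; 0; 3; 2; 0; 3; 3; 3; 0; 1; 2; 2; 1; 1; 2; 1].
Definition lz : seq int := [:: 0; 1; 0; 1; 1; 0; 1; 1; 0; 0; 0; 1; 1; 0; 0; 1].

Definition box_left : seq (seq nat) := [:: [:: 0; 1; 7]; [:: 0; 2; 7]]%N.
Definition box_right : seq (seq nat) := [:: [:: 4; 6; 8]; [:: 5; 6; 8]]%N.
Definition box_sides : seq (seq nat) :=
  [:: [:: 0; 1; 4]; [:: 0; 2; 9]; [:: 0; 4; 8]; [:: 0; 8; 13]; [:: 0; 9; 13];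
      [:: 1; 4; 15]; [:: 1; 7; 12]; [:: 1; 12; 15]; [:: 2; 5; 6]; [:: 2; 5; 10];
      [:: 2; 6; 7]; [:: 2; 9; 10]; [:: 3; 4; 6]; [:: 3; 4; 15]; [:: 3; 6; 11];
      [:: 3; 10; 11]; [:: 3; 10; 14]; [:: 3; 13; 14]; [:: 3; 13; 15]; [:: 5; 8; 14];
      [:: 5; 10; 14]; [:: 6; 7; 11]; [:: 7; 11; 12]; [:: 8; 13; 14]; [:: 9; 10; 11];
      [:: 9; 11; 12]; [:: 9; 12; 15]; [:: 9; 13; 15]]%N.

(** The label 16 is auxiliary: subdividing an edge at it and welding along the opposite diagonal
    flips the edge. There are ten such flips; the nine other moves each remove a vertex, leaving 7
    of the 16 vertices of the box. *)
Definition box_moves : seq (bool * seq nat * nat) :=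
  [:: (true, [:: 12; 15], 16); (false, [:: 1; 9], 16); (false, [:: 1; 11], 12);
      (true, [:: 10; 14], 16); (false, [:: 5; 3], 16); (false, [:: 8; 3], 14);
      (true, [:: 8; 13], 16); (false, [:: 0; 3], 16); (false, [:: 9; 3], 13);
      (false, [:: 1; 3], 15); (true, [:: 5; 10], 16); (false, [:: 2; 3], 16);
      (false, [:: 2; 11], 10); (true, [:: 8; 3], 16); (false, [:: 0; 5], 16);
      (false, [:: 5; 4], 8); (true, [:: 7; 11], 16); (false, [:: 1; 6], 16);
      (false, [:: 2; 1], 7); (true, [:: 1; 11], 16); (false, [:: 6; 9], 16);
      (true, [:: 2; 6], 16); (false, [:: 1; 5], 16); (false, [:: 2; 6], 11);
      (true, [:: 6; 3], 16); (false, [:: 2; 4], 16); (true, [:: 2; 9], 16);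
      (false, [:: 0; 6], 16); (false, [:: 6; 3], 9)]%N.

Lemma box_connected : connected_by box_moves [:: box_left; box_sides; box_right]
  [:: [:: [:: 0; 1; 2]]; block_sides; [:: [:: 4; 5; 6]]]%N.
Proof. by vm_compute. Qed.

Lemma box_matchable (R : realType) : matchable R 17
  [:: [:: [:: 0; 1; 2]]; block_sides; [:: [:: 4; 5; 6]]]%N
  [:: box_left; box_sides; box_right].
Proof. by apply: matchable_sym; exact: (connected_matchable (moves := box_moves) R (N := 17) isT box_connected). Qed.

Definition volb (p q r s : nat) : int :=
  let d (t : seq int) a := t`_a - t`_p in
  d lx q * (d ly r * d lz s - d lz r * d ly s)
  - d ly q * (d lx r * d lz s - d lz r * d lx s)
  + d lz q * (d lx r * d ly s - d ly r * d lx s).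

Definition evalb (f : int * int * int * int) (v : nat) : int :=
  let: (c, a, b, d) := f in c + a * lx`_v + b * ly`_v + d * lz`_v.

Definition box_planes : seq (int * int * int * int) :=
  [:: (0, 3, -4, 0); (1, 0, -1, 0); (1, 0, 0, -1); (3, -2, -1, 4); (0, 0, 0, 1);
      (2, 0, -1, 0); (7, -2, -1, 1); (1, -1, 0, 0); (4, -1, 0, 0); (0, 0, 1, -3);
      (3, -2, -1, 0); (5, 1, -3, -5); (1, -1, 1, -1); (3, -1, -1, 1); (8, -2, -1, 0);
      (0, 1, -3, -4); (0, 1, -1, -1); (2, -1, -1, 1); (9, 1, -3, -4); (3, -1, 0, 0);
      (0, 2, -1, -4); (0, 2, 1, -3); (4, -1, -1, -4)].

Definition separates_box f (t t' t0 : seq nat) : bool :=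
  [&& all (fun v => evalb f v <= 0) t, all (fun v => 0 <= evalb f v) t',
      all (fun v => (evalb f v == 0) ==> (v \in t0)) t &
      all (fun v => (evalb f v == 0) ==> (v \in t0)) t'].

(** Some vertex off the plane of the triangle, completing it to a tetrahedron that carries
    barycentric coordinates. *)
Definition apex (t : seq nat) : nat :=
  head 0%N [seq v <- iota 0 16 | volb (nth 0%N t 0) (nth 0%N t 1) (nth 0%N t 2) v != 0].

Definition box_tris := box_left ++ box_sides ++ box_right.

Lemma box_apex : all (fun t => (size t == 3) && uniq (rcons t (apex t)) &&
  (volb (nth 0 t 0) (nth 0 t 1) (nth 0 t 2) (apex t) != 0))%N box_tris.
Proof. by vm_compute. Qed.

Lemma box_separated : all (fun t => all (fun t' => if t == t' then true else
  let T := rcons t (apex t) in let T' := rcons t' (apex t') in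
  has (fun f => if separates_box f t t' T then true else separates_box f t t' T')
    (box_planes ++ map oppf box_planes)) box_tris) box_tris.
Proof. by vm_compute. Qed.

(** * The boundary of the block as a placed complex *)

Section BoxPlacement.
Variable R : realType.

Definition box_pt (v : nat) : 'rV[R]_3 := pt (lx`_v)%:~R (ly`_v)%:~R (lz`_v)%:~R.

Definition box_aff (f : int * int * int * int) : R * 'cV[R]_3 :=
  let: (c, a, b, d) := f in (c%:~R, col3 a%:~R b%:~R d%:~R).

Lemma aff_box f v : aff (box_aff f).1 (box_aff f).2 (box_pt v) = (evalb f v)%:~R.
Proof.
by case: f => [[[c a] b] d]; rewrite /= aff_col3 !ptE /evalb !(rmorphD, rmorphM).
Qed.

Lemma vol_box p q r s :
  vol (box_pt p) (box_pt q) (box_pt r) (box_pt s) = (volb p q r s)%:~R.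
Proof.
by rewrite /vol /box_pt /volb /= !ptE !(rmorphD, rmorphB, rmorphM, rmorphN).
Qed.

Lemma box_tri_coords t : t \in box_tris ->
  exists (c : nat -> R) (u : nat -> 'cV[R]_3), barycentric box_pt (rcons t (apex t)) c u.
Proof.
move=> tB; have /allP/(_ t tB)/andP[/andP[/eqP zt ut] v0] := box_apex.
case: t zt ut v0 {tB} => [|a [|b [|d []]]] // _; move: (apex _) => e ut /= v0.
have vol0 : vol (box_pt a) (box_pt b) (box_pt d) (box_pt e) != 0.
  by rewrite vol_box intr_eq0.
apply: (@nondegenerate_barycentric _ box_pt [:: a; b; d; e]
    [tuple box_pt (nth 0%N [:: a; b; d; e] j) | j < 4]).
- exact: ut.
- apply: (@eq_from_nth _ 0); first by rewrite size_tuple.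
  move=> j; rewrite size_tuple => j4.
  by rewrite -(tnth_nth _ _ (Ordinal j4)) tnth_mktuple -(nth_map 0%N 0).
- exact/nondegenerate_vol.
Qed.

Lemma box_inj (w w' : 'rV[R]_17) : realization box_tris w -> realization box_tris w' ->
  place box_pt w = place box_pt w' -> w = w'.
Proof.
have coord0 (s s' : seq nat) (f : int * int * int * int) : 
    all (fun v => (evalb f v == 0) ==> (v \in s')) s ->
    {in s, forall v, aff (box_aff f).1 (box_aff f).2 (box_pt v) = 0 -> v \in s'}.
  move=> /allP h v vs; rewrite aff_box => /eqP; rewrite intr_eq0.
  by have /implyP := h v vs.
move=> [t tB wt] [t' t'B w't'] e.
have /allP/(_ t tB)/allP/(_ t' t'B) := box_separated.
case: ifP => [/eqP E _|_ /hasP[f _]].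
  have [c [u cu]] := box_tri_coords tB; rewrite -E in w't'.
  have sub : {subset t <= rcons t (apex t)} by move=> v vt; rewrite mem_rcons inE vt orbT.
  exact: (place_inj cu (asimplexW sub wt) (asimplexW sub w't')).
suff h T : T \in box_tris -> separates_box f t t' (rcons T (apex T)) -> w = w'.
  by case: ifP => [s _|_ s]; [exact: (h t tB s)|exact: (h t' t'B s)].
move=> TB /and4P[/allP f1 /allP f2 f3 f4]; have [c [u cu]] := box_tri_coords TB.
apply: (place_inj_sep (c := (box_aff f).1) (u := (box_aff f).2) cu) wt w't' e.
- by move=> v /f1; rewrite aff_box lerz0.
- by move=> v /f2; rewrite aff_box ler0z.
- exact: coord0.
- exact: coord0.
Qed.

Definition cross (i j : 'I_3) (A B D : 'rV[R]_3) : R :=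
  (B 0 i - A 0 i) * (D 0 j - A 0 j) - (B 0 j - A 0 j) * (D 0 i - A 0 i).

(** For a triangle parallel to a coordinate plane the barycentric coordinates are ratios of signed
    areas in that plane; the sign conditions multiply by the total area instead of dividing, which
    keeps them polynomial. *)
Lemma hull_flat (i j : 'I_3) (A B D p : 'rV[R]_3) :
  (forall l, [\/ l = i, l = j | [/\ A 0 l = p 0 l, B 0 l = p 0 l & D 0 l = p 0 l]]) ->
  let c := cross i j in c A B D != 0 ->
  0 <= c p B D * c A B D -> 0 <= c A p D * c A B D -> 0 <= c A B p * c A B D ->
  hull [:: A; B; D] p.
Proof.
move=> flat /=; set d := cross _ _ A B D => d0 a0 b0 c0; apply/hull3.
have d2 : 0 < d ^+ 2 by rewrite exprn_even_gt0.
have pos x : 0 <= x * d -> 0 <= x / d.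
  move=> xd; have <- : x * d / d ^+ 2 = x / d by rewrite expr2 invfM mulrA mulfK.
  by rewrite divr_ge0 // ltW.
have dE : cross i j p B D + cross i j A p D + cross i j A B p = d.
  by rewrite /d /cross; ring.
exists (cross i j p B D / d), (cross i j A p D / d), (cross i j A B p / d); split.
- exact: pos.
- exact: pos.
- exact: pos.
- by rewrite -!mulrDl dE divff.
apply/rowP => l; rewrite !mxE; apply: (mulIf d0); rewrite !mulrDl.
rewrite ![_ / d * _ * d]mulrAC ![_ / d * d]divfK //.
have [->|->|[-> -> ->]] := flat l; last by rewrite -!mulrDl dE mulrC.
- by rewrite /d /cross; ring.
- by rewrite /d /cross; ring.
Qed.

End BoxPlacement.

Section BoxBoundary.
Variable R : realType.
Let pos := @box_pt R.
Definition over (K : seq (seq nat)) : set 'rV[R]_3 := place pos @` @realization R 17 K.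

(* The sides of the drilled block other than [x = 0] and [x = 4]. *)
Definition box_wall (x y z : R) : Prop :=
  [/\ 0 <= x <= 4, 0 <= y <= 3, 0 <= z <= 1,
      [\/ x <= 1, 3 <= x, y <= 1 | 2 <= y]
    & [\/ y = 0 \/ y = 3, z = 0, z = 1 | 1 <= x <= 3 /\ 1 <= y <= 2]].

(** Convex pieces of the walls, so that a triangle lies in a piece as soon as its vertices do: four
    around the hole for each of [z = 0] and [z = 1], one for each of [y = 0] and [y = 3], and the
    four sides of the tunnel. *)
Definition wall_pieces : seq (seq (int * int * int * int)) :=
  let X0 := (0, 1, 0, 0) in let X4 := (4, -1, 0, 0) in
  let Y0 := (0, 0, 1, 0) in let Y3 := (3, 0, -1, 0) in
  let Z0 := (0, 0, 0, 1) in let Z1 := (1, 0, 0, -1) in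
  let box := [:: X0; X4; Y0; Y3; Z0; Z1] in
  let X1 := (1, -1, 0, 0) in let X3 := (-3, 1, 0, 0) in
  let Y1 := (1, 0, -1, 0) in let Y2 := (-2, 0, 1, 0) in
  let X1' := oppf X1 in let X3' := oppf X3 in
  let Y1' := oppf Y1 in let Y2' := oppf Y2 in
  map (fun p => p ++ box) ([seq [:: Z; C] | Z <- [:: oppf Z0; oppf Z1], C <- [:: X1; X3; Y1; Y2]]
    ++ [:: [:: oppf Y0; Y1]; [:: oppf Y3; Y2];
           [:: X1; X1'; Y1'; Y2']; [:: X3; X3'; Y1'; Y2'];
           [:: Y1; Y1'; X1'; X3']; [:: Y2; Y2'; X1'; X3']]).

Lemma box_sides_pieces : all (fun t => has (all (fun f => all (fun v => 0 <= evalb f v) t))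
  wall_pieces) box_sides.
Proof. by vm_compute. Qed.

Lemma over_ge0 t f x : all (fun v => 0 <= evalb f v) t -> over [:: t] x ->
  0 <= aff (box_aff R f).1 (box_aff R f).2 x.
Proof.
move=> /allP h [w [t' + wt] <-]; rewrite inE => /eqP tE; rewrite {}tE in wt.
by apply: (aff_place_ge0 wt) => v /h; rewrite aff_box ler0z.
Qed.

Lemma over_mem K x : over K x <-> exists2 t, t \in K & over [:: t] x.
Proof.
split=> [[w [t tK wt] <-]|[t tK [w [t' + wt] <-]]].
  by exists t => //; exists w => //; exists t; rewrite ?inE.
by rewrite inE => /eqP tE; rewrite tE in wt; exists w => //; exists t.
Qed.

Lemma box_sides_wall x : over box_sides x -> box_wall (x 0 0) (x 0 1) (x 0 2).
Proof.
move=> /over_mem[t tK xt]; have /allP/(_ t tK)/hasP[P PW /allP h] := box_sides_pieces.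
have {}h f : f \in P -> 0 <= aff (box_aff R f).1 (box_aff R f).2 x.
  by move=> fP; exact: over_ge0 (h f fP) xt.
rewrite /box_wall.
have E f : aff (box_aff R f).1 (box_aff R f).2 x =
    let: (c, a, b, d) := f in
    c%:~R + a%:~R * x 0 0 + b%:~R * x 0 1 + d%:~R * x 0 2.
  by case: f => [[[c a] b] d]; rewrite /= aff_col3.
have {}h : all (fun f => let: (c, a, b, d) := f in
    0 <= c%:~R + a%:~R * x 0 0 + b%:~R * x 0 1 + d%:~R * x 0 2) P.
  by apply/allP => f /h; rewrite E; case: f => [[[c a] b] d].
have : has (all (fun f : int * int * int * int => let: (c, a, b, d) := f in
    0 <= c%:~R + a%:~R * x 0 0 + b%:~R * x 0 1 + d%:~R * x 0 2)) wall_pieces.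
  by apply/hasP; exists P.
move: (x 0 0) (x 0 1) (x 0 2) => {x xt h P PW E} x y z.
rewrite /wall_pieces /= !andbT.
by repeat (case/orP); last done; do !case/andP; move=> *;
  (split; [apply/andP; split; lra|apply/andP; split; lra|apply/andP; split; lra|
    first [by constructor 1; lra|by constructor 2; lra|by constructor 3; lra|by constructor 4; lra]|
    first [by constructor 1; left; lra|by constructor 1; right; lra|by constructor 2; lra|
           by constructor 3; lra|by constructor 4; split; apply/andP; split; lra]]).
Qed.

End BoxBoundary.

Section BoxCover.
Variable R : realType.

Lemma over_flat (K : seq (seq nat)) (i j : 'I_3) (a b d : nat) (x : 'rV[R]_3) :
  let A := @box_pt R a in let B := box_pt R b in let D := box_pt R d in
  let c := cross i j in
  [:: a; b; d] \in K -> uniq [:: a; b; d] -> all (gtn 17) [:: a; b; d] ->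
  (forall l, [\/ l = i, l = j | [/\ A 0 l = x 0 l, B 0 l = x 0 l & D 0 l = x 0 l]]) ->
  c A B D != 0 ->
  0 <= c x B D * c A B D -> 0 <= c A x D * c A B D -> 0 <= c A B x * c A B D ->
  over K x.
Proof.
move=> A B D c tK ut t17 flat d0 a0 b0 c0; apply/over_mem; exists [:: a; b; d] => //.
have := hull_flat flat d0 a0 b0 c0.
rewrite -[X in hull X]/(map (box_pt R) [:: a; b; d]) (hull_place _ ut t17) => -[w wt <-].
by exists w => //; exists [:: a; b; d]; rewrite ?inE.
Qed.

Lemma flat_x (A B D x : 'rV[R]_3) a : A 0 0 = a -> B 0 0 = a -> D 0 0 = a -> x 0 0 = a ->
  forall l : 'I_3, [\/ l = 1, l = 2 | [/\ A 0 l = x 0 l, B 0 l = x 0 l & D 0 l = x 0 l]].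
Proof.
move=> eA eB eD ex; case=> [[|[|[|//]]]] l3.
- by constructor 3; rewrite (_ : Ordinal l3 = 0) ?eA ?eB ?eD ?ex //; apply: val_inj.
- by constructor 1; apply: val_inj.
- by constructor 2; apply: val_inj.
Qed.

Lemma flat_y (A B D x : 'rV[R]_3) a : A 0 1 = a -> B 0 1 = a -> D 0 1 = a -> x 0 1 = a ->
  forall l : 'I_3, [\/ l = 0, l = 2 | [/\ A 0 l = x 0 l, B 0 l = x 0 l & D 0 l = x 0 l]].
Proof.
move=> eA eB eD ex; case=> [[|[|[|//]]]] l3.
- by constructor 1; apply: val_inj.
- by constructor 3; rewrite (_ : Ordinal l3 = 1) ?eA ?eB ?eD ?ex //; apply: val_inj.
- by constructor 2; apply: val_inj.
Qed.

Lemma flat_z (A B D x : 'rV[R]_3) a : A 0 2 = a -> B 0 2 = a -> D 0 2 = a -> x 0 2 = a ->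
  forall l : 'I_3, [\/ l = 0, l = 1 | [/\ A 0 l = x 0 l, B 0 l = x 0 l & D 0 l = x 0 l]].
Proof.
move=> eA eB eD ex; case=> [[|[|[|//]]]] l3.
- by constructor 1; apply: val_inj.
- by constructor 2; apply: val_inj.
- by constructor 3; rewrite (_ : Ordinal l3 = 2) ?eA ?eB ?eD ?ex //; apply: val_inj.
Qed.

Definition side (s t : seq int) (a b : nat) (x y : R) : R :=
  ((s`_b)%:~R - (s`_a)%:~R) * (y - (t`_a)%:~R) - ((t`_b)%:~R - (t`_a)%:~R) * (x - (s`_a)%:~R).

Definition over_tri (s t : seq int) (a b d : nat) (x y : R) : Prop :=
  let o := (s`_b - s`_a) * (t`_d - t`_a) - (t`_b - t`_a) * (s`_d - s`_a) in
  o != 0 /\ [/\ 0 <= side s t b d x y * o%:~R, 0 <= side s t d a x y * o%:~R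
    & 0 <= side s t a b x y * o%:~R].

Let over_plane (i j : 'I_3) (K : seq (seq nat)) (s t : seq int) (a b d : nat) (p : 'rV[R]_3) :
  (forall v, box_pt R v 0 i = (s`_v)%:~R /\ box_pt R v 0 j = (t`_v)%:~R) ->
  [:: a; b; d] \in K -> uniq [:: a; b; d] -> all (gtn 17) [:: a; b; d] ->
  (forall l, [\/ l = i, l = j |
    [/\ box_pt R a 0 l = p 0 l, box_pt R b 0 l = p 0 l & box_pt R d 0 l = p 0 l]]) ->
  over_tri s t a b d (p 0 i) (p 0 j) -> over K p.
Proof.
move=> c tK ut t17 flat [o0 [h1 h2 h3]].
have E v := (c v).1; have F v := (c v).2.
have oE : cross i j (box_pt R a) (box_pt R b) (box_pt R d) =
    ((s`_b - s`_a) * (t`_d - t`_a) - (t`_b - t`_a) * (s`_d - s`_a))%:~R.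
  by rewrite /cross !E !F !(rmorphB, rmorphM).
apply: (over_flat tK ut t17 flat); rewrite oE ?intr_eq0 //.
- by apply: le_trans h1 _; rewrite le_eqVlt; apply/orP; left; apply/eqP; congr (_ * _);
    rewrite /cross /side !E !F; ring.
- by apply: le_trans h2 _; rewrite le_eqVlt; apply/orP; left; apply/eqP; congr (_ * _);
    rewrite /cross /side !E !F; ring.
- by apply: le_trans h3 _; rewrite le_eqVlt; apply/orP; left; apply/eqP; congr (_ * _);
    rewrite /cross /side !E !F; ring.
Qed.

Lemma over_x K a b d x y z : [:: a; b; d] \in K -> uniq [:: a; b; d] ->
  all (gtn 17) [:: a; b; d] -> (lx`_b == lx`_a) && (lx`_d == lx`_a) -> x = (lx`_a)%:~R ->
  over_tri ly lz a b d y z -> over K (pt x y z).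
Proof.
move=> tK ut t17 /andP[/eqP e1 /eqP e2] xE h.
apply: (@over_plane 1 2 K ly lz a b d) => //; last by rewrite !ptE.
  by move=> v; rewrite !ptE.
by apply: (@flat_x _ _ _ _ x); rewrite !ptE ?e1 ?e2.
Qed.

Lemma over_y K a b d x y z : [:: a; b; d] \in K -> uniq [:: a; b; d] ->
  all (gtn 17) [:: a; b; d] -> (ly`_b == ly`_a) && (ly`_d == ly`_a) -> y = (ly`_a)%:~R ->
  over_tri lx lz a b d x z -> over K (pt x y z).
Proof.
move=> tK ut t17 /andP[/eqP e1 /eqP e2] yE h.
apply: (@over_plane 0 2 K lx lz a b d) => //; last by rewrite !ptE.
  by move=> v; rewrite !ptE.
by apply: (@flat_y _ _ _ _ y); rewrite !ptE ?e1 ?e2.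
Qed.

Lemma over_z K a b d x y z : [:: a; b; d] \in K -> uniq [:: a; b; d] ->
  all (gtn 17) [:: a; b; d] -> (lz`_b == lz`_a) && (lz`_d == lz`_a) -> z = (lz`_a)%:~R ->
  over_tri lx ly a b d x y -> over K (pt x y z).
Proof.
move=> tK ut t17 /andP[/eqP e1 /eqP e2] zE h.
apply: (@over_plane 0 1 K lx ly a b d) => //; last by rewrite !ptE.
  by move=> v; rewrite !ptE.
by apply: (@flat_z _ _ _ _ z); rewrite !ptE ?e1 ?e2.
Qed.

Ltac cover lem a b d := apply: (lem _ a b d);
  [by []|by []|by []|by []|by []|split; [by []|rewrite /side /=; split; lra]].

Lemma pt_eta (x : 'rV[R]_3) : x = pt (x 0 0) (x 0 1) (x 0 2).
Proof.
by apply/rowP => -[[|[|[|//]]] l3]; rewrite mxE /=; congr (x _ _); apply: val_inj.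
Qed.

(** The rectangle with a hole is cut into four trapezoids along the segments joining its corners to
    the nearest corners of the hole. *)
Lemma annulus_cover (P : Prop) (x y : R) : 0 <= x <= 4 -> 0 <= y <= 3 ->
  [\/ x <= 1, 3 <= x, y <= 1 | 2 <= y] ->
  (y <= 1 -> y <= x -> x + y <= 4 -> P) -> (x <= 1 -> x <= y -> x + y <= 3 -> P) ->
  (2 <= y -> 3 <= x + y -> x <= y + 1 -> P) -> (3 <= x -> 4 <= x + y -> y + 1 <= x -> P) -> P.
Proof.
move=> /andP[x0 x4] /andP[y0 y3] h bot left top right; case: h => h.
- have [xy|xy] := lerP x y; last by apply: bot; lra.
  by have [s|s] := lerP (x + y) 3; [apply: left; lra|apply: top; lra].
- have [s|s] := lerP (x + y) 4; first by apply: bot; lra.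
  by have [xy|xy] := lerP x (y + 1); [apply: top; lra|apply: right; lra].
- have [xy|xy] := lerP x y; first by apply: left; lra.
  by have [s|s] := lerP (x + y) 4; [apply: bot; lra|apply: right; lra].
- have [s|s] := lerP (x + y) 3; first by apply: left; lra.
  by have [xy|xy] := lerP x (y + 1); [apply: top; lra|apply: right; lra].
Qed.

Lemma wall_box_sides (x y z : R) : box_wall x y z -> over box_sides (pt x y z).
Proof.
move=> [X Y Z hole [[->|->]|zE|zE|[X13 Y12]]].
- move: X Z => {hole Y} /andP[? ?] /andP[? ?].
  by have [?|?] := lerP x (4 * z); [cover @over_y 0%N 1%N 4%N|cover @over_y 0%N 4%N 8%N].
- move: X Z => {hole Y} /andP[? ?] /andP[? ?].
  by have [?|?] := lerP x (4 * z); [cover @over_y 2%N 6%N 7%N|cover @over_y 2%N 5%N 6%N].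
- rewrite {z}zE in Z *; move: (X) (Y) => {Z} /andP[? ?] /andP[? ?].
  apply: (annulus_cover X Y hole) => {X Y hole} ? ? ?.
  (* Each trapezoid is cut by one diagonal into two triangles of [box_sides]. *)
  + by have [?|?] := lerP x (3 * y); [cover @over_z 0%N 9%N 13%N|cover @over_z 0%N 8%N 13%N].
  + by have [?|?] := lerP y (3 - 2 * x); [cover @over_z 0%N 2%N 9%N|cover @over_z 2%N 9%N 10%N].
  + by have [?|?] := lerP (3 * y) (x + 5); [cover @over_z 5%N 10%N 14%N|cover @over_z 2%N 5%N 10%N].
  + by have [?|?] := lerP (2 * x) (8 - y); [cover @over_z 8%N 13%N 14%N|cover @over_z 5%N 8%N 14%N].
- rewrite {z}zE in Z *; move: (X) (Y) => {Z} /andP[? ?] /andP[? ?].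
  apply: (annulus_cover X Y hole) => {X Y hole} ? ? ?.
  + by have [?|?] := lerP x (3 * y); [cover @over_z 1%N 12%N 15%N|cover @over_z 1%N 4%N 15%N].
  + by have [?|?] := lerP y (3 - 2 * x); [cover @over_z 1%N 7%N 12%N|cover @over_z 7%N 11%N 12%N].
  + by have [?|?] := lerP (3 * y) (x + 5); [cover @over_z 3%N 6%N 11%N|cover @over_z 6%N 7%N 11%N].
  + by have [?|?] := lerP (2 * x) (8 - y); [cover @over_z 3%N 4%N 15%N|cover @over_z 3%N 4%N 6%N].
move: X13 Y12 Z => /andP[? ?] /andP[? ?] /andP[? ?].
case: hole => {X Y} ?.
- have -> : x = 1 by lra.
  by have [?|?] := lerP z (y - 1); [cover @over_x 9%N 10%N 11%N|cover @over_x 9%N 11%N 12%N].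
- have -> : x = 3 by lra.
  by have [?|?] := lerP z (y - 1); [cover @over_x 3%N 13%N 14%N|cover @over_x 3%N 13%N 15%N].
- have -> : y = 1 by lra.
  by have [?|?] := lerP (2 * z) (x - 1); [cover @over_y 9%N 13%N 15%N|cover @over_y 9%N 12%N 15%N].
- have -> : y = 2 by lra.
  by have [?|?] := lerP (2 * z) (x - 1); [cover @over_y 3%N 10%N 14%N|cover @over_y 3%N 10%N 11%N].
Qed.

Definition box_end (a x y z : R) : Prop := [/\ x = a, 0 <= y <= 3 & 0 <= z <= 1].

Lemma over_left x : over box_left x <-> box_end 0 (x 0 0) (x 0 1) (x 0 2).
Proof.
split=> [/over_mem[t tK xt]|[xE /andP[? ?] /andP[? ?]]]; last first.
  by rewrite (pt_eta x) xE; have [?|?] := lerP (x 0 1) (3 * x 0 2);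
    [cover @over_x 0%N 1%N 7%N|cover @over_x 0%N 2%N 7%N].
have ge0 c a b d : all (fun v => 0 <= evalb (c, a, b, d) v) [:: 0; 1; 2; 7]%N ->
    0 <= c%:~R + a%:~R * x 0 0 + b%:~R * x 0 1 + d%:~R * x 0 2.
  move=> h; rewrite -aff_col3; apply: (over_ge0 (f := (c, a, b, d))) xt.
  apply/allP => v vt; apply: (allP h); move: vt.
  by move: tK; rewrite !inE => /orP[]/eqP->; rewrite !inE => /or3P[]/eqP->.
have := ge0 0 1 0 0 isT; have := ge0 0 (-1) 0 0 isT; have := ge0 0 0 1 0 isT.
have := ge0 3 0 (-1) 0 isT; have := ge0 0 0 0 1 isT; have := ge0 1 0 0 (-1) isT.
by move: (x 0 0) (x 0 1) (x 0 2) => a b d *; split; [lra|apply/andP; split; lra..].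
Qed.

Lemma over_right x : over box_right x <-> box_end 4 (x 0 0) (x 0 1) (x 0 2).
Proof.
split=> [/over_mem[t tK xt]|[xE /andP[? ?] /andP[? ?]]]; last first.
  by rewrite (pt_eta x) xE; have [?|?] := lerP (x 0 1) (3 * x 0 2);
    [cover @over_x 4%N 6%N 8%N|cover @over_x 5%N 6%N 8%N].
have ge0 c a b d : all (fun v => 0 <= evalb (c, a, b, d) v) [:: 4; 5; 6; 8]%N ->
    0 <= c%:~R + a%:~R * x 0 0 + b%:~R * x 0 1 + d%:~R * x 0 2.
  move=> h; rewrite -aff_col3; apply: (over_ge0 (f := (c, a, b, d))) xt.
  apply/allP => v vt; apply: (allP h); move: vt.
  by move: tK; rewrite !inE => /orP[]/eqP->; rewrite !inE => /or3P[]/eqP->.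
have := ge0 4 (-1) 0 0 isT; have := ge0 (-4) 1 0 0 isT; have := ge0 0 0 1 0 isT.
have := ge0 3 0 (-1) 0 isT; have := ge0 0 0 0 1 isT; have := ge0 1 0 0 (-1) isT.
by move: (x 0 0) (x 0 1) (x 0 2) => a b d *; split; [lra|apply/andP; split; lra..].
Qed.

End BoxCover.

Section BlockOntoBox.
Variable R : realType.

(** The one pair of maps of [box_matchable] respects the walls and both ends at once, so the two
    gates go to the two ends of the block. *)
Lemma block_onto_box : exists g : 'rV[R]_17 -> 'rV[R]_3,
  [/\ continuous g,
      forall w w', realization block_tris w -> realization block_tris w' ->
        g w = g w' -> w = w',
      g @` realization block_sides = [set x | box_wall (x 0 0) (x 0 1) (x 0 2)],
      g @` realization [:: [:: 0; 1; 2]%N] = [set x | box_end 0 (x 0 0) (x 0 1) (x 0 2)]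
    & g @` realization [:: [:: 4; 5; 6]%N] = [set x | box_end 4 (x 0 0) (x 0 1) (x 0 2)]].
Proof.
have [f [f' [fc fc' ff' f'f]]] := box_matchable R.
have sub (w : 'rV[R]_17) : realization block_tris w -> exists j : nat,
    realization (nth [::] [:: [:: [:: 0; 1; 2]]; block_sides; [:: [:: 4; 5; 6]]]%N j) w.
  move=> [t]; rewrite /block_tris mem_cat => /orP[tB|]; last rewrite !inE => /orP[]/eqP->; move=> wt.
  - by exists 1%N; exists t => //; exact: tB.
  - by exists 0%N; exists [:: 0; 1; 2]%N => //; exact: mem_head.
  - by exists 2%N; exists [:: 4; 5; 6]%N => //; exact: mem_head.
have sub' j (w : 'rV[R]_17) : realization (nth [::] [:: box_left; box_sides; box_right] j) w ->
    realization box_tris w.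
  move=> [t tK wt]; exists t => //; rewrite /box_tris !mem_cat; move: tK.
  by case: j => [|[|[|j]]] => [->|->|->|]; rewrite ?orbT // nth_default.
have im j : (place (box_pt R) \o f) @`
      realization (nth [::] [:: [:: [:: 0; 1; 2]]; block_sides; [:: [:: 4; 5; 6]]]%N j) =
    over (nth [::] [:: box_left; box_sides; box_right] j).
  apply/seteqP; split=> [_ [w /ff'[h _] <-]|_ [w /f'f[h e] <-]]; first by exists (f w).
  by exists (f' w); rewrite //= e.
exists (place (box_pt R) \o f); split.
- move=> x; apply: continuous_comp; [exact: fc|exact: continuous_place].
- move=> w w' /sub[j wj] /sub[j' wj'] /= e.
  have [fw ew] := ff' _ _ wj; have [fw' ew'] := ff' _ _ wj'.
  by rewrite -ew -ew' (box_inj (sub' _ _ fw) (sub' _ _ fw') e).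
- rewrite (im 1%N) /=; apply/seteqP; split=> x /=; first exact: box_sides_wall.
  by rewrite [x in over _ x]pt_eta; exact: wall_box_sides.
- by rewrite (im 0%N) /=; apply/seteqP; split=> x /over_left.
- by rewrite (im 2%N) /=; apply/seteqP; split=> x /over_right.
Qed.

End BlockOntoBox.

(** * Unfolding the chain *)

(** An automorphism of the block exchanging its two gates (see [local_sides]). Applied in blocks of
    odd index, it makes each gate the same end for both blocks that contain it. *)
Definition flip (r : nat) : nat := if r == 3%N then 3%N else if (r < 3)%N then (r + 4)%N else (r - 4)%N.

Definition local i r := if odd i then flip r else r.

(* Folds the chain onto its first block, turning every other block over. *)
Definition fold (v : nat) : nat := if odd (v %/ 4) && (v %% 4 < 3)%N then (v %% 4 + 4)%N else (v %% 4)%N.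

(** A gate label belongs to two blocks; turning over the odd one makes both local labels agree, so
    [fold] does not depend on the block. *)
Lemma fold_block i r : (r < 7)%N -> fold (4 * i + r) = local i r.
Proof.
have E s t : (t < 4)%N -> ((4 * s + t) %/ 4 = s)%N /\ ((4 * s + t) %% 4 = t)%N by lia.
move=> r7; rewrite /fold /local; have [r4|r4] := ltnP r 4.
  have [-> ->] := E i r r4; case: (odd i) => //=.
  by case: r r4 {r7} => [|[|[|[|]]]].
have -> : (4 * i + r = 4 * i.+1 + (r - 4))%N by lia.
have [|-> ->] := E i.+1 (r - 4)%N; first by lia.
rewrite oddS; case: (odd i) => /=.
  by case: r r4 r7 => [|[|[|[|[|[|[|]]]]]]].
by case: r r4 r7 => [|[|[|[|[|[|[|]]]]]]].
Qed.

Lemma fold_lt v : (fold v < 17)%N.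
Proof. by rewrite /fold; case: ifP; lia. Qed.

Lemma local_lt i r : (r < 7)%N -> (local i r < 7)%N.
Proof. by rewrite /local; case: (odd i) => //; case: r => [|[|[|[|[|[|[|]]]]]]]. Qed.

Lemma localK i r : (r < 7)%N -> local i (local i r) = r.
Proof. by rewrite /local; case: (odd i) => //; case: r => [|[|[|[|[|[|[|]]]]]]]. Qed.

Lemma local_sides i b : b \in block_sides ->
  exists2 b', b' \in block_sides & {subset map (local i) b <= b'}.
Proof.
have [h0 h1] : all (fun b => has (fun b' => all (mem b') (map (local 0) b)) block_sides) block_sides /\
  all (fun b => has (fun b' => all (mem b') (map (local 1) b)) block_sides) block_sides.
  by split; vm_compute.
have -> : map (local i) b = map (local (odd i)) b.
  by apply: eq_map => r; rewrite /local; case: (odd i).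
by move=> bB; case: (odd i);
  [have /hasP[b' b'B /allP h] := allP h1 b bB|have /hasP[b' b'B /allP h] := allP h0 b bB];
  exists b'.
Qed.

Section Fold.
Variables (R : realType) (N : nat).

Definition supported i (w : 'rV[R]_N) := forall v : 'I_N, w 0 v != 0 -> (4 * i <= v < 4 * i + 7)%N.

(** Push-forward of weights along [fold], into the 17 labels used by the moves to the box. It is
    injective only on the weights of one block ([foldw_inj]), so the block has to be remembered
    separately. *)
Definition foldw (w : 'rV[R]_N) : 'rV[R]_17 := \row_(r < 17) \sum_(v < N | fold v == r) w 0 v.

Lemma continuous_foldw : continuous foldw.
Proof.
apply: continuous_row => r; under eq_fun do rewrite mxE -big_filter.
by apply: continuous_sum => v; exact: (@coord_continuous R 1 N 0 v).
Qed.

Lemma sum_foldw w : \sum_r foldw w 0 r = \sum_v w 0 v.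
Proof.
under eq_bigr do rewrite mxE.
rewrite [RHS](partition_big (fun v : 'I_N => Ordinal (fold_lt v)) xpredT) //; exact: eq_bigr.
Qed.

Lemma asimplex_shift i b w : {in b, forall r, (r < 7)%N} -> asimplex (shift i b) w ->
  supported i w /\ asimplex (map (local i) b) (foldw w).
Proof.
move=> b7 [w0 w1 ws]; split=> [v /ws/mapP[r /b7 r7 ->]|]; first by lia.
split=> [r||r].
- by rewrite mxE sumr_ge0.
- by rewrite sum_foldw.
rewrite mxE => nz; have [v /andP[/eqP vr wv]] : exists v : 'I_N, (fold v == r) && (w 0 v != 0).
  apply/existsP; apply: contraNT nz; rewrite negb_exists => /forallP h.
  by rewrite big1 // => v vr; have := h v; rewrite vr negbK => /eqP.
have /mapP[s sb vE] := ws v wv.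
by rewrite -vr vE fold_block ?b7 //; apply: map_f.
Qed.

Lemma foldw_local i w r (v : 'I_N) (q : 'I_17) : supported i w -> (r < 7)%N ->
  v = (4 * i + r)%N :> nat -> q = local i r :> nat -> foldw w 0 q = w 0 v.
Proof.
move=> sw r7 vE qE; rewrite mxE (bigD1 v) /=; last by rewrite vE fold_block // qE.
rewrite big1 ?addr0 // => u /andP[/eqP fu uv].
apply/eqP; apply: contraNT uv => /sw /andP[u1 u2]; apply/eqP/val_inj => /=.
have uE : u = (4 * i + (u - 4 * i))%N :> nat by rewrite subnKC.
have u7 : (u - 4 * i < 7)%N by lia.
rewrite vE uE; congr (_ + _)%N; rewrite -(localK i u7) -(localK i r7); congr local.
by rewrite -fold_block // -uE fu.
Qed.

Lemma foldw_supp i w r : supported i w -> (r < 17)%N -> (7 <= r)%N -> 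
  forall q : 'I_17, q = r :> nat -> foldw w 0 q = 0.
Proof.
move=> sw r17 r7 q qr; rewrite mxE big1 // => v /eqP vq.
apply/eqP; apply: contraTT r7 => /sw /andP[v1 v2].
rewrite -ltnNge -qr -vq -(subnKC v1) fold_block; last by lia.
by rewrite local_lt //; lia.
Qed.

Lemma foldw_inj i w w' : supported i w -> supported i w' -> foldw w = foldw w' -> w = w'.
Proof.
move=> sw sw' e; apply/rowP => v.
have [/andP[v1 v2]|out] := boolP (4 * i <= v < 4 * i + 7)%N; last first.
  have -> : w 0 v = 0 by apply: contraNeq out => /sw.
  by apply/esym; apply: contraNeq out => /sw'.
have v7 : (v - 4 * i < 7)%N by lia.
have q17 : (local i (v - 4 * i) < 17)%N by have := local_lt i v7; lia.
have vE : v = (4 * i + (v - 4 * i))%N :> nat by rewrite subnKC.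
rewrite -(foldw_local (q := Ordinal q17) sw v7 vE) //.
by rewrite -(foldw_local (q := Ordinal q17) sw' v7 vE) // e.
Qed.

Lemma foldw_onto i b (y : 'rV[R]_17) : (4 * i + 7 <= N)%N -> {in b, forall r, (r < 7)%N} ->
  asimplex b y ->
  exists w, [/\ asimplex (shift i (map (local i) b)) w, supported i w & foldw w = y].
Proof.
move=> iN b7 [y0 y1 ys].
pose w : 'rV[R]_N := \row_v (if (4 * i <= v < 4 * i + 7)%N then
  y 0 (inord (local i (v - 4 * i))) else 0).
have sw : supported i w by move=> v; rewrite mxE; case: ifP => //; rewrite eqxx.
have e : foldw w = y.
  apply/rowP => q; have [q7|q7] := ltnP q 7; last first.
    rewrite (foldw_supp sw (ltn_ord q) q7) //; apply/esym/eqP.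
    by apply: contraTT q7 => /ys/b7; rewrite -ltnNge.
  have vN : (4 * i + local i q < N)%N by have := local_lt i q7; lia.
  rewrite (foldw_local (v := Ordinal vN) sw (local_lt i q7)) ?localK //.
  rewrite mxE /= ifT; last by have := local_lt i q7; lia.
  by rewrite addKn localK // inord_val.
exists w; split=> //; split=> [v||v]; first by rewrite mxE; case: ifP.
  by rewrite -sum_foldw e.
move=> wv; have /andP[v1 v2] := sw v wv; rewrite -(subnKC v1).
apply: map_f; have v7 : (v - 4 * i < 7)%N by lia.
rewrite -[X in X \in _](localK i v7); apply: map_f; move: wv.
have l17 : (local i (v - 4 * i) < 17)%N by have := local_lt i v7; lia.
by rewrite mxE v1 v2 => /ys; rewrite inordK.
Qed.

End Fold.

(** * The map of the whole chain *)

Section ChainMap.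
Variables (R : realType) (m k : nat).
Let N := (4 * m + 7 + k)%N.
Let chain := @realization R N (chain_tris m).

Variable g : 'rV[R]_17 -> 'rV[R]_3.
Hypothesis gc : continuous g.
Hypothesis g_inj : forall w w', realization block_tris w -> realization block_tris w' ->
  g w = g w' -> w = w'.
Hypothesis g_sides : g @` realization block_sides = [set x | box_wall (x 0 0) (x 0 1) (x 0 2)].
Hypothesis g_left : g @` realization [:: [:: 0; 1; 2]%N] =
  [set x | box_end 0 (x 0 0) (x 0 1) (x 0 2)].
Hypothesis g_right : g @` realization [:: [:: 4; 5; 6]%N] =
  [set x | box_end 4 (x 0 0) (x 0 1) (x 0 2)].

(** Block [i] is put over the interval from [4 * i] to [4 * i + 4], mirrored for odd [i] to
    compensate for [flip]. *)
Definition unfold i (u : R) : R := (4 * i)%:R + (if odd i then 4 - u else u).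

Definition unfold_map i (w : 'rV[R]_N) : 'rV[R]_3 :=
  pt (unfold i (g (foldw w) 0 0)) (g (foldw w) 0 1) (g (foldw w) 0 2).

Definition chain_map (w : 'rV[R]_N) : 'rV[R]_3 :=
  unfold_map (xget 0%N [set i | (i <= m)%N /\ supported i w]) w.

Let end_tri i := if odd i then [:: 4; 5; 6]%N else [:: 0; 1; 2]%N.

Let end_tri_block i : end_tri i \in block_tris.
Proof. by rewrite /end_tri; case: (odd i). Qed.

Let g_end i w : realization [:: end_tri i] w ->
  box_end (if odd i then 4 else 0) (g w 0 0) (g w 0 1) (g w 0 2).
Proof.
rewrite /end_tri; case: (odd i) => h.
  have : (g @` realization [:: [:: 4; 5; 6]%N]) (g w) by exists w.
  by rewrite g_right.
have : (g @` realization [:: [:: 0; 1; 2]%N]) (g w) by exists w.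
by rewrite g_left.
Qed.

Let g_end_onto i (x : 'rV[R]_3) : box_end (if odd i then 4 else 0) (x 0 0) (x 0 1) (x 0 2) ->
  exists2 w, realization [:: end_tri i] w & g w = x.
Proof.
rewrite /end_tri; case: (odd i) => h.
  have : (g @` realization [:: [:: 4; 5; 6]%N]) x by rewrite g_right.
  by move=> [w ? <-]; exists w.
have : (g @` realization [:: [:: 0; 1; 2]%N]) x by rewrite g_left.
by move=> [w ? <-]; exists w.
Qed.

Let shift_end i : shift i (map (local i) (end_tri i)) = gate i.
Proof. by rewrite /gate /end_tri /local; case: (odd i). Qed.

Let shift_end_next i : shift i (map (local i) (end_tri i.+1)) = gate i.+1.
Proof. by rewrite gateE /end_tri /local oddS; case: (odd i). Qed.

Let end_lt7 i : {in end_tri i, forall r, (r < 7)%N}.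
Proof. by move=> r; rewrite /end_tri; case: (odd i); rewrite !inE => /or3P[]/eqP->. Qed.

Let sides_lt7 b : b \in block_sides -> {in b, forall r, (r < 7)%N}.
Proof. by move=> bB r; apply: block_tri_lt; rewrite mem_block_tris bB. Qed.

Lemma chain_cases w : chain w ->
  [\/ exists i, [/\ (i <= m)%N, supported i w & realization block_sides (foldw w)],
      supported 0 w /\ realization [:: end_tri 0] (foldw w)
    | supported m w /\ realization [:: end_tri m.+1] (foldw w)].
Proof.
have sh i b : {in b, forall r, (r < 7)%N} -> asimplex (shift i (map (local i) b)) w ->
    supported i w /\ asimplex b (foldw w).
  move=> b7 /(@asimplex_shift _ _ i); case; first by move=> _ /mapP[r /b7 r7 ->]; apply: local_lt.
  rewrite -map_comp => sw h; split=> //; apply: asimplexW h => r /mapP[s sb ->] /=.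
  by rewrite localK ?b7.
move=> [b /mem_chain_tris[[i [b0 [im b0B ->]]]|->|->] wb].
- have [sw wf] := asimplex_shift (sides_lt7 b0B) wb.
  have [b' b'B sub] := local_sides i b0B.
  by constructor 1; exists i; split=> //; exists b' => //; apply: asimplexW wf.
- constructor 2; rewrite -shift_end in wb; have [sw wf] := sh _ _ (@end_lt7 0) wb.
  by split=> //; exists (end_tri 0); rewrite ?mem_head.
- constructor 3; rewrite -shift_end_next in wb; have [sw wf] := sh _ _ (@end_lt7 m.+1) wb.
  by split=> //; exists (end_tri m.+1); rewrite ?mem_head.
Qed.

Lemma chain_folded w : chain w -> realization block_tris (foldw w) /\
  exists2 i, (i <= m)%N & supported i w.
Proof.
have sub K : {subset K <= block_tris} -> realization K `<=` @realization R 17 block_tris.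
  by move=> KB y [t /KB tB yt]; exists t.
have sub1 i : {subset [:: end_tri i] <= block_tris}.
  by move=> t; rewrite inE => /eqP->; exact: end_tri_block.
move=> /chain_cases[[i [im sw h]]|[sw h]|[sw h]].
- by split; [apply: sub h => t tB; rewrite mem_block_tris tB|exists i].
- by split; [apply: sub h; exact: sub1|exists 0%N].
- by split; [apply: sub h; exact: sub1|exists m].
Qed.

Lemma supported_twice i j w : chain w -> supported i w -> supported j w -> (i < j)%N ->
  j = i.+1 /\ realization [:: end_tri j] (foldw w).
Proof.
move=> [b _ [w0 w1 _]] si sj ij.
have [v wv] : exists v, w 0 v != 0.
  apply/existsP; apply: contra_eqT w1; rewrite negb_exists => /forallP h.
  rewrite big1 => [|v _]; first by rewrite eq_sym oner_eq0.
  by apply/eqP; have := h v; rewrite negbK.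
have jE : j = i.+1 by have := si v wv; have := sj v wv; lia.
have gw : asimplex (shift j [:: 0; 1; 2]%N) w.
  split=> // u wu; have := si u wu; have /andP[j1 j2] := sj u wu => u7.
  by rewrite -(subnKC j1); apply: map_f; rewrite !inE; lia.
split=> //; exists (end_tri j); first exact: mem_head.
have [|_] := @asimplex_shift _ _ j _ _ _ gw; first by move=> r; rewrite !inE => /or3P[]/eqP->.
by apply: asimplexW => r; rewrite /end_tri /local; case: (odd j).
Qed.

(** The block chosen by [xget] is immaterial: weights supported in two blocks live on the common
    gate, which [g] sends to the end [x = 0] or [x = 4], and both unfoldings put this end in the
    same plane. *)
Lemma chain_mapE i w : (i <= m)%N -> chain w -> supported i w -> chain_map w = unfold_map i w.
Proof.
move=> im cw si; rewrite /chain_map; case: xgetP => [j _ [jm sj]|/(_ i)[]//].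
suff h i' j' : (i' < j')%N -> supported i' w -> supported j' w ->
    unfold_map i' w = unfold_map j' w.
  by have [ij|ij|->//] := ltngtP i j; [rewrite (h i j)|rewrite (h j i)].
move=> ij si' sj'; have [jE h] := supported_twice cw si' sj' ij.
rewrite /unfold_map; congr pt; have [-> _ _] := g_end h.
rewrite jE /unfold oddS mulnS natrD; case: (odd i') => /=; ring.
Qed.

Lemma closed_supported i : closed [set w : 'rV[R]_N | supported i w].
Proof.
have -> : [set w : 'rV[R]_N | supported i w] =
    \bigcap_(v in [set v : 'I_N | ~~ (4 * i <= v < 4 * i + 7)%N]) [set w | w 0 v = 0].
  apply/seteqP; split=> w /= h v; first by move=> /= vi; apply: contraNeq vi => /h.
  by apply: contraNT => vi; apply/eqP; exact: h.
apply: closed_bigI => v _.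
have c := @coord_continuous R 1 N 0 v.
rewrite [X in closed X](_ : _ = [set w : 'rV[R]_N | w 0 v <= 0] `&` [set w | 0 <= w 0 v]).
  by apply: closedI; [exact: closed_fun_le|exact: closed_fun_ge].
apply/seteqP; split=> w /=; first by move=> ->.
by move=> [h h']; apply/le_anti; rewrite h.
Qed.

Lemma continuous_unfold_map i : continuous (unfold_map i).
Proof.
have gfc : continuous (g \o foldw (N := N)).
  by move=> w; apply: continuous_comp; [exact: continuous_foldw|exact: gc].
have cc (j : 'I_3) : continuous (fun w : 'rV[R]_N => g (foldw w) 0 j).
  exact: (continuous_coord gfc).
apply: continuous_row => -[[|[|[|//]]] l3]; under eq_fun do rewrite mxE /=; [|exact: cc..].
apply: continuous_add; first exact: continuous_cst.
case: (odd i); last exact: cc.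
under eq_fun do rewrite -[g _ _ _]mul1r -mulNr.
by apply: continuous_add; [exact: continuous_cst|
  apply: continuous_mul; [exact: continuous_cst|exact: cc]].
Qed.

(** The chain is a finite union of closed parts, one for each block, on which the map is the
    continuous [unfold_map i]. *)
Lemma continuous_chain_map : {within chain, continuous chain_map}.
Proof.
pose A i := chain `&` [set w | supported i w].
have hN : hausdorff_space 'rV[R]_N by exact: norm_hausdorff.
have cA i : (i < m.+1)%N -> closed (A i).
  move=> _; apply: closedI; last exact: closed_supported.
  by apply: compact_closed; [exact: hN|exact: compact_realization].
have -> : chain = [set w | exists2 i, (i < m.+1)%N & A i w].
  apply/seteqP; split=> [w cw|w [i im []]] //.
  by have [_ [j jm sw]] := chain_folded cw; exists j.
apply: (closed_within_union cA _).2 => i im.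
apply: (@subspace_eq_continuous _ _ _ (unfold_map i)).
  by move=> w /set_mem[cw sw]; exact: (esym (chain_mapE im cw sw)).
exact/continuous_subspaceT/continuous_unfold_map.
Qed.

Lemma g_bounds w : realization block_tris w ->
  [/\ 0 <= g w 0 0 <= 4, 0 <= g w 0 1 <= 3 & 0 <= g w 0 2 <= 1].
Proof.
move=> [t]; rewrite mem_block_tris => /or3P[tB|/eqP->|/eqP->] wt.
- have : (g @` realization block_sides) (g w) by exists w => //; exists t.
  by rewrite g_sides => -[].
- have : (g @` realization [:: [:: 0; 1; 2]%N]) (g w).
    by exists w => //; exists [:: 0; 1; 2]%N => //; exact: mem_head.
  by rewrite g_left => -[-> ? ?]; split=> //; apply/andP; split; lra.
- have : (g @` realization [:: [:: 4; 5; 6]%N]) (g w).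
    by exists w => //; exists [:: 4; 5; 6]%N => //; exact: mem_head.
  by rewrite g_right => -[-> ? ?]; split=> //; apply/andP; split; lra.
Qed.

(** For points in blocks [i < j] the first coordinates of the images lie in intervals with at most
    an end point in common, so [j = i + 1] and the image is in the plane of the gate. The second
    point is then on that gate, hence also in block [i], and injectivity within one block
    concludes. *)
Lemma chain_map_inj w w' : chain w -> chain w' -> chain_map w = chain_map w' -> w = w'.
Proof.
suff h i j v v' : (i <= j)%N -> (j <= m)%N -> chain v -> chain v' -> supported i v ->
    supported j v' -> unfold_map i v = unfold_map j v' -> v = v'.
  move=> cw cw'; have [_ [i im si]] := chain_folded cw; have [_ [j jm sj]] := chain_folded cw'.
  rewrite (chain_mapE im cw si) (chain_mapE jm cw' sj) => e.
  by have [ij|/ltnW ji] := leqP i j; [exact: h si sj e|apply/esym; exact: (h _ _ _ _ ji im)].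
move=> ij jm cv cv' si sj e.
have [bv _] := chain_folded cv; have [bv' _] := chain_folded cv'.
have e0 : unfold i (g (foldw v) 0 0) = unfold j (g (foldw v') 0 0).
  by move: (congr1 (fun x : 'rV[R]_3 => x 0 0) e); rewrite !ptE.
have e1 : g (foldw v) 0 1 = g (foldw v') 0 1.
  by move: (congr1 (fun x : 'rV[R]_3 => x 0 1) e); rewrite !ptE.
have e2 : g (foldw v) 0 2 = g (foldw v') 0 2.
  by move: (congr1 (fun x : 'rV[R]_3 => x 0 2) e); rewrite !ptE.
have [/andP[u0 u4] _ _] := g_bounds bv; have [/andP[u0' u4'] y' z'] := g_bounds bv'.
have [lij|eij] := eqVneq i j.
  apply: (foldw_inj si); rewrite ?lij //; apply: g_inj => //.
  rewrite [LHS]pt_eta [RHS]pt_eta e1 e2; congr pt.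
  by move: e0; rewrite lij /unfold => /addrI; case: (odd j) => // /addrI/oppr_inj.
have ltij : (i < j)%N by rewrite ltn_neqAle eij.
have jE : j = i.+1.
  apply/eqP; rewrite eqn_leq ltij andbT -(leq_pmul2l (isT : (0 < 4)%N)) -(ler_nat R).
  rewrite mulnS natrD; move: e0; rewrite /unfold; move: ((4 * i)%:R) ((4 * j)%:R) => a b.
  by case: (odd i); case: (odd j); lra.
have E : g (foldw v') 0 0 = if odd j then 4 else 0.
  move: e0; rewrite jE /unfold mulnS natrD oddS; move: ((4 * i)%:R) => a.
  by case: (odd i) => /=; lra.
have : box_end (if odd j then 4 else 0) (g (foldw v') 0 0) (g (foldw v') 0 1) (g (foldw v') 0 2).
  by split.
move=> /g_end_onto[y yj /g_inj ye].
have {}ye : y = foldw v'.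
  apply: ye => //; have [t + yt] := yj; rewrite inE => /eqP tE.
  by exists t => //; rewrite tE end_tri_block.
(* [ye] puts the folded weights of [v'] on the three labels of the gate, so the local labels of
   block [j] from 3 on carry no weight. *)
have si' : supported i v'.
  move=> u vu; have /andP[j1 j2] := sj u vu; apply/andP; split; first by lia.
  rewrite ltnNge; apply/negP => u7; have r7 : (u - 4 * j < 7)%N by lia.
  have q17 : (local j (u - 4 * j) < 17)%N by have := local_lt j r7; lia.
  have := foldw_local (v := u) (q := Ordinal q17) sj r7 (esym (subnKC j1)) erefl.
  rewrite -ye; have [t] := yj; rewrite inE => /eqP-> [_ _ yt] => E'.
  have := yt (Ordinal q17); rewrite E' => /(_ vu) /=.
  have : (3 <= u - 4 * j)%N by lia.
  rewrite /end_tri /local; move: (u - 4 * j)%N r7 => r; clear.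
  by case: (odd j); case: r => [|[|[|[|[|[|[|]]]]]]].
have eqm : unfold_map i v = unfold_map i v'.
  have im : (i <= m)%N by lia.
  by rewrite e -(chain_mapE jm cv' sj) (chain_mapE im cv' si').
apply: (foldw_inj si si'); apply: g_inj => //.
rewrite [LHS]pt_eta [RHS]pt_eta e1 e2; congr pt.
move: (congr1 (fun x : 'rV[R]_3 => x 0 0) eqm); rewrite !ptE /unfold => /addrI.
by case: (odd i) => // /addrI/oppr_inj.
Qed.

Lemma box_wall_sym (x y z : R) : box_wall x y z -> box_wall (4 - x) y z.
Proof.
move=> [/andP[? ?] Y Z hole sides]; split=> //; first by apply/andP; split; lra.
  by case: hole => ?; [constructor 2|constructor 1|constructor 3|constructor 4] => //; lra.
case: sides => [?|?|?|[/andP[? ?] ?]]; [constructor 1|constructor 2|constructor 3|constructor 4] => //.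
by split=> //; apply/andP; split; lra.
Qed.

Let sym_wall i (x y z : R) : box_wall (if odd i then 4 - x else x) y z <-> box_wall x y z.
Proof.
case: (odd i) => //; split=> [h|]; last exact: box_wall_sym.
by have := box_wall_sym h; rewrite opprB addrC subrK.
Qed.

Definition chain_walls : set 'rV[R]_3 :=
  [set x | [\/ exists2 i, (i <= m)%N & box_wall (x 0 0 - (4 * i)%:R) (x 0 1) (x 0 2),
               box_end 0 (x 0 0) (x 0 1) (x 0 2)
             | box_end (4 * m.+1)%:R (x 0 0) (x 0 1) (x 0 2)]].

(** Points of the walls are lifted block by block, through [g] and then [foldw_onto]. Of the gates
    only the first and the last belong to the surface, whence the two end clauses of
    [chain_walls]. *)
Lemma chain_map_image : chain_map @` chain = chain_walls.
Proof.
have onto i b (x : 'rV[R]_3) : (i <= m)%N -> {in b, forall r, (r < 7)%N} ->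
    (exists2 b', b' \in chain_tris m & {subset shift i (map (local i) b) <= b'}) ->
    (exists2 y, realization [:: b] y &
      g y = pt (if odd i then 4 - (x 0 0 - (4 * i)%:R) else x 0 0 - (4 * i)%:R)
               (x 0 1) (x 0 2)) -> (chain_map @` chain) x.
  move=> im b7 [b' b'B sub] [y [b0 + yb] gy]; rewrite inE => /eqP b0E; rewrite {}b0E in yb.
  have iN : (4 * i + 7 <= N)%N by rewrite /N; lia.
  have [w [wb sw wy]] := foldw_onto iN b7 yb.
  have cw : chain w by exists b' => //; exact: asimplexW wb.
  exists w => //; rewrite (chain_mapE im cw sw) /unfold_map wy gy !ptE /unfold [RHS]pt_eta.
  by congr pt; case: (odd i); ring.
apply/seteqP; split=> [_ [w cw <-]|x].
  case: (chain_cases cw) => [[i [im sw [b bB wb]]]|[sw h]|[sw h]].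
  - constructor 1; exists i => //; rewrite (chain_mapE im cw sw) !ptE /unfold addrAC subrr add0r.
    apply/sym_wall; have : (g @` realization block_sides) (g (foldw w)).
      by exists (foldw w) => //; exists b.
    by rewrite g_sides.
  - constructor 2; rewrite (chain_mapE _ cw sw) // !ptE; have [-> ? ?] := g_end h.
    by split=> //; rewrite /unfold muln0 add0r.
  constructor 3; rewrite (chain_mapE _ cw sw) // !ptE; have [-> ? ?] := g_end h.
  by split=> //; rewrite /unfold mulnS natrD oddS; case: (odd m) => /=; ring.
have bdry i : (i <= m)%N -> gate i \in chain_tris m ->
    box_end (4 * i)%:R (x 0 0) (x 0 1) (x 0 2) -> (chain_map @` chain) x.
  move=> im gT [xE Y Z]; apply: (onto i (end_tri i)) => //.
    by exists (gate i) => //; rewrite shift_end.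
  apply: (@g_end_onto i); rewrite !ptE xE subrr subr0; by split.
case=> [[i im /(sym_wall i) h]|h|[xE Y Z]].
- have : (g @` realization block_sides)
      (pt (if odd i then 4 - (x 0 0 - (4 * i)%:R) else x 0 0 - (4 * i)%:R) (x 0 1) (x 0 2)).
    by rewrite g_sides /= !ptE.
  move=> [y [b bB yb] gy]; apply: (onto i b) => //; first exact: sides_lt7.
    have [b' b'B sub] := local_sides i bB; exists (shift i b').
      by apply/mem_chain_tris; constructor 1; exists i, b'.
    by move=> _ /mapP[r rb ->]; apply: map_f; exact: sub.
  by exists y => //; exists b; rewrite ?mem_head.
- by apply: (bdry 0%N); rewrite ?muln0 //; apply/mem_chain_tris; constructor 2.
apply: (onto m (end_tri m.+1)) => //.
  by exists (gate m.+1); rewrite ?shift_end_next //; apply/mem_chain_tris; constructor 3.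
apply: (@g_end_onto m.+1); rewrite !ptE xE mulnS natrD oddS; split=> //.
by case: (odd m) => /=; ring.
Qed.

End ChainMap.

(** * The drilled box *)

Section DrilledBox.
Variables (R : realType) (p : nat).

Let near_gt (f : 'rV[R]_3 -> R) a x : continuous f -> a < f x ->
  \forall y \near x, a < f y.
Proof.
by move=> fc ax; apply: (@open_nbhs_nbhs _ x [set y | a < f y]); split; [exact: open_fun_gt|].
Qed.

Let near_lt (f : 'rV[R]_3 -> R) a x : continuous f -> f x < a ->
  \forall y \near x, f y < a.
Proof.
move=> fc xa; have : \forall y \near x, - a < - f y.
  apply: (@near_gt (fun y => - f y)); last by rewrite ltrN2.
  under eq_fun do rewrite -mulN1r.
  by apply: continuous_mul => //; exact: continuous_cst.
by apply: filterS => y; rewrite ltrN2.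
Qed.

Let cc (j : 'I_3) : continuous (fun x : 'rV[R]_3 => x 0 j).
Proof. exact: coord_continuous. Qed.

Lemma closed_drilled_box : closed (@drilled_box R p).
Proof.
have -> : @drilled_box R p =
    [set x | 0 <= x 0 0] `&` [set x | x 0 0 <= (2 * p + 1)%:R] `&`
    ([set x | 0 <= x 0 1] `&` [set x | x 0 1 <= 3]) `&`
    ([set x | 0 <= x 0 2] `&` [set x | x 0 2 <= 1]) `&`
    \bigcap_(i in [set i | (i < p)%N])
      ([set x | x 0 0 <= (2 * i + 1)%:R] `|` [set x | (2 * i + 2)%:R <= x 0 0] `|`
       ([set x | x 0 1 <= 1] `|` [set x | 2 <= x 0 1])).
  apply/seteqP; split=> x /=.
    move=> [/andP[? ?] /andP[? ?] /andP[? ?] h]; do !split=> // i /= ip.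
    have := h i ip; have [|x1] := lerP (x 0 0) (2 * i + 1)%:R; first by left; left.
    have [|x2] := lerP (2 * i + 2)%:R (x 0 0); first by left; right.
    have [|y1] := lerP (x 0 1) 1; first by right; left.
    have [|y2] := lerP 2 (x 0 1); first by right; right.
    by case; split.
  move=> [[[[? ?] [? ?]] [? ?]] h]; split; [exact/andP..|].
  move=> i /h; rewrite /= !leNgt => -[[|]|[|]] /negbTE h'; rewrite h' ?andbF; by case.
by do !apply: closedI; try apply: closed_bigI => i _; do ?apply: closedU;
  first [exact: closed_fun_le|exact: closed_fun_ge].
Qed.

Definition box_boundary : set 'rV[R]_3 :=
  [set x | @drilled_box R p x /\
    [\/ x 0 0 = 0 \/ x 0 0 = (2 * p + 1)%:R, x 0 1 = 0 \/ x 0 1 = 3, x 0 2 = 0 \/ x 0 2 = 1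
      | exists2 i, (i < p)%N & (2 * i + 1)%:R <= x 0 0 <= (2 * i + 2)%:R /\ 1 <= x 0 1 <= 2]].

(** From a point where an equality holds some direction leaves the box at once; for a point of a
    closed tunnel it leads to the axis of the tunnel. Where none holds, finitely many open
    conditions describe a neighbourhood contained in the box. *)
Lemma frontier_drilled_box : @sphere_with_handles R p = box_boundary.
Proof.
rewrite /sphere_with_handles /frontier -((closure_id _).1 closed_drilled_box).
apply/seteqP; split=> x [bx h]; split=> //; last first.
  move=> ix; have step d := small_step d ix.
  case: h => [[x0|x0]|[x1|x1]|[x2|x2]|[i ip [/andP[a b] /andP[c d]]]].
  - have [s /andP[s0 _] [/andP[+ _] _ _ _]] := step (pt (-1) 0 0).
    by rewrite !mxE /= x0; lra.
  - have [s /andP[s0 _] [/andP[_ +] _ _ _]] := step (pt 1 0 0).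
    by rewrite !mxE /= x0 mulr1 gerDl leNgt s0.
  - have [s /andP[s0 _] [_ /andP[+ _] _ _]] := step (pt 0 (-1) 0).
    by rewrite !mxE /= x1; lra.
  - have [s /andP[s0 _] [_ /andP[_ +] _ _]] := step (pt 0 1 0).
    by rewrite !mxE /= x1; lra.
  - have [s /andP[s0 _] [_ _ /andP[+ _] _]] := step (pt 0 0 (-1)).
    by rewrite !mxE /= x2; lra.
  - have [s /andP[s0 _] [_ _ /andP[_ +] _]] := step (pt 0 0 1).
    by rewrite !mxE /= x2; lra.
  have [s /andP[s0 s1] [_ _ _ /(_ i ip)]] :=
    step (pt ((2 * i + 1)%:R + 2^-1 - x 0 0) (1 + 2^-1 - x 0 1) 0).
  apply; rewrite !mxE /=; move: a b; rewrite !natrD; move: ((2 * i)%:R : R) => t a b.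
  split; apply/andP; split; nra.
apply: contrapT => nb; apply: h.
have [/andP[X0 X1] /andP[Y0 Y1] /andP[Z0 Z1] _] := bx.
  have s (a b : R) : a <= b -> a <> b -> a < b.
    by rewrite le_eqVlt => /orP[/eqP|].
  have hx0 : 0 < x 0 0 by apply: s => // e; apply: nb; constructor 1; left.
  have hx1 : x 0 0 < (2 * p + 1)%:R by apply: s => // e; apply: nb; constructor 1; right.
  have hy0 : 0 < x 0 1 by apply: s => // e; apply: nb; constructor 2; left.
  have hy1 : x 0 1 < 3 by apply: s => // e; apply: nb; constructor 2; right.
  have hz0 : 0 < x 0 2 by apply: s => // e; apply: nb; constructor 3; left.
  have hz1 : x 0 2 < 1 by apply: s => // e; apply: nb; constructor 3; right.
  pose off (i : 'I_p) (y : 'rV[R]_3) :=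
    ~ ((2 * i + 1)%:R < y 0 0 < (2 * i + 2)%:R /\ 1 < y 0 1 < 2).
  have hi : \forall y \near x, forall i, off i y.
    apply: (@filter_forall _ _ off (nbhs x)) => i.
    have [u|u] := ltrP (x 0 0) (2 * i + 1)%:R.
      apply: filterS (near_lt (@cc 0) u) => y yu [/andP[yu' _] _].
      by have := lt_trans yu yu'; rewrite ltxx.
    have [v|v] := ltrP (2 * i + 2)%:R (x 0 0).
      apply: filterS (near_gt (@cc 0) v) => y yv [/andP[_ yv'] _].
      by have := lt_trans yv yv'; rewrite ltxx.
    have [a|a] := ltrP (x 0 1) 1.
      apply: filterS (near_lt (@cc 1) a) => y ya [_ /andP[ya' _]].
      by have := lt_trans ya ya'; rewrite ltxx.
    have [b|b] := ltrP 2 (x 0 1).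
      apply: filterS (near_gt (@cc 1) b) => y yb [_ /andP[_ yb']].
      by have := lt_trans yb yb'; rewrite ltxx.
    by exfalso; apply: nb; constructor 4; exists i => //; rewrite u v a b.
  have n1 := near_gt (@cc 0) hx0; have n2 := near_lt (@cc 0) hx1.
  have n3 := near_gt (@cc 1) hy0; have n4 := near_lt (@cc 1) hy1.
  have n5 := near_gt (@cc 2) hz0; have n6 := near_lt (@cc 2) hz1.
  apply: filter_app hi; apply: filter_app n1; apply: filter_app n2; apply: filter_app n3.
  apply: filter_app n4; apply: filter_app n5; apply: filterS n6 => y y6 y5 y4 y3 y2 y1 yi.
  split; [by rewrite !ltW|by rewrite !ltW|by rewrite !ltW|].
  by move=> i ip; exact: (yi (Ordinal ip)).
Qed.

End DrilledBox.

Section Stretch.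
Variables (R : realType) (m : nat).

Let natrMD (a b c : nat) : (a * b + c)%:R = (a * b)%:R + c%:R :> R.
Proof. exact: natrD. Qed.

(* Halves the distances between the tunnels and keeps the unit margins at the
   two ends. *)
Definition stretch (x : R) : R := Num.max (Num.min x ((x + 1) / 2)) (x - (2 * m + 1)%:R).

Lemma stretchP x : [\/ x <= 1 /\ stretch x = x,
  1 <= x <= (4 * m + 3)%:R /\ stretch x = (x + 1) / 2
  | (4 * m + 3)%:R <= x /\ stretch x = x - (2 * m + 1)%:R].
Proof.
rewrite /stretch !natrMD !natrM; have := natr_ge0 R m; move: (m%:R : R) => M M0.
have [x1|x1] := lerP x 1.
  by constructor 1; rewrite min_l ?max_l; [|lra..].
have [x2|x2] := lerP x (4 * M + 3).
  by constructor 2; rewrite min_r ?max_l; [split=> //; apply/andP; split; lra|lra..].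
by constructor 3; rewrite min_r ?max_r; [split=> //; lra|lra..].
Qed.

Lemma stretch_lt x y : x < y -> stretch x < stretch y.
Proof.
have := stretchP x; have := stretchP y; rewrite !natrMD !natrM.
have := natr_ge0 R m; move: (m%:R : R) => M M0.
by move=> [[? ->]|[/andP[? ?] ->]|[? ->]] [[? ->]|[/andP[? ?] ->]|[? ->]] ?; lra.
Qed.

Lemma stretch_le x y : (stretch x <= stretch y) = (x <= y).
Proof.
have [|/stretch_lt] := lerP x y; last by move=> h; rewrite leNgt h.
by rewrite le_eqVlt => /orP[/eqP->|/stretch_lt/ltW->]; rewrite ?lexx.
Qed.

Lemma stretch_inj : injective stretch.
Proof. by move=> x y e; apply/le_anti; rewrite -(stretch_le x y) -(stretch_le y x) e lexx. Qed.

Lemma stretch_onto q : exists x, stretch x = q.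
Proof.
have [q1|q1] := lerP q 1.
  by exists q; case: (stretchP q) => [[_ ->]|[/andP[? ?] ->]|[+ ->]] //; [lra|];
    rewrite !natrMD !natrM; have := natr_ge0 R m; move: (m%:R : R) => M *; lra.
have [q2|q2] := lerP q (2 * m + 2)%:R.
  exists (2 * q - 1); case: (stretchP (2 * q - 1)); move: q2; rewrite !natrMD !natrM;
    have := natr_ge0 R m; move: (m%:R : R) => M.
  - by move=> ? ? [? ->]; lra.
  - by move=> ? ? [? ->]; lra.
  - by move=> ? ? [? ->]; lra.
exists (q + (2 * m + 1)%:R); case: (stretchP (q + (2 * m + 1)%:R)); move: q2; rewrite !natrMD !natrM;
  have := natr_ge0 R m; move: (m%:R : R) => M.
- by move=> ? ? [? ->]; lra.
- by move=> ? ? [/andP[? ?] ->]; lra.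
- by move=> ? ? [? ->]; lra.
Qed.

Lemma continuous_stretch : continuous stretch.
Proof.
move=> x; apply: (@continuous_max R R (fun x => Num.min x ((x + 1) / 2))).
  apply: (@continuous_min R R idfun); first exact: cvg_id.
  by apply: cvgM; [apply: cvgD; [exact: cvg_id|exact: cvg_cst]|exact: cvg_cst].
by apply: cvgB; [exact: cvg_id|exact: cvg_cst].
Qed.

Lemma stretch0 : stretch 0 = 0.
Proof.
case: (stretchP 0) => [[_ ->]|[/andP[+ _] _]|[+ _]] //; first by rewrite ler10.
by rewrite natrMD; have := ler0n R (4 * m); lra.
Qed.

Lemma stretch_enter i : (i <= m)%N -> stretch (4 * i + 1)%:R = (2 * i + 1)%:R.
Proof.
move=> im; have iR : (i%:R : R) <= m%:R by rewrite ler_nat.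
have := stretchP (4 * i + 1)%:R; rewrite !natrMD !natrM; have := natr_ge0 R i.
by move: iR; move: (i%:R : R) (m%:R : R) => a b ? ? [[? ->]|[/andP[? ?] ->]|[? ->]]; lra.
Qed.

Lemma stretch_leave i : (i <= m)%N -> stretch (4 * i + 3)%:R = (2 * i + 2)%:R.
Proof.
move=> im; have iR : (i%:R : R) <= m%:R by rewrite ler_nat.
have := stretchP (4 * i + 3)%:R; rewrite !natrMD !natrM; have := natr_ge0 R i.
by move: iR; move: (i%:R : R) (m%:R : R) => a b ? ? [[? ->]|[/andP[? ?] ->]|[? ->]]; lra.
Qed.

Lemma stretch_end : stretch (4 * m.+1)%:R = (2 * m.+1 + 1)%:R.
Proof.
have := stretchP (4 * m.+1)%:R; rewrite !natrMD !natrM -!natr1; have := natr_ge0 R m.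
by move: (m%:R : R) => b ? [[? ->]|[/andP[? ?] ->]|[? ->]]; lra.
Qed.

Lemma block_index n (x : R) : 0 <= x <= (4 * n.+1)%:R ->
  exists2 i, (i <= n)%N & (4 * i)%:R <= x <= (4 * i)%:R + 4.
Proof.
elim: n => [|n IH] /andP[x0 x1]; first by exists 0%N; rewrite // muln0 x0 add0r; move: x1.
have [xn|xn] := lerP x (4 * n.+1)%:R.
  by have [|i im ix] := IH; [rewrite x0 xn|exists i => //; exact: leqW].
by exists n.+1 => //; rewrite ltW //=; move: x1; rewrite mulnS natrD addrC.
Qed.

(** [stretch] is increasing and takes [4 * i + 1], [4 * i + 3] and the two ends of the chain to the
    corresponding numbers of the drilled box, so comparisons with them carry over. In the converse
    direction [block_index] supplies the block. *)
Lemma stretch_walls (X y z : R) :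
  chain_walls m (pt X y z) <-> box_boundary (m.+1) (pt (stretch X) y z).
Proof.
have bd : (0 <= stretch X <= (2 * m.+1 + 1)%:R) = (0 <= X <= (4 * m.+1)%:R).
  by rewrite -{1}stretch0 -stretch_end !stretch_le.
have hl j : (j < m.+1)%N -> (((2 * j + 1)%:R < stretch X < (2 * j + 2)%:R) =
    ((4 * j + 1)%:R < X < (4 * j + 3)%:R)) *
    (((2 * j + 1)%:R <= stretch X <= (2 * j + 2)%:R) =
    ((4 * j + 1)%:R <= X <= (4 * j + 3)%:R)).
  by move=> jm; rewrite -stretch_enter // -stretch_leave // !ltNge !stretch_le.
rewrite /chain_walls /box_boundary /drilled_box /= !ptE bd; split.
  case=> [[i im [/andP[u0 u4] Y Z hole sides]]|[XE Y Z]|[XE Y Z]].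
  - have iX : 0 <= X.
      by rewrite (le_trans (ler0n R (4 * i))) // -subr_ge0.
    have Xi : X <= (4 * i)%:R + 4 by rewrite addrC -lerBlDr.
    have mX : X <= (4 * m.+1)%:R.
      apply: (le_trans Xi); rewrite -(natrMD 4 i 4) ler_nat.
      by clear -im; lia.
    split.
      split=> //; first by rewrite iX mX.
      move=> j jm; rewrite hl // => -[/andP[a b] /andP[c d]].
      have [ij|ij|ij] := ltngtP i j.
      + have : (4 * i)%:R + 4 < X.
          apply: le_lt_trans a; rewrite -(natrMD 4 i 4) ler_nat.
          by clear -ij; lia.
        by rewrite ltNge Xi.
      + have : X < (4 * i)%:R.
          apply: (lt_le_trans b); rewrite ler_nat.
          by clear -ij; lia.
        by rewrite ltNge -subr_ge0 u0.
      move: a b; rewrite -ij !natrMD => a b.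
      by case: hole => ?; lra.
    case: sides => [h|h|h|[/andP[a b] h]]; [constructor 2|constructor 3|constructor 3|constructor 4] => //.
    + by left. + by right.
    exists i => //; rewrite hl //; split=> //.
    by rewrite !natrMD; apply/andP; split; lra.
  - split; last by constructor 1; left; rewrite XE stretch0.
    split=> //; first by rewrite XE lexx ler0n.
    by move=> j jm; rewrite hl // XE => -[/andP[+ _] _]; rewrite ltNge ler0n.
  split; last by constructor 1; right; rewrite XE stretch_end.
  split=> //; first by rewrite XE lexx ler0n.
  move=> j jm; rewrite hl // XE => -[/andP[_ +] _].
  by rewrite ltr_nat; clear -jm; lia.
move=> [[/andP[X0 X4] Y Z holes]].
have wall i : (i <= m)%N -> (4 * i)%:R <= X <= (4 * i)%:R + 4 ->
    [\/ y = 0 \/ y = 3, z = 0, z = 1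
      | 1 <= X - (4 * i)%:R <= 3 /\ 1 <= y <= 2] ->
    exists2 i, (i <= m)%N & box_wall (X - (4 * i)%:R) y z.
  move=> im /andP[a b] sides; exists i => //; split=> //; first by apply/andP; split; lra.
  have := holes i im; rewrite hl // !natrMD; move: ((4 * i)%:R : R) => t h.
  have [|x1] := lerP (X - t) 1; first by constructor 1.
  have [|x2] := lerP 3 (X - t); first by constructor 2.
  have [|y1] := lerP y 1; first by constructor 3.
  have [|y2] := lerP 2 y; first by constructor 4.
  by case: h; split; apply/andP; split; lra.
have ind : exists2 i, (i <= m)%N & (4 * i)%:R <= X <= (4 * i)%:R + 4.
  by apply: block_index; rewrite X0 X4.
case=> [[|]|h|h|[i im]].
- by move=> e; constructor 2; split=> //; apply: stretch_inj; rewrite e stretch0.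
- by move=> e; constructor 3; split=> //; apply: stretch_inj; rewrite e stretch_end.
- by constructor 1; have [i im iX] := ind; apply: (wall i) => //; constructor 1.
- constructor 1; have [i im iX] := ind; apply: (wall i) => //.
  by case: h => ?; [constructor 2|constructor 3].
rewrite hl // !natrMD => -[/andP[a b] h]; constructor 1; apply: (wall i) => //.
  by apply/andP; split; lra.
by constructor 4; split=> //; apply/andP; split; lra.
Qed.

Definition stretch_map (x : 'rV[R]_3) : 'rV[R]_3 := pt (stretch (x 0 0)) (x 0 1) (x 0 2).

Lemma continuous_stretch_map : continuous stretch_map.
Proof.
have cc (j : 'I_3) : continuous (fun x : 'rV[R]_3 => x 0 j) by exact: coord_continuous.
apply: continuous_row => -[[|[|[|//]]] l3]; under eq_fun do rewrite mxE /=; [|exact: cc..].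
by move=> x; apply: continuous_comp; [exact: cc|exact: continuous_stretch].
Qed.

Lemma stretch_map_inj : injective stretch_map.
Proof.
move=> x y e; rewrite [LHS]pt_eta [RHS]pt_eta.
have E (j : 'I_3) : stretch_map x 0 j = stretch_map y 0 j by rewrite e.
have := E 0; have := E 1; have := E 2; rewrite !ptE => -> -> /stretch_inj ->.
by [].
Qed.

Lemma stretch_map_image : stretch_map @` chain_walls m = @sphere_with_handles R m.+1.
Proof.
rewrite frontier_drilled_box; apply/seteqP; split=> [_ [x xw <-]|q qb].
  by apply/stretch_walls; rewrite -pt_eta.
have [X XE] := stretch_onto (q 0 0).
exists (pt X (q 0 1) (q 0 2)); first by apply/stretch_walls; rewrite XE -pt_eta.
by rewrite /stretch_map !ptE XE -pt_eta.
Qed.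

End Stretch.

(** * The theorem *)

Section Surface.
Variables (R : realType) (m k : nat).
Let N := (4 * m + 7 + k)%N.

Lemma homeomorphic_matchable (K K' : seq (seq nat)) : matchable R N [:: K] [:: K'] ->
  homeomorphic (@realization R N K) (@realization R N K').
Proof.
move=> [f [g [fc gc fg gf]]]; exists f, g; split.
- exact: continuous_subspaceT.
- exact: continuous_subspaceT.
- by move=> _ [w /(fg 0%N)[h _] <-].
- by move=> _ [w /(gf 0%N)[h _] <-].
by split=> w /set_mem; [move=> /(fg 0%N)[]|move=> /(gf 0%N)[]].
Qed.

Lemma tri_sortedE j b : b \in toroid_tris m j -> sorted ltn b /\ size b = 3%N.
Proof. exact: tri_sorted (toroid_closed m j) b. Qed.

(** Stacking a tetrahedron on a triangle changes the surface by the stellar subdivision of that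
    triangle at the new vertex. *)
Lemma lid_split j : (j < k)%N ->
  @realization R N (stellar (lid m j) (crest m j.+1) (toroid_tris m j)) =
  @realization R N (toroid_tris m j.+1).
Proof.
have cE : crest m j.+1 = (4 * m + 7 + j)%N by [].
move=> jk; have c1 := crest_gt1 m j; have c2 := crest_lt m (ltnSn j).
have [slid zlid] := tri_sortedE (lid_toroid m j).
have ulid := sorted_uniq ltn_trans ltnn slid.
have lidE t : t \in toroid_tris m j -> all (mem t) (lid m j) -> t = lid m j.
  move=> /tri_sortedE[st zt] /allP sub.
  have [_ h] := uniq_min_size ulid sub (eq_leq (etrans zt (esym zlid))).
  by apply: (irr_sorted_eq ltn_trans ltnn) => // v; rewrite h.
have inS t : t \in toroid_tris m j -> t != lid m j -> t \in toroid_tris m j.+1.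
  by move=> tT tl; rewrite toroid_trisS mem_cat mem_filter tl tT.
have inN t : crest m j.+1 \in t ->
    t \in [:: lid m j.+1; [:: 0%N; crest m j; crest m j.+1];
              [:: 1%N; crest m j; crest m j.+1]] -> t \in toroid_tris m j.+1.
  move=> ct tN; rewrite toroid_trisS mem_cat !mem_filter; apply/orP; right.
  rewrite (in_cons (lid m j)) tN orbT andbT; apply: contraTN ct => /eqP->.
  by rewrite !inE; lia.
have sub (K K' : seq (seq nat)) : (forall t, t \in K -> exists2 t', t' \in K' & {subset t <= t'}) ->
    @realization R N K `<=` @realization R N K'.
  by move=> h w [t /h[t' t'K tt'] wt]; exists t' => //; exact: asimplexW wt.
apply/seteqP; split; apply: sub => t.
  move=> /flattenP[_ /mapP[t0 t0T ->]]; rewrite /star_split; case: ifP => al; last first.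
    rewrite inE => /eqP->; exists t0 => //; apply: inS => //.
    by apply: contraFN al => /eqP->; apply/allP.
  rewrite (lidE _ t0T al) => /mapP[v vl ->].
  have memr u : u \in rem v (lid m j) -> (u != v) /\ u \in lid m j.
    by rewrite mem_rem_uniq // inE => /andP[].
  move: vl memr; rewrite !inE => /or3P[]/eqP-> memr.
  - exists [:: 1%N; crest m j; crest m j.+1].
      by apply: inN; rewrite !inE eqxx ?orbT.
    by move=> u; rewrite inE => /orP[/eqP->|/memr[]]; rewrite !inE; lia.
  - exists [:: 0%N; crest m j; crest m j.+1].
      by apply: inN; rewrite !inE eqxx ?orbT.
    by move=> u; rewrite inE => /orP[/eqP->|/memr[]]; rewrite !inE; lia.
  - exists (lid m j.+1).
      by apply: inN; rewrite !inE eqxx ?orbT.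
    by move=> u; rewrite inE => /orP[/eqP->|/memr[]]; rewrite !inE; lia.
have star v : v \in lid m j -> crest m j.+1 :: rem v (lid m j) \in
    stellar (lid m j) (crest m j.+1) (toroid_tris m j).
  move=> vl; apply/flattenP; exists (star_split (lid m j) (crest m j.+1) (lid m j)).
    exact: map_f (lid_toroid m j).
  by rewrite /star_split ifT; [exact: map_f|apply/allP].
rewrite toroid_trisS mem_cat !mem_filter => /orP[/andP[tl tT]|/andP[tl]].
  exists t => //; apply/flattenP; exists (star_split (lid m j) (crest m j.+1) t).
    exact: map_f.
  by rewrite /star_split ifF ?mem_head //; apply: contraNF tl => /(lidE _ tT)->.
rewrite in_cons (negbTE tl) /= !inE => /or3P[]/eqP->.
- exists (crest m j.+1 :: rem (crest m j) (lid m j)); first by apply: star; rewrite !inE eqxx !orbT.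
  by move=> u ul; rewrite in_cons (mem_rem_uniq _ ulid) inE; move: ul; rewrite !inE; lia.
- exists (crest m j.+1 :: rem 1%N (lid m j)); first by apply: star; rewrite !inE.
  by move=> u ul; rewrite in_cons (mem_rem_uniq _ ulid) inE; move: ul; rewrite !inE; lia.
- exists (crest m j.+1 :: rem 0%N (lid m j)); first by apply: star; rewrite !inE.
  by move=> u ul; rewrite in_cons (mem_rem_uniq _ ulid) inE; move: ul; rewrite !inE; lia.
Qed.

(** By [lid_split] the stacked vertices are removed one at a time, each by an inverse stellar
    move. *)
Lemma uncap : homeomorphic (@realization R N (toroid_tris m k)) (@realization R N (chain_tris m)).
Proof.
suff h j : (j <= k)%N ->
    homeomorphic (@realization R N (toroid_tris m j)) (@realization R N (chain_tris m)).
  exact: h.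
elim: j => [|j IH] jk.
  exists idfun, idfun; split; last by split.
  - exact: continuous_subspaceT (@continuous_idfun _).
  - exact: continuous_subspaceT (@continuous_idfun _).
  - by move=> _ [w ? <-].
  - by move=> _ [w ? <-].
rewrite -lid_split //; apply: homeomorphic_trans (IH (ltnW jk)).
apply: homeomorphic_sym; apply: homeomorphic_matchable.
have [slid _] := tri_sortedE (lid_toroid m j).
have cN : (crest m j.+1 < N)%N by rewrite /crest /N; lia.
have lab b v : b \in toroid_tris m j -> v \in b -> (v < crest m j.+1)%N.
  move=> bB vb; exact: (allP (tri_labels (toroid_closed m j) (@toroid_labels m j) bB) v vb).
apply: (@matchable_stellar R N (lid m j) (crest m j.+1) cN _ _ _ _ [:: toroid_tris m j]).
- exact: (sorted_uniq ltn_trans ltnn slid).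
- by [].
- by apply/allP => v vl; apply: ltn_trans cN; exact: lab (lid_toroid m j) vl.
- by apply/negP => /(lab _ _ (lid_toroid m j)); rewrite ltnn.
rewrite /= andbT; apply/allP => t tT; rewrite (tri_uniqS (toroid_closed m j) tT) /=.
by apply/negP => /(lab _ _ tT); rewrite ltnn.
Qed.

Lemma chain_homeomorphic :
  homeomorphic (@realization R N (chain_tris m)) (@sphere_with_handles R m.+1).
Proof.
have [g [gc ginj gs gl gr]] := block_onto_box R.
have h3 : hausdorff_space 'rV[R]_3 by exact: norm_hausdorff.
pose F : 'rV[R]_N -> 'rV[R]_3 := stretch_map m \o chain_map (m := m) (k := k) g.
have -> : @sphere_with_handles R m.+1 = F @` @realization R N (chain_tris m).
  by rewrite /F -stretch_map_image -(chain_map_image m k gs gl gr) image_comp.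
apply: homeomorphic_compact => //; first exact: compact_realization.
  apply: within_comp (continuous_chain_map gc gl gr) _; first exact: subset_refl.
  exact: continuous_subspaceT (@continuous_stretch_map R m).
by move=> w w' cw cw' /stretch_map_inj; exact: chain_map_inj.
Qed.

Lemma frontier_homeomorphic : homeomorphic (frontier (body (toroid_polyhedron R m k)))
  (@realization R N (toroid_tris m k)).
Proof.
apply: homeomorphic_sym.
have h3 : hausdorff_space 'rV[R]_3 by exact: norm_hausdorff.
have cs := toroid_closed m k.
have -> : frontier (body (toroid_polyhedron R m k)) =
    place (@position R m) @` @realization R N (toroid_tris m k).
  rewrite (frontier_solid cs (@toroid_labels m k) (@toroid_coords R m k) (@toroid_inj R m k)).
  apply/seteqP; split=> [x [b bB]|_ [w [b bB wb] <-]].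
    move=> /(tri_hullP (position R m) cs (@toroid_labels m k) _ bB)[w wb <-].
    by exists w => //; exists b.
  by exists b => //; apply/(tri_hullP _ cs (@toroid_labels m k)) => //; exists w.
apply: homeomorphic_compact => //; first exact: compact_realization.
  exact: continuous_subspaceT (@continuous_place _ _ _).
move=> w w' [b bB wb] [b' b'B wb'].
exact: (toroid_inj (tri_realization cs bB wb) (tri_realization cs b'B wb')).
Qed.

Lemma toroid_homeomorphic : homeomorphic (frontier (body (toroid_polyhedron R m k)))
  (@sphere_with_handles R m.+1).
Proof.
apply: homeomorphic_trans frontier_homeomorphic _.
exact: homeomorphic_trans uncap chain_homeomorphic.
Qed.

End Surface.

Theorem theorem6 (R : realType) (p : nat) (hp : (1 <= p)%N)
    (n : nat) (hn : (4 * p + 3 <= n)%N) :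
  exists (P : polyhedron R) (hP : triangulable P),
    [/\ toroid p P, size (vertices P) = n
      & Tmin hP = (n + 3 * (p - 1))%N].
Proof.
(* With [p = m + 1] and [k] stacked tetrahedra, [n = 4 p + 3 + k], so that
   [7 p + k = n + 3 (p - 1)]. *)
case: p hp hn => [//|m] _ hn; pose k := (n - (4 * m.+1 + 3))%N.
exists (toroid_polyhedron R m k).
exists (ex_intro _ (7 * m.+1 + k)%N (toroid_triangulable R m k)); split.
- by split=> //; exact: toroid_homeomorphic.
- by rewrite size_vertices /k; lia.
- by rewrite Tmin_toroid /k; lia.
Qed.
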